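(* For every integer $R\ge3$ there exist threshold numbers $m_R$, $n_R$ and a constant $C_R>0$, depending only on $R$, such that the following hold for all integers $n,m$ with $1\le m\le n-1$. (1) If $a_{n,2}>1$, $m\ge m_R$ and $n\ge n_R$, then $$d_{\mathrm{TV}}(\mu,\nu_R)\le C_R\,\sigma_n\log\sigma_n\left(\frac1{\sqrt m}\right)^R\quad\text{if } m\le\frac n2-1,$$ and $$d_{\mathrm{TV}}(\mu,\nu_R)\le C_R\frac{(\sqrt n)^{R-3}}{(n-m)^{R-2}}\quad\text{if } m\ge\frac n2.$$ (2) If $a_{n,2}<1$ and $n\ge n_R$, then $$d_{\mathrm{TV}}(\mu,\nu_R)\le C_R\frac{n-m}{(\sqrt n)^{R+1}}.$$
   Context: Coupon collector's waiting time: coupons are drawn independently and uniformly at random with replacement from $n$ distinct coupons, and $W_{n,m}$ is the number of draws until $n-m$ distinct coupons have been collected for the first time. Let $\widetilde W_{n,m}=W_{n,m}-(n-m)$; equivalently it is distributed as $\sum_{k=m+1}^n\widetilde X_k$ with independent $\widetilde X_k$ satisfying $\mathbf P(\widetilde X_k=j)=(1-\frac kn)^j\frac kn$, $j=0,1,\ldots$. Let $\sigma_n^2=\mathbf{Var}(W_{n,m})=n\sum_{k=m+1}^n\frac{n-k}{k^2}$ and, for $j\ge1$, $a_{n,j}=\sum_{k=m+1}^n\left(\frac{n-k}k\right)^j$. Let $\mu$ be the distribution of $\widetilde W_{n,m}+c$, where $c=\lfloor a_{n,2}\rfloor$. For an integer $R\ge3$, $\nu_R$ is the finite signed measure on the nonnegative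 integers (a Poisson–Charlier signed measure) whose characteristic function is $$\sum_{j\ge0}e^{itj}\nu_R\{j\}=\exp\{\sigma_n^2(e^{it}-1)\}\,H_R(e^{it}-1),\qquad t\in\mathbb{R},$$ where - if $a_{n,2}>1$: $h_R(w)=-(a_{n,2}-\lfloor a_{n,2}\rfloor)w+(a_{n,2}-\lfloor a_{n,2}\rfloor)\frac{w^2}2+\sum_{r=3}^R\big(a_{n,r}+(-1)^{r+1}\lfloor a_{n,2}\rfloor\big)\frac{w^r}r$ and $H_R(w)=\sum_{l=0}^R\frac{h_R(w)^l}{l!}$; - if $a_{n,2}<1$: $h_R(w)=-a_{n,2}w+a_{n,2}\frac{w^2}2+\sum_{r=3}^Ra_{n,r}\frac{w^r}r$ and $H_R(w)=\sum_{l=0}^{3R-2}\frac{h_R(w)^l}{l!}$. For finite signed measures on $\mathbb{Z}$, $d_{\mathrm{TV}}(\mu,\nu)=\sup_{A\subset\mathbb{Z}}|\mu(A)-\nu(A)|$. *)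

(* Defs.v *)
From HB Require Import structures.
From mathcomp Require Import all_boot all_order all_algebra.
From mathcomp Require Import all_classical all_reals all_analysis.
From mathcomp Require Export complex.

Set Implicit Arguments.
Unset Strict Implicit.
Unset Printing Implicit Defensive.

Import Order.TTheory GRing.Theory Num.Theory.
Import numFieldNormedType.Exports.

Local Open Scope classical_set_scope.
Local Open Scope ring_scope.

HB.instance Definition _ := isPointed.Build int 0.

HB.instance Definition _ := @isMeasurable.Build default_measure_display
  int discrete_measurable discrete_measurable0
  discrete_measurableC discrete_measurableU.

Section CouponCollector.
Context {K : realType} {d : measure_display} {T : measurableType d}.
Context (n : nat) (P : probability T K) (X : nat -> T -> 'I_n).

(* [X i] is the [i]-th coupon drawn, [i = 0, 1, ...].  Independence is the
   product rule over every finite subfamily (listed by [J]). *)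
Record iid_uniform_draws : Prop := IidUniformDraws {
  draw_measurable : forall i k, measurable [set w | X i w = k] ;
  draw_uniform : forall i k, P [set w | X i w = k] = (n%:R^-1)%:E ;
  draw_independent : forall (J : seq nat) (A : nat -> set 'I_n), uniq J ->
    P [set w | forall i, i \in J -> A i (X i w)] =
    (\prod_(i <- J) P [set w | A i (X i w)])%E }.

Definition num_distinct (w : T) (t : nat) : nat :=
  #|[set X i w | i : 'I_t]|%SET.

(* [waiting_time m] is W_{n,m}.  It takes the value 0 on the null event that
   [n - m] distinct coupons are never collected. *)
Definition waiting_time (m : nat) (w : T) : nat :=
  if pselect (exists t, num_distinct w t == (n - m)%N) is left h
  then ex_minn h else 0%N.

End CouponCollector.

Section Quantities.
Context {K : realType}.
Variables n m : nat.

Definition acoef (j : nat) : K :=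
  \sum_(m.+1 <= k < n.+1) ((n%:R - k%:R) / k%:R) ^+ j.

Definition sigma_sq : K :=
  n%:R * \sum_(m.+1 <= k < n.+1) (n%:R - k%:R) / k%:R ^+ 2.

Definition sigma_n : K := Num.sqrt sigma_sq.

Definition cshift : int := Num.floor (acoef 2).

(* The distribution, on the integers, of W_{n,m} - (n - m) + c. *)
Definition mu_law d (T : measurableType d) (P : probability T K)
    (X : nat -> T -> 'I_n) : set int -> \bar K :=
  pushforward P (fun w =>
    (waiting_time X m w)%:Z - (n%:Z - m%:Z) + cshift).

Local Open Scope complex_scope.

Definition cexp (z : K[i]) : K[i] :=
  (expR (complex.Re z))%:C *
  (cos (complex.Im z) +i* sin (complex.Im z)).

(* The value at [a_{n,2} = 1] is irrelevant: that case is always excluded. *)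
Definition hR (R : nat) (w : K[i]) : K[i] :=
  let a := @acoef in
  if 1 < a 2 then
    let fl : K := (Num.floor (a 2))%:~R in
    - (a 2 - fl)%:C * w + (a 2 - fl)%:C * (w ^+ 2 / 2)
    + \sum_(3 <= r < R.+1) (a r + (-1) ^+ r.+1 * fl)%:C * (w ^+ r / r%:R)
  else
    - (a 2)%:C * w + (a 2)%:C * (w ^+ 2 / 2)
    + \sum_(3 <= r < R.+1) (a r)%:C * (w ^+ r / r%:R).

Definition HR (R : nat) (w : K[i]) : K[i] :=
  let L := if 1 < acoef 2 then R else (3 * R - 2)%N in
  \sum_(0 <= l < L.+1) hR R w ^+ l / l`!%:R.

(* [nu] is a finite signed measure carried by the nonnegative integers whose
   characteristic function is exp(sigma_n^2 (e^{it} - 1)) H_R(e^{it} - 1); as a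
   finite signed measure is determined by its characteristic function, at most
   one [nu] qualifies. *)
Definition poisson_charlier (R : nat) (nu : {charge set int -> \bar K}) : Prop :=
  (forall A : set int, A `<=` [set j | j < 0] -> nu A = 0%E) /\
  (forall t : K,
     series (fun j : nat =>
       cexp ((t * j%:R) *i) * (fine (nu [set j%:Z]))%:C : K[i]^o) @ \oo -->
     (cexp (sigma_sq%:C * (cexp (t *i) - 1)) * HR R (cexp (t *i) - 1) : K[i]^o)).

End Quantities.

Definition dTV (K : realType) (mu nu : set int -> \bar K) : \bar K :=
  ereal_sup [set `|mu A - nu A|%E | A in [set: set int]].

(* Main.v *)
(* Laws on the nonnegative integers are power series under the l1 norm.  With
   w = z - 1 and b_k = (n - k) / k, the law of W - (n - m) + c is M(1) for
     M(s) = exp((1 - s) sigma^2 w) (1 + s w)^c prod_k (1 - s b_k w)^-1,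
   while M(0) = exp(sigma^2 w) is Poisson.  The Taylor coefficients of M at
   s = 0 are exp(sigma^2 w) times the coefficients of exp(h_R), so that the
   distance to nu_R is a Taylor remainder.  It is small because w acts as a
   difference operator: |w^p M(s)| <= delta^p, where for s <= 1/2 the smoothing
   comes from the Poisson factor and for s >= 1/2 from a negative binomial
   factor of the product, in both cases by bounding the variance of the score.
   The regimes of n and m differ only in the sizes of delta and of the
   a_{n,r}.  Finally nu_R is recovered from its characteristic function by
   averaging over roots of unity, and the generating function of W follows
   from the recursion in time for the number of distinct coupons. *)
Require Import Defs.
From HB Require Import structures.
From mathcomp Require Import all_boot all_order all_algebra.
From mathcomp Require Import all_classical all_reals all_analysis.
From mathcomp Require Import ring lra zify.
Set Implicit Arguments.
Unset Strict Implicit.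
Unset Printing Implicit Defensive.
Import Order.TTheory GRing.Theory Num.Theory.
Import numFieldNormedType.Exports.
Local Open Scope ring_scope.

(** * Formal power series *)

(** The logarithmic derivative of (1 + s w)^c contains the inverse of 1 + s w = (1 - s) + s z, which
    is not summable for s >= 1/2. So no single M is differentiated repeatedly: each derivative
    lowers the exponent c by one, and the Taylor argument treats all exponents [c - i] together,
    which avoids division.

    Two sizes govern the estimates. [dl] is the gain from one factor w. [ep] is the expansion
    parameter: the coefficient kappa_j of s^j w^(j+1) in the derivative must satisfy |kappa_j|
    dl^(j+1) <= C ep^(j+1). For a_{n,2} > 1 the cubic term a_{n,2} w^3 has size about n^(-1/2) or
    m^(-1/2), so [ep] is only a sixth root of 1/n or 1/m. Hence all scales are written as powers of
    a sixth root [e], and the Taylor order D is taken far above R, beyond the degree of H_R. The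
    surplus terms are then removed by comparing polynomials in w.

    Norms are truncated to the first N coefficients and every bound is uniform in N, so the
    approximation itself never takes a limit of power series. *)

Record fps (K : realType) := Fps { fps_fun : nat -> K }.
Definition fcoef (K : realType) (x : fps K) (j : nat) : K := let: Fps f := x in f j.

Section FpsRing.
Context {K : realType}.
Implicit Types x y z : fps K.

HB.instance Definition _ := gen_eqMixin (fps K).
HB.instance Definition _ := gen_choiceMixin (fps K).

Lemma fpsP x y : (forall j, fcoef x j = fcoef y j) -> x = y.
Proof. by case: x y => [f] [g] /= e; congr Fps; apply/funext. Qed.

Definition fps_zero : fps K := Fps (fun _ => 0).
Definition fps_add x y := Fps (fun j => fcoef x j + fcoef y j).
Definition fps_opp x := Fps (fun j => - fcoef x j).
Definition fps_cst (a : K) := Fps (fun j => if j == 0%N then a else 0).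
Definition fps_mul x y :=
  Fps (fun j => \sum_(i < j.+1) fcoef x i * fcoef y (j - i)).

Fact fps_addA : associative fps_add.
Proof. by move=> x y z; apply: fpsP => j /=; rewrite addrA. Qed.
Fact fps_addC : commutative fps_add.
Proof. by move=> x y; apply: fpsP => j /=; rewrite addrC. Qed.
Fact fps_add0 : left_id fps_zero fps_add.
Proof. by move=> x; apply: fpsP => j /=; rewrite add0r. Qed.
Fact fps_addN : left_inverse fps_zero fps_opp fps_add.
Proof. by move=> x; apply: fpsP => j /=; rewrite addNr. Qed.

HB.instance Definition _ := GRing.isZmodule.Build (fps K)
  fps_addA fps_addC fps_add0 fps_addN.

Definition fps_poly (N : nat) x : {poly K} := \poly_(i < N) fcoef x i.

(** Coefficients below N only see the truncations, so the ring laws are inherited from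
    [{poly K}]. *)
Lemma fcoef_mulE N x y j : (j < N)%N ->
  fcoef (fps_mul x y) j = (fps_poly N x * fps_poly N y)`_j.
Proof.
move=> jN; rewrite coefM /=; apply: eq_bigr => i _; rewrite !coef_poly.
by rewrite (leq_ltn_trans _ jN) ?(leq_ltn_trans _ jN) ?leq_subr -1?ltnS.
Qed.

Fact fps_mulC : commutative fps_mul.
Proof.
move=> x y; apply: fpsP => j.
by rewrite (@fcoef_mulE j.+1 x) // (@fcoef_mulE j.+1 y) // mulrC.
Qed.

Lemma fcoef_mul_sum x y j :
  fcoef (fps_mul x y) j = \sum_(i < j.+1) fcoef x i * fcoef y (j - i).
Proof. by []. Qed.

Fact fps_mulA : associative fps_mul.
Proof.
move=> x y z; apply: fpsP => j; rewrite !(fcoef_mul_sum _ _ j).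
transitivity ((fps_poly j.+1 x * fps_poly j.+1 y * fps_poly j.+1 z)`_j).
  rewrite -mulrA coefM; apply: eq_bigr => i _.
  by rewrite coef_poly ltn_ord (@fcoef_mulE j.+1) ?ltnS ?leq_subr.
rewrite coefM; apply: eq_bigr => i _.
rewrite -(@fcoef_mulE j.+1) ?ltn_ord //.
by rewrite [(fps_poly _ z)`_ _]coef_poly ltnS leq_subr.
Qed.

Fact fps_mul1 : left_id (fps_cst 1) fps_mul.
Proof.
move=> x; apply: fpsP => j /=; rewrite big_ord_recl /= subn0 mul1r big1 ?addr0//.
by move=> i _; rewrite mul0r.
Qed.

Fact fps_mulDl : left_distributive fps_mul fps_add.
Proof.
move=> x y z; apply: fpsP => j /=; rewrite -big_split /=.
by apply: eq_bigr => i _; rewrite mulrDl.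
Qed.

Fact fps_1neq0 : fps_cst 1 != 0 :> fps K.
Proof.
by apply/eqP => /(congr1 (fun x => fcoef x 0)) /= /eqP; rewrite oner_eq0.
Qed.

HB.instance Definition _ := GRing.Zmodule_isComNzRing.Build (fps K)
  fps_mulA fps_mulC fps_mul1 fps_mulDl fps_1neq0.

Lemma fcoefD x y j : fcoef (x + y) j = fcoef x j + fcoef y j. Proof. by []. Qed.
Lemma fcoefB x y j : fcoef (x - y) j = fcoef x j - fcoef y j. Proof. by []. Qed.
Lemma fcoef1 j : fcoef (1 : fps K) j = (j == 0%N)%:R.
Proof. by rewrite /=; case: eqP. Qed.
Lemma fcoefM x y j :
  fcoef (x * y) j = \sum_(i < j.+1) fcoef x i * fcoef y (j - i).
Proof. by []. Qed.

Fact fps_cst_zmod : zmod_morphism fps_cst.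
Proof. by move=> a b; apply: fpsP => j /=; case: eqP => // _; rewrite subrr. Qed.
Fact fps_cst_monoid : monoid_morphism fps_cst.
Proof.
split=> // a b; apply: fpsP => j /=; rewrite big_ord_recl /= subn0 big1 ?addr0.
  by case: eqP; rewrite ?mulr0.
by move=> i _; rewrite mul0r.
Qed.

HB.instance Definition _ := GRing.isZmodMorphism.Build K (fps K) fps_cst
  fps_cst_zmod.
HB.instance Definition _ := GRing.isMonoidMorphism.Build K (fps K) fps_cst
  fps_cst_monoid.

Lemma fcoef_cstM a x j : fcoef (fps_cst a * x) j = a * fcoef x j.
Proof.
rewrite fcoefM big_ord_recl /= subn0 big1 ?addr0 // => i _.
by rewrite mul0r.
Qed.

Definition fps_X : fps K := Fps (fun j => (j == 1%N)%:R).

Lemma fcoef_XM x j : fcoef (fps_X * x) j = if j is j'.+1 then fcoef x j' else 0.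
Proof.
rewrite fcoefM; case: j => [|j]; first by rewrite big_ord1 /= mul0r.
rewrite !big_ord_recl /= mul0r add0r mul1r subSS subn0 big1 ?addr0 // => i _.
by rewrite mul0r.
Qed.

Lemma fcoef_XnM k x j : fcoef (fps_X ^+ k * x) j = if (k <= j)%N then fcoef x (j - k) else 0.
Proof.
elim: k j => [|k IH] j; first by rewrite expr0 mul1r subn0.
by rewrite exprS -mulrA fcoef_XM; case: j => // j; rewrite IH ltnS subSS.
Qed.

Definition fps_w : fps K := fps_X - 1.

Lemma fcoef_wM x j :
  fcoef (fps_w * x) j = (if j is j'.+1 then fcoef x j' else 0) - fcoef x j.
Proof. by rewrite mulrBl mul1r fcoefB fcoef_XM. Qed.

Definition fnorm (N : nat) x : K := \sum_(j < N) `|fcoef x j|.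

Lemma fnorm_ge0 N x : 0 <= fnorm N x.
Proof. exact: sumr_ge0. Qed.

Lemma fnormD N x y : fnorm N (x + y) <= fnorm N x + fnorm N y.
Proof. by rewrite -big_split; apply: ler_sum => i _ /=; exact: ler_normD. Qed.

Lemma fnormN N x : fnorm N (- x) = fnorm N x.
Proof. by apply: eq_bigr => i _ /=; rewrite normrN. Qed.

Lemma fnormB N x y : fnorm N (x - y) <= fnorm N x + fnorm N y.
Proof. by rewrite -[fnorm N y]fnormN fnormD. Qed.

Lemma fnorm0 N : fnorm N 0 = 0.
Proof. by rewrite /fnorm big1 // => i _; rewrite normr0. Qed.

Lemma fnorm_sum N I (r : seq I) (P : pred I) (F : I -> fps K) :
  fnorm N (\sum_(i <- r | P i) F i) <= \sum_(i <- r | P i) fnorm N (F i).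
Proof.
elim/big_rec2: _ => [|i a b _ h]; first by rewrite fnorm0.
by apply: le_trans (fnormD _ _ _) _; rewrite lerD2l.
Qed.

Lemma fnormZ N a x : fnorm N (fps_cst a * x) = `|a| * fnorm N x.
Proof.
by rewrite /fnorm mulr_sumr; apply: eq_bigr => i _; rewrite fcoef_cstM normrM.
Qed.

Lemma fnorm_le N N' x : (N <= N')%N -> fnorm N x <= fnorm N' x.
Proof.
move=> h; rewrite /fnorm -(subnKC h) big_split_ord /= lerDl.
exact: sumr_ge0.
Qed.

Lemma fnormM N x y : fnorm N (x * y) <= fnorm N x * fnorm N y.
Proof.
rewrite /fnorm [leRHS]mulr_suml.
apply: (@le_trans _ _ (\sum_(j < N) \sum_(i < N | (i <= j)%N) `|fcoef x i| * `|fcoef y (j - i)|)).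
  apply: ler_sum => j _; rewrite fcoefM.
  apply: le_trans (ler_norm_sum _ _ _) _.
  rewrite (big_ord_widen_cond N (fun=> true) (fun i => `|fcoef x i * fcoef y (j - i)|)) ?ltn_ord //.
  rewrite le_eqVlt; apply/orP; left; apply/eqP.
  by apply: eq_big => [i|i _]; rewrite ?ltnS ?normrM.
rewrite (exchange_big_dep xpredT) //=; apply: ler_sum => i _.
rewrite -mulr_sumr; apply: ler_wpM2l => //.
have -> : \sum_(j < N | (i <= j)%N) `|fcoef y (j - i)| =
          \sum_(j < N - i) `|fcoef y j|.
  rewrite -(big_mkord (fun j => (i <= j)%N) (fun j => `|fcoef y (j - i)|)).
  rewrite (big_cat_nat (n := i)) /= ?(ltnW (ltn_ord i)) //.
  rewrite big_nat_cond big_pred0 ?add0r; last first.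
    by move=> j; case: ltngtP => //; rewrite ?andbF.
  rewrite -{1}[nat_of_ord i]add0n big_addn big_mkord.
  by apply: eq_big => [j|j _]; rewrite ?leq_addl ?addnK.
exact: (@fnorm_le _ _ y (leq_subr i N)).
Qed.

(** Stands in for sub-probability laws: only the l1 bound is recorded, and products and mixtures
    preserve it. *)
Definition subprob x := forall N, fnorm N x <= 1.

Lemma subprobM x y : subprob x -> subprob y -> subprob (x * y).
Proof.
move=> hx hy N; apply: le_trans (fnormM _ _ _) _.
by apply: mulr_ile1; rewrite ?fnorm_ge0.
Qed.

Lemma fnorm_cst N a : fnorm N (fps_cst a) <= `|a|.
Proof.
case: N => [|N]; first by rewrite /fnorm big_ord0.
by rewrite /fnorm big_ord_recl /= big1 ?addr0 // => i _; rewrite normr0.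
Qed.

Lemma subprob1 : subprob 1.
Proof. by move=> N; apply: le_trans (fnorm_cst N 1) _; rewrite normr1. Qed.

Lemma subprobX x k : subprob x -> subprob (x ^+ k).
Proof.
move=> hx; elim: k => [|k IH]; first by rewrite expr0; exact: subprob1.
by rewrite exprS; apply: subprobM.
Qed.

Lemma subprob_prod I (r : seq I) (P : pred I) (F : I -> fps K) :
  (forall i, P i -> subprob (F i)) -> subprob (\prod_(i <- r | P i) F i).
Proof.
by move=> h; elim/big_rec: _ => [|i y Pi ?]; [exact: subprob1|apply: subprobM; first exact: h].
Qed.

Lemma subprob_fps_X : subprob fps_X.
Proof.
case=> [|[|N]]; rewrite /fnorm ?big_ord0 // ?big_ord1 /= ?normr0 //.
by rewrite !big_ord_recl /= big1 ?normr0 ?normr1 ?add0r ?addr0 // => i _; rewrite normr0.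
Qed.

Lemma subprob_mix a x y : 0 <= a <= 1 -> subprob x -> subprob y ->
  subprob (fps_cst a * x + fps_cst (1 - a) * y).
Proof.
move=> /andP[a0 a1] hx hy N; apply: le_trans (fnormD _ _ _) _.
rewrite !fnormZ ger0_norm // (ger0_norm (x := 1 - a)) ?subr_ge0 //.
rewrite -[leRHS](_ : a * 1 + (1 - a) * 1 = 1); last by ring.
by apply: lerD; apply: ler_wpM2l; rewrite ?subr_ge0 ?hx ?hy.
Qed.

Lemma fnorm_w N : fnorm N fps_w <= 2.
Proof.
apply: le_trans (fnormB _ _ _) _.
by rewrite (_ : 2 = 1 + 1) // lerD ?subprob_fps_X ?subprob1.
Qed.

(** Lets the smoothing bounds start the truncation beyond the mean, where the boundary term of a
    truncated variance has the favourable sign. *)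
Lemma fnorm_large x (B : K) (N0 : nat) :
  (forall N, (N0 <= N)%N -> fnorm N x <= B) -> forall N, fnorm N x <= B.
Proof.
move=> h N; apply: le_trans (fnorm_le x (leq_maxl N N0)) _.
by apply: h; rewrite leq_maxr.
Qed.

End FpsRing.

Lemma le_of_eq (K : realType) (a b : K) : a = b -> a <= b.
Proof. by move=> ->. Qed.

(** * Geometric, negative binomial and Poisson laws *)

Section Laws.
Context {K : realType}.
Implicit Types (b p lam : K).

(** The geometric law of mean b, whose generating function is the inverse of 1 - b w. *)
Definition geo b : fps K :=
  Fps (fun j => (1 - b / (1 + b)) * (b / (1 + b)) ^+ j).

Lemma geoK b : 0 <= b -> (1 - fps_cst b * fps_w) * geo b = 1.
Proof.
move=> b0; have b1 : 1 + b != 0 by lra.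
apply: fpsP => j; rewrite mulrBl mul1r -mulrA fcoefB fcoef_cstM fcoef_wM fcoef1.
case: j => [|j] /=; first by field.
by rewrite exprS; field.
Qed.

Lemma geoE b : 0 <= b -> geo b = 1 + fps_cst b * fps_w * geo b.
Proof. by move=> b0; rewrite -{1}(geoK b0) mulrBl mul1r subrK. Qed.

Lemma geo_uniq b x : 0 <= b -> (1 - fps_cst b * fps_w) * x = 1 -> x = geo b.
Proof.
by move=> b0 h; rewrite -[x]mul1r -(geoK b0) mulrAC h mul1r.
Qed.

Lemma geo0 : geo 0 = 1.
Proof. by apply/esym/geo_uniq => //; rewrite rmorph0 mul0r subr0 mulr1. Qed.

Lemma ratio01 b : 0 <= b -> 0 <= b / (1 + b) < 1.
Proof.
by move=> b0; rewrite divr_ge0 ?addr_ge0 //= ltr_pdivrMr ?mul1r ?ltrDr // ltr_pwDl.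
Qed.

Lemma subprob_geo b : 0 <= b -> subprob (geo b).
Proof.
move=> b0 N; have /andP[p0 p1] := ratio01 b0.
rewrite /fnorm /= (eq_bigr (fun j : 'I_N => (1 - b / (1 + b)) * (b / (1 + b)) ^+ j)).
  by rewrite -mulr_sumr -opprB mulNr -subrX1 opprB lerBlDr lerDl exprn_ge0.
by move=> j _; rewrite ger0_norm // mulr_ge0 ?exprn_ge0 // subr_ge0 ltW.
Qed.

(** The quotient of two geometric laws is a mixture of the unit mass and [geo b]. A geometric factor
    can thus be traded for one of smaller mean at the cost of a bounded factor. *)
Lemma subprob_geo_ratio b b' : 0 <= b' <= b ->
  subprob ((1 - fps_cst b' * fps_w) * geo b).
Proof.
move=> /andP[b'0 b'b]; have b0 := le_trans b'0 b'b.
have [b'z|b'n] := eqVneq b' 0.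
  by rewrite b'z rmorph0 mul0r subr0 mul1r; exact: subprob_geo.
have bp : 0 < b by rewrite (lt_le_trans _ b'b) // lt0r b'n.
have -> : (1 - fps_cst b' * fps_w) * geo b =
  fps_cst (b' / b) * 1 + fps_cst (1 - b' / b) * geo b.
  rewrite -[X in _ * X + _](geoK b0) -{1}[b'](@divfK _ b) ?gt_eqF //.
  by ring.
apply: subprob_mix; [|exact: subprob1|exact: subprob_geo].
by rewrite divr_ge0 // ler_pdivrMr // mul1r.
Qed.

(** The series exp(lam w), whose coefficients in z are the Poisson weights. *)
Definition expw lam : fps K := Fps (fun j => expR (- lam) * (lam ^+ j / j`!%:R)).

Lemma expwD lam mu : expw (lam + mu) = expw lam * expw mu.
Proof.
apply: fpsP => j; rewrite fcoefM /= opprD expRD.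
under eq_bigr => i _ do rewrite mulrACA.
rewrite -mulr_sumr; congr (_ * _).
rewrite addrC exprDn mulr_suml; apply: eq_bigr => i _.
have ij : (i <= j)%N by rewrite -ltnS.
have := bin_fact ij => /(congr1 (fun k => k%:R : K)); rewrite !natrM => <-.
have := fact_gt0 i; have := fact_gt0 (j - i); rewrite -!(ltr0n K) => h1 h2.
have h3 : 0 < ('C(j, i))%:R :> K by rewrite ltr0n bin_gt0.
rewrite -mulr_natr; field; rewrite !gt_eqF //.
Qed.

Lemma expw0 : expw 0 = 1.
Proof.
apply: fpsP => j; rewrite fcoef1 /= oppr0 expR0 mul1r.
by case: j => [|j]; rewrite ?expr0 ?divr1 // expr0n mul0r.
Qed.

Lemma expwX lam k : expw lam ^+ k = expw (lam *+ k).
Proof.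
elim: k => [|k IH]; first by rewrite expr0 mulr0n expw0.
by rewrite exprS IH mulrS expwD.
Qed.

Lemma exp_partial_sum lam N : 0 <= lam ->
  \sum_(j < N) lam ^+ j / j`!%:R <= expR lam.
Proof.
move=> l0; rewrite -(big_mkord xpredT (fun j => lam ^+ j / j`!%:R)).
apply: (nondecreasing_cvgn_le (u_ := series (exp_coeff lam))).
  by apply: nondecreasing_series => i *; exact: exp_coeff_ge0.
exact: is_cvg_series_exp_coeff.
Qed.

Lemma fcoef_expw_ge0 lam j : 0 <= lam -> 0 <= fcoef (expw lam) j.
Proof. by move=> l0; rewrite /= mulr_ge0 ?expR_ge0 // divr_ge0 ?exprn_ge0. Qed.

Lemma fnorm_nneg N (x : fps K) : (forall j, 0 <= fcoef x j) ->
  fnorm N x = \sum_(j < N) fcoef x j.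
Proof. by move=> h; apply: eq_bigr => i _; rewrite ger0_norm. Qed.

Lemma subprob_expw lam : 0 <= lam -> subprob (expw lam).
Proof.
move=> l0 N; rewrite fnorm_nneg => [|j]; last exact: fcoef_expw_ge0.
rewrite /= -mulr_sumr expRN -ler_pdivlMl ?invr_gt0 ?expR_gt0 // invrK mulr1.
exact: exp_partial_sum.
Qed.

(** The subtraction alters only the first two coefficients, which are estimated by hand; the others
    are Poisson weights, controlled by the total mass. *)
Lemma fnorm_expw_lin N h : 0 <= h ->
  fnorm N (expw h - 1 - fps_cst h * fps_w) <= 3 * h ^+ 2.
Proof.
move=> h0; move: N; apply: (@fnorm_large _ _ _ 2) => -[|[|N]] // _.
have e1 : 1 - h <= expR (- h) by rewrite expR_ge1Dx.
have e2 : expR (- h) <= 1 - h + h ^+ 2.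
  rewrite expRN; apply: (@le_trans _ _ (1 + h)^-1).
    by rewrite lef_pV2 ?posrE ?expR_gt0 ?ltr_pwDl // expR_ge1Dx.
  rewrite -[leLHS]mul1r ler_pdivrMr ?ltr_pwDl //.
  have -> : (1 - h + h ^+ 2) * (1 + h) = 1 + h ^+ 3 by ring.
  by rewrite lerDl exprn_ge0.
rewrite /fnorm !big_ord_recl.
have s := subprob_expw h0 N.+2; rewrite fnorm_nneg in s => [|j]; last exact: fcoef_expw_ge0.
rewrite !big_ord_recl /= in s.
have -> : \sum_(i < N) `|fcoef (expw h - 1 - fps_cst h * fps_w) (lift ord0 (lift ord0 i))|
  = \sum_(i < N) expR (- h) * (h ^+ bump 0 (bump 0 i) / (bump 0 (bump 0 i))`!%:R).
  apply: eq_bigr => i _; rewrite !fcoefB fcoef1 fcoef_cstM /= subrr mulr0 subr0 subr0.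
  by rewrite ger0_norm // mulr_ge0 ?expR_ge0 // divr_ge0 ?exprn_ge0.
rewrite !fcoefB !fcoef1 !fcoef_cstM /=.
rewrite /bump /= !expr0 !expr1 !fact0 !divr1 in s *.
set rest := \sum_(i < N) _ in s *.
have h2 : 0 <= h ^+ 2 by rewrite exprn_ge0.
have -> : `|expR (- h) * 1 - 1 - h * (0 - 1)| = expR (- h) - 1 + h.
  by rewrite ger0_norm; lra.
have -> : `|expR (- h) * h - 0 - h * (1 - 0)| = h - expR (- h) * h.
  rewrite !subr0 mulr1 distrC ger0_norm // -{1}[h]mul1r -mulrBl mulr_ge0 // subr_ge0.
  by rewrite expRN invf_le1 ?expR_gt0 // -expR0 ler_expR.
have : (1 - h) * (1 + h) <= expR (- h) * (1 + h) by rewrite ler_pM2r // ltr_pwDl.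
have := ler_wpM2r h0 e1.
by move: s; rewrite expr2; lra.
Qed.

(* The total variation of [w * x] is the mean absolute value of its score
   [rho]; it is bounded by the root mean square. *)
Lemma score_bound N (x : fps K) (rho : nat -> K) (V : K) :
  (forall j, 0 <= fcoef x j) -> fnorm N x <= 1 ->
  (forall j, fcoef (fps_w * x) j = fcoef x j * rho j) ->
  0 < V -> \sum_(j < N) fcoef x j * rho j ^+ 2 <= V ->
  fnorm N (fps_w * x) <= Num.sqrt V.
Proof.
move=> x0 x1 hrho V0 hV.
have s0 : 0 < Num.sqrt V by rewrite sqrtr_gt0.
have sV : Num.sqrt V ^+ 2 = V by rewrite sqr_sqrtr // ltW.
rewrite fnorm_nneg // in x1.
(* The pointwise bound |r| <= (r^2 / v + v) / 2 with v the root of V, summed against the weights,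
   plays the part of Cauchy-Schwarz. *)
have -> : Num.sqrt V = (Num.sqrt V)^-1 / 2 * V + Num.sqrt V / 2.
  by rewrite -{3}sV; field; rewrite gt_eqF.
apply: (@le_trans _ _ ((Num.sqrt V)^-1 / 2 * \sum_(j < N) fcoef x j * rho j ^+ 2
    + Num.sqrt V / 2 * \sum_(j < N) fcoef x j)); last first.
  apply: lerD; first by rewrite ler_wpM2l // divr_ge0 // invr_ge0 ltW.
  by rewrite -[leRHS]mulr1 ler_wpM2l // divr_ge0 // ltW.
rewrite !mulr_sumr -big_split; apply: ler_sum => j _.
rewrite hrho normrM (ger0_norm (x0 j)).
rewrite [leRHS](_ : _ = fcoef x j * ((Num.sqrt V)^-1 / 2 * (rho j ^+ 2 + Num.sqrt V ^+ 2))).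
  rewrite ler_wpM2l // mulrAC ler_pdivlMr // mulrC ler_pdivlMl //.
  have : 0 <= (`|rho j| - Num.sqrt V) ^+ 2 by rewrite sqr_ge0.
  rewrite sqrrB real_normK ?num_real // -mulr_natr; lra.
by rewrite /=; field; rewrite gt_eqF.
Qed.

Lemma poisson_smooth N lam : 0 < lam ->
  fnorm N (fps_w * expw lam) <= (Num.sqrt lam)^-1.
Proof.
move=> l0; move: N; apply: (@fnorm_large _ _ _ (Num.truncn lam).+1) => N hN.
have lN : lam <= N%:R by rewrite ltW // (lt_le_trans (truncnS_gt lam)) // ler_nat.
rewrite -sqrtrV; last exact: ltW.
apply: (@score_bound _ _ (fun j => j%:R / lam - 1)).
- by move=> j; apply/fcoef_expw_ge0/ltW.
- by apply/subprob_expw/ltW.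
- move=> j; rewrite fcoef_wM; case: j => [|j] /=; first by ring.
  rewrite factS natrM exprS; field.
  by rewrite gt_eqF //= gt_eqF ?ltr0n ?fact_gt0 //= ?nat1r ?pnatr_eq0.
- by rewrite invr_gt0.
(* Truncated form of variance = mean: the Poisson recursion makes the sum telescope, and the
   boundary term is nonpositive once the truncation exceeds lam. *)
have tele M : \sum_(j < M) fcoef (expw lam) j * ((j%:R - lam) ^+ 2 - lam) =
    (lam - M%:R) * (M%:R * fcoef (expw lam) M).
  elim: M => [|M IH]; first by rewrite big_ord0 /=; ring.
  rewrite big_ord_recr /= IH /= factS natrM [_ ^+ M.+1]exprS -natr1.
  have f0 : (M`!)%:R != 0 :> K by rewrite pnatr_eq0 -lt0n fact_gt0.
  have M0 : M%:R + 1 != 0 :> K by rewrite natr1 pnatr_eq0.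
  by field; rewrite M0 f0.
have : \sum_(j < N) fcoef (expw lam) j * ((j%:R - lam) ^+ 2 - lam) <= 0.
  rewrite tele mulr_le0_ge0 ?subr_le0 // mulr_ge0 //.
  by apply/fcoef_expw_ge0/ltW.
have := subprob_expw (ltW l0) N; rewrite fnorm_nneg => [h1 h2|j]; last first.
  by apply/fcoef_expw_ge0/ltW.
rewrite [leLHS](_ : _ = lam ^- 2 * (\sum_(j < N) fcoef (expw lam) j * ((j%:R - lam) ^+ 2 - lam)
   + lam * \sum_(j < N) fcoef (expw lam) j)); last first.
  rewrite mulr_sumr -big_split mulr_sumr; apply: eq_bigr => j _ /=.
  by field; rewrite gt_eqF ?ltr0n ?fact_gt0 //= gt_eqF.
rewrite [leRHS](_ : _ = lam ^- 2 * (0 + lam * 1)); last by field; rewrite gt_eqF.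
rewrite ler_wpM2l ?invr_ge0 ?exprn_ge0 ?(ltW l0) // lerD // ler_wpM2l //; exact: ltW.
Qed.

Definition nb b k : fps K :=
  Fps (fun j => 'C(k + j, j)%:R * (1 - b / (1 + b)) ^+ k.+1 * (b / (1 + b)) ^+ j).

Lemma nbE b k : 0 <= b -> geo b ^+ k.+1 = nb b k.
Proof.
move=> b0; have b1 : 1 + b != 0 by lra.
elim: k => [|k IH].
  by rewrite expr1; apply: fpsP => j /=; rewrite add0n binn mul1r expr1.
rewrite exprS IH.
have <- : (1 - fps_cst b * fps_w) * nb b k.+1 = nb b k.
  apply: fpsP => j; rewrite mulrBl mul1r -mulrA fcoefB fcoef_cstM fcoef_wM.
  case: j => [|j] /=; first by rewrite !addn0 !bin0 !exprS; field.
  have -> : 'C(k.+1 + j.+1, j.+1) = ('C(k + j.+1, j.+1) + 'C(k.+1 + j, j))%N.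
    by rewrite addSn binS addSnnS.
  rewrite natrD.
  by rewrite !exprS; field.
by rewrite mulrA [geo b * _]mulrC geoK // mul1r.
Qed.

Lemma nb_recur b k j :
  j.+1%:R * fcoef (nb b k) j.+1 = b / (1 + b) * (k.+1 + j)%:R * fcoef (nb b k) j.
Proof.
have e : j.+1%:R * 'C(k + j.+1, j.+1)%:R = (k.+1 + j)%:R * 'C(k + j, j)%:R :> K.
  by rewrite -!natrM addnS -mul_bin_diag addSn.
by rewrite /= [_ ^+ j.+1]exprS !mulrA e; ring.
Qed.

Lemma nb_shift b k j :
  (k.+1 * k.+2)%:R * fcoef (nb b k.+2) j =
  (1 - b / (1 + b)) ^+ 2 * ((k.+1 + j) * (k.+2 + j))%:R * fcoef (nb b k) j.
Proof.
have e : (k.+1 * k.+2 * 'C(k.+2 + j, j) = (k.+1 + j) * (k.+2 + j) * 'C(k + j, j))%N.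
  have e1 i : (i.+1 * 'C(i.+1 + j, j) = (i.+1 + j) * 'C(i + j, j))%N.
    by have := mul_bin_down (i.+1 + j) j; rewrite addnK addSn => <-.
  by rewrite -mulnA e1 mulnCA e1 mulnA [(_ * (k.+1 + j))%N]mulnC.
have {}e := congr1 (fun i => i%:R : K) e; rewrite !natrM in e.
rewrite /= !natrM !exprS !mulrA e; ring.
Qed.

Lemma fcoef_nb_ge0 b k j : 0 <= b -> 0 <= fcoef (nb b k) j.
Proof.
move=> b0; have /andP[p0 p1] := ratio01 b0.
by rewrite /= !mulr_ge0 ?exprn_ge0 // subr_ge0 ltW.
Qed.

(** The score of this law has denominator [k.+2 + j]. By [nb_shift], two of the geometric factors
    absorb its square, and what is left is a second moment under [nb b k], computed by
    telescoping. *)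
Lemma nb_smooth N b k : 0 < b ->
  fnorm N (fps_w * geo b ^+ k.+3) <= (Num.sqrt (b * (1 + b) * k.+1%:R))^-1.
Proof.
move=> b0; have bn := ltW b0; have b1 : 0 < 1 + b by lra.
have /andP[p0 p1] := ratio01 bn.
rewrite nbE //; move: N.
apply: (@fnorm_large _ _ _ (Num.truncn (b * k.+2%:R)).+1) => N hN.
have lN : b * k.+2%:R <= N%:R by rewrite ltW // (lt_le_trans (truncnS_gt _)) // ler_nat.
have sub i : fnorm N (nb b i) <= 1 by rewrite -nbE //; apply/subprobX/subprob_geo.
set p := b / (1 + b) in p0 p1; set q : K := 1 - p.
have pE : p = b / (1 + b) by [].
have ppos : 0 < p by rewrite divr_gt0.
have qpos : 0 < q by rewrite subr_gt0.
have k1 : 0 < k.+1%:R :> K by rewrite ltr0n.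
have k2 : 0 < k.+2%:R :> K by rewrite ltr0n.
rewrite -sqrtrV; last by apply/ltW; rewrite !mulr_gt0.
apply: (@score_bound _ _ (fun j => (q * j%:R - p * k.+2%:R) / (p * (k.+2 + j)%:R))).
- by move=> j; exact: fcoef_nb_ge0.
- exact: sub.
- move=> j; rewrite fcoef_wM; case: j => [|j].
    by rewrite sub0r addn0 mulr0 sub0r mulNr divff ?mulrN1 // mulf_neq0 ?gt_eqF.
  have j1 : 0 < j.+1%:R :> K by rewrite ltr0n.
  have k3 : 0 < (k.+3 + j)%:R :> K by rewrite ltr0n.
  have := nb_recur b k.+2 j; rewrite -pE => e.
  have -> : fcoef (nb b k.+2) j = j.+1%:R * fcoef (nb b k.+2) j.+1 / (p * (k.+3 + j)%:R).
    by rewrite e; field; rewrite !gt_eqF.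
  rewrite addnS -addSn; have := k3; rewrite addSnnS natrD => k3'.
  by rewrite /q; field; rewrite !gt_eqF.
- by rewrite invr_gt0 !mulr_gt0.
have c0 : 0 <= q ^+ 2 / (p ^+ 2 * k.+1%:R * k.+2%:R).
  apply: divr_ge0; first exact: sqr_ge0.
  by do 2![apply: mulr_ge0 => //]; exact: sqr_ge0.
set g := fcoef (nb b k).
(* Under [nb b k] the variable [q * j] has mean [p * k.+1] and variance [p * k.+1]; centring at
   [p * k.+2] adds the [p ^+ 2]. *)
have tele M : \sum_(j < M) g j * ((q * j%:R - p * k.+2%:R) ^+ 2 - (p * k.+1%:R + p ^+ 2)) =
    (p * k.+2%:R - q * M%:R) * (M%:R * g M).
  elim: M => [|M IH]; first by rewrite big_ord0 /=; ring.
  rewrite big_ord_recr /= IH /g nb_recur -pE -/g /q natrD -!natr1; ring.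
have tot : \sum_(j < N) g j * ((q * j%:R - p * k.+2%:R) ^+ 2 - (p * k.+1%:R + p ^+ 2)) <= 0.
  rewrite tele mulr_le0_ge0 //; last by rewrite mulr_ge0 // fcoef_nb_ge0.
  have -> : p * k.+2%:R = q * (b * k.+2%:R) by rewrite /q /p; field; rewrite gt_eqF.
  by rewrite subr_le0 ler_pM2l.
have mass : \sum_(j < N) g j <= 1.
  by have := sub k; rewrite fnorm_nneg // => j; exact: fcoef_nb_ge0.
have sq : \sum_(j < N) g j * (q * j%:R - p * k.+2%:R) ^+ 2 <= p * k.+1%:R + p ^+ 2.
  move: tot; under eq_bigr => j _ do rewrite mulrBr.
  rewrite sumrB -mulr_suml subr_le0 => /le_trans; apply.
  rewrite -[leRHS]mul1r ler_wpM2r //.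
  by apply: addr_ge0; [apply: mulr_ge0|apply: exprn_ge0].
apply: (@le_trans _ _ (q ^+ 2 / (p ^+ 2 * k.+1%:R * k.+2%:R) *
    \sum_(j < N) g j * (q * j%:R - p * k.+2%:R) ^+ 2)).
  rewrite mulr_sumr; apply: ler_sum => j _.
  have := nb_shift b k j; rewrite -/g -pE -/q !natrM => e.
  have k2j : 0 < (k.+2 + j)%:R :> K by rewrite ltr0n.
  have -> : fcoef (nb b k.+2) j = q ^+ 2 * ((k.+1 + j)%:R * (k.+2 + j)%:R) * g j / (k.+1%:R * k.+2%:R).
    by rewrite -e; field; rewrite !gt_eqF.
  rewrite [leLHS](_ : _ = (k.+1 + j)%:R / (k.+2 + j)%:R *
     (q ^+ 2 / (p ^+ 2 * k.+1%:R * k.+2%:R) * (g j * (q * j%:R - p * k.+2%:R) ^+ 2))); last first.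
    by field; rewrite !gt_eqF.
  rewrite -[leRHS]mul1r ler_wpM2r //.
    apply: mulr_ge0; first exact: c0.
    by rewrite mulr_ge0 ?sqr_ge0 ?fcoef_nb_ge0.
  by rewrite ler_pdivrMr // mul1r ler_nat leq_add2r.
apply: (@le_trans _ _ (q ^+ 2 / (p ^+ 2 * k.+1%:R * k.+2%:R) * (p * k.+1%:R + p ^+ 2))).
  by rewrite ler_wpM2l // c0.
have -> : (b * (1 + b) * k.+1%:R)^-1 = q ^+ 2 / (p ^+ 2 * k.+1%:R * k.+2%:R) * (p * k.+2%:R).
  by rewrite /q /p; field; rewrite !gt_eqF.
rewrite ler_wpM2l //.
by rewrite expr2 -mulrDr ler_wpM2l // -(@natr1 K k.+1) lerD2l ltW.
Qed.

End Laws.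

Lemma triangle_sum (V : zmodType) (F : nat -> nat -> V) d :
  \sum_(q < d) \sum_(j < q.+1) F j (q - j)%N =
  \sum_(j < d) \sum_(q < d - j) F j q.
Proof.
elim: d => [|d IH]; first by rewrite !big_ord0.
rewrite big_ord_recr /= IH [in RHS]big_ord_recr /= subSnn big_ord1.
rewrite [X in _ + X]big_ord_recr /= subnn addrA; congr (_ + _).
rewrite -big_split; apply: eq_bigr => j _ /=.
by rewrite subSn ?(ltnW (ltn_ord j)) // big_ord_recr.
Qed.

(** * Taylor expansion of families of power series *)

Section Derivatives.
Context {K : realType}.
Variable N : nat.
Implicit Types f g : K -> fps K.

Definition fbounded f :=
  exists B : K, forall s : K, 0 <= s <= 1 -> fnorm N (f s) <= B.

(* The uniform quadratic error gives a mean value inequality by subdividing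
   the interval. *)
Definition fder f f' := [/\ fbounded f, fbounded f' &
  exists B : K, forall s t : K, 0 <= s -> s <= t -> t <= 1 ->
    fnorm N (f t - f s - fps_cst (t - s) * f' s) <= B * (t - s) ^+ 2].

Lemma fbounded_ge0 f : fbounded f ->
  exists2 B : K, 0 <= B & forall s : K, 0 <= s <= 1 -> fnorm N (f s) <= B.
Proof.
move=> [B hB]; exists B => //.
by apply: le_trans _ (hB 0 _); rewrite ?fnorm_ge0 ?lexx ?ler01.
Qed.

Lemma fboundedM f g : fbounded f -> fbounded g -> fbounded (fun s => f s * g s).
Proof.
move=> /fbounded_ge0[A A0 hA] /fbounded_ge0[B B0 hB]; exists (A * B) => s hs.
apply: le_trans (fnormM _ _ _) _.
by apply: ler_pM; rewrite ?fnorm_ge0 ?hA ?hB.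
Qed.

Lemma fboundedD f g : fbounded f -> fbounded g -> fbounded (fun s => f s + g s).
Proof.
move=> [A hA] [B hB]; exists (A + B) => s hs.
by apply: le_trans (fnormD _ _ _) _; apply: lerD; [exact: hA|exact: hB].
Qed.

Lemma fbounded_cst x : fbounded (fun=> x).
Proof. by exists (fnorm N x). Qed.

Lemma fder_cst x : fder (fun=> x) (fun=> 0).
Proof.
split; [exact: fbounded_cst|exact: fbounded_cst|].
by exists 0 => s t _ _ _; rewrite mulr0 !subrr fnorm0 mul0r.
Qed.

Lemma fder_id : fder (fun s => fps_cst s) (fun=> 1).
Proof.
split; [|exact: fbounded_cst|].
  by exists 1 => s /andP[s0 s1]; apply: le_trans (fnorm_cst _ _) _; rewrite ger0_norm.
by exists 0 => s t _ _ _; rewrite mulr1 -rmorphB subrr fnorm0 mul0r.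
Qed.

Lemma fderD f f' g g' : fder f f' -> fder g g' ->
  fder (fun s => f s + g s) (fun s => f' s + g' s).
Proof.
move=> [bf bf' [A hA]] [bg bg' [B hB]].
split; [exact: fboundedD|exact: fboundedD|exists (A + B) => s t s0 st t1].
have -> : f t + g t - (f s + g s) - fps_cst (t - s) * (f' s + g' s) =
  (f t - f s - fps_cst (t - s) * f' s) + (g t - g s - fps_cst (t - s) * g' s).
  by ring.
by apply: le_trans (fnormD _ _ _) _; rewrite mulrDl lerD ?hA ?hB.
Qed.

Lemma fderM f f' g g' : fder f f' -> fder g g' ->
  fder (fun s => f s * g s) (fun s => f' s * g s + f s * g' s).
Proof.
move=> [bf bf' [A hA]] [bg bg' [B hB]].
split; [exact: fboundedM|by apply: fboundedD; apply: fboundedM|].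
move: bf bf' bg bg' => /fbounded_ge0[F F0 hF] /fbounded_ge0[F' F'0 hF']
  /fbounded_ge0[G G0 hG] /fbounded_ge0[G' G'0 hG'].
exists (A * G + F' * (`|B| + G') + F * B) => s t s0 st t1.
have hs : 0 <= s <= 1 by rewrite s0 (le_trans st).
have ht : 0 <= t <= 1 by rewrite t1 (le_trans s0).
have h0 : 0 <= t - s by rewrite subr_ge0.
have h1 : t - s <= 1 by lra.
have -> : f t * g t - f s * g s - fps_cst (t - s) * (f' s * g s + f s * g' s) =
  (f t - f s - fps_cst (t - s) * f' s) * g t +
  fps_cst (t - s) * (f' s * (g t - g s)) +
  f s * (g t - g s - fps_cst (t - s) * g' s) by ring.
have inc : fnorm N (g t - g s) <= (`|B| + G') * (t - s).
  have -> : g t - g s = (g t - g s - fps_cst (t - s) * g' s) + fps_cst (t - s) * g' s.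
    by ring.
  apply: le_trans (fnormD _ _ _) _; rewrite mulrDl; apply: lerD.
    apply: le_trans (hB _ _ _ _ _) _ => //.
    apply: (@le_trans _ _ (`|B| * (t - s) ^+ 2)).
      by rewrite ler_wpM2r ?exprn_ge0 ?ler_norm.
    by rewrite ler_wpM2l // expr2 ler_piMr.
  by rewrite fnormZ ger0_norm // mulrC ler_wpM2r // hG'.
rewrite [leRHS]mulrDl [X in _ <= X + _]mulrDl; apply: le_trans (fnormD _ _ _) _; apply: lerD.
  apply: le_trans (fnormD _ _ _) _; apply: lerD.
    apply: le_trans (fnormM _ _ _) _; rewrite mulrAC.
    by apply: ler_pM; rewrite ?fnorm_ge0 ?hA ?hG.
  rewrite fnormZ ger0_norm //.
  apply: (@le_trans _ _ ((t - s) * (F' * ((`|B| + G') * (t - s))))); last first.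
    by apply: le_of_eq; ring.
  rewrite ler_wpM2l //; apply: le_trans (fnormM _ _ _) _.
  by apply: ler_pM; rewrite ?fnorm_ge0 ?hF'.
apply: le_trans (fnormM _ _ _) _; rewrite -mulrA.
by apply: ler_pM; rewrite ?fnorm_ge0 ?hF ?hB.
Qed.

Lemma fder_eq f f' g g' : f =1 g -> f' =1 g' -> fder f f' -> fder g g'.
Proof. by move=> /funext <- /funext <-. Qed.

Lemma fderZ x f f' : fder f f' -> fder (fun s => x * f s) (fun s => x * f' s).
Proof.
move=> h; have := fderM (fder_cst x) h.
by apply: fder_eq => s //; rewrite mul0r add0r.
Qed.

Lemma fder_sum (I : Type) (r : seq I) (F F' : I -> K -> fps K) :
  (forall i, fder (F i) (F' i)) ->
  fder (fun s => \sum_(i <- r) F i s) (fun s => \sum_(i <- r) F' i s).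
Proof.
move=> h; elim: r => [|i r IH].
  by apply: fder_eq (fder_cst 0) => s; rewrite big_nil.
by apply: fder_eq (fderD (h i) IH) => s; rewrite big_cons.
Qed.

Lemma fderX f f' k : fder f f' ->
  fder (fun s => f s ^+ k) (fun s => f s ^+ k.-1 *+ k * f' s).
Proof.
move=> h; elim: k => [|k IH].
  by apply: fder_eq (fder_cst 1) => s; rewrite ?mulr0n ?mul0r.
apply: fder_eq (fderM h IH) => s; first by rewrite exprS.
case: k {IH} => [|k]; first by rewrite /= !expr0 mulr0n mul0r mulr0 addr0 mulr1n mulr1 mul1r.
by rewrite /= -[_ *+ k.+1]mulr_natr -[_ *+ k.+2]mulr_natr -(@natr1 _ k.+1) exprS; ring.
Qed.

Lemma fder_mono a k : fder (fun s => fps_cst (a * s ^+ k))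
  (fun s => fps_cst (a * (k%:R * s ^+ k.-1))).
Proof.
apply: fder_eq (fderZ (fps_cst a) (fderX k fder_id)) => s /=.
  by rewrite rmorphM rmorphXn.
by rewrite mulr1 !rmorphM rmorphXn rmorph_nat -mulr_natl.
Qed.

Lemma fder_mean_value f f' C : fder f f' ->
  (forall s : K, 0 <= s <= 1 -> fnorm N (f' s) <= C) ->
  forall s : K, 0 <= s <= 1 -> fnorm N (f s - f 0) <= C.
Proof.
move=> [_ _ [B hB]] hC s /andP[s0 s1].
have C0 : 0 <= C by apply: le_trans _ (hC 0 _); rewrite ?fnorm_ge0 ?lexx ?ler01.
(* On [n.+1] equal subintervals the quadratic errors add up to at most [|B| / n.+1]; n is chosen at
   the end against a supposed gap. *)
have step n : fnorm N (f s - f 0) <= C + `|B| / n.+1%:R.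
  have n0 : 0 < n.+1%:R :> K by rewrite ltr0n.
  set u := fun i : nat => f (s * i%:R / n.+1%:R).
  have -> : f s - f 0 = \sum_(0 <= i < n.+1) (u i.+1 - u i).
    by rewrite telescope_sumr // /u mulr0 mul0r mulfK ?gt_eqF.
  apply: le_trans (fnorm_sum _ _ _ _) _.
  rewrite big_mkord.
  apply: (@le_trans _ _ (\sum_(i < n.+1) (C + `|B| / n.+1%:R) / n.+1%:R)); last first.
    by rewrite sumr_const card_ord -[leLHS]mulr_natr divfK ?gt_eqF.
  apply: ler_sum => i _; rewrite /u.
  set t := s * i.+1%:R / _; set r := s * i%:R / _.
  have e : t - r = s / n.+1%:R by rewrite /t /r -natr1; field; rewrite gt_eqF.
  have h0 : 0 <= s / n.+1%:R by rewrite divr_ge0 // ltW.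
  have rt : r <= t by rewrite -subr_ge0 e.
  have r0 : 0 <= r by rewrite /r !mulr_ge0 // invr_ge0 ltW.
  have t1 : t <= 1.
    rewrite /t ler_pdivrMr // mul1r; apply: (@le_trans _ _ (1 * i.+1%:R)).
      by rewrite ler_wpM2r.
    by rewrite mul1r ler_nat ltn_ord.
  have -> : f t - f r = (f t - f r - fps_cst (t - r) * f' r) + fps_cst (t - r) * f' r.
    by ring.
  have hs : s / n.+1%:R <= n.+1%:R^-1 by rewrite ler_pdivrMr // mulVf ?gt_eqF.
  apply: le_trans (fnormD _ _ _) _; rewrite addrC mulrDl; apply: lerD.
    rewrite fnormZ e ger0_norm // mulrC.
    apply: ler_pM => //; first exact: fnorm_ge0.
    by apply: hC; rewrite r0 (le_trans rt).
  apply: le_trans (hB _ _ r0 rt t1) _; rewrite e.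
  apply: (@le_trans _ _ (`|B| * (s / n.+1%:R) ^+ 2)).
    by rewrite ler_wpM2r ?exprn_ge0 ?ler_norm.
  rewrite -mulrA ler_wpM2l // expr2.
  by apply: ler_pM.
rewrite leNgt; apply/negP => lt.
have e0 : 0 < fnorm N (f s - f 0) - C by rewrite subr_gt0.
set n := Num.truncn (`|B| / (fnorm N (f s - f 0) - C)).
have h : `|B| / n.+1%:R < fnorm N (f s - f 0) - C.
  by rewrite ltr_pdivrMr ?ltr0n // mulrC -ltr_pdivrMr // truncnS_gt.
by move: h (step n); set a := _ / n.+1%:R; set x := fnorm _ _; lra.
Qed.

End Derivatives.

Section TaylorFamily.
Context {K : realType}.
Variables (N D : nat) (M psi : nat -> K -> fps K) (e : fps K).
Variables (kap f : nat -> nat -> K) (dl ep C : K).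
Hypotheses (dl0 : 0 <= dl) (ep0 : 0 <= ep) (C0 : 0 <= C).
Hypothesis M_der : forall i, (i < D)%N -> fder N (M i) (fun s => M i.+1 s * psi i s).
Hypothesis M_0 : forall i, M i 0 = e.
Hypothesis M_smooth : forall i p s, (p <= D)%N -> 0 <= s <= 1 ->
  fnorm N (fps_w ^+ p * M i s) <= dl ^+ p.
Hypothesis kap_le : forall i j, (i < D)%N -> (j < D)%N ->
  `|kap i j| * dl ^+ j.+1 <= C * ep ^+ j.+1.
Hypothesis psi_le : forall i p J s, (i < D)%N -> (p + J < D)%N -> 0 <= s <= 1 ->
  fnorm N (fps_w ^+ p * (M i.+1 s *
    (psi i s - \sum_(j < J) fps_cst (kap i j * s ^+ j) * fps_w ^+ j.+1)))
  <= C * dl ^+ p * ep ^+ J.+1.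
Hypothesis f_0 : forall i, f i 0 = 1.
Hypothesis f_rec : forall i q, (i < D)%N -> (q < D)%N ->
  q.+1%:R * f i q.+1 = \sum_(j < q.+1) kap i j * f i.+1 (q - j)%N.

Let taylor d i s := \sum_(q < d) fps_cst (f i q * s ^+ q) * fps_w ^+ q.

(** Closes the induction of [taylor_family] for the constant (1 + C)^d. *)
Lemma geometric_bound d :
  C * (1 + \sum_(j < d) (1 + C) ^+ (d - j)) <= (1 + C) ^+ d.+1.
Proof.
elim: d => [|d IH]; first by rewrite big_ord0 addr0 mulr1 expr1 lerDr.
rewrite big_ord_recl subn0; under eq_bigr => j _ do rewrite lift0 subSS.
have -> : C * (1 + ((1 + C) ^+ d.+1 + \sum_(j < d) (1 + C) ^+ (d - j))) =
  C * (1 + C) ^+ d.+1 + C * (1 + \sum_(j < d) (1 + C) ^+ (d - j)) by ring.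
by rewrite [leRHS]exprS mulrDl mul1r addrC lerD2r.
Qed.

(** Induction on d. The difference vanishes at s = 0. By [f_rec] its derivative is the remainder of
    psi after d terms plus the sum over j of kappa_j s^j w^(j+1) times the same difference for
    [i.+1] and order [d - j]. The j + 1 lost orders are repaid by [kap_le]; the power p is carried
    along to absorb the new factors w. *)
Lemma taylor_family d i p s : (i + d <= D)%N -> (p + d <= D)%N -> 0 <= s <= 1 ->
  fnorm N (fps_w ^+ p * (M i s - e * taylor d i s)) <= (1 + C) ^+ d * dl ^+ p * ep ^+ d.
Proof.
elim/ltn_ind: d i p s => -[_|d IH] i p s.
  rewrite !addn0 => hi hp hs; rewrite /taylor big_ord0 mulr0 subr0 !expr0 mul1r mulr1.
  exact: M_smooth.
rewrite !addnS => hi hp hs.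
pose F s := fps_w ^+ p * (M i s - e * taylor d.+1 i s).
pose F' s := fps_w ^+ p * (M i.+1 s * psi i s +
  (- e) * \sum_(q < d.+1) fps_w ^+ q * fps_cst (f i q * (q%:R * s ^+ q.-1))).
have iD : (i < D)%N by rewrite (leq_ltn_trans _ hi) // leq_addr.
have dS : fder N
    (fun s => \sum_(q < d.+1) fps_w ^+ q * fps_cst (f i q * s ^+ q))
    (fun s => \sum_(q < d.+1) fps_w ^+ q * fps_cst (f i q * (q%:R * s ^+ q.-1))).
  by apply: fder_sum => q; apply: fderZ; exact: fder_mono.
have dF : fder N F F'.
  have h := fderZ (fps_w ^+ p) (fderD (M_der iD) (fderZ (- e) dS)).
  move: h; congr fder; apply/funext => r; rewrite /F /taylor mulNr; congr (_ * _).
  by congr (_ - e * _); apply: eq_bigr => q _; rewrite mulrC.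
have F0 : F 0 = 0.
  rewrite /F /taylor big_ord_recl expr0 !mulr1 f_0 rmorph1 big1 ?addr0 ?M_0 ?mulr1 ?subrr ?mulr0 //.
  by move=> q _; rewrite expr0n mulr0 rmorph0 mul0r.
suff hF' r : 0 <= r <= 1 -> fnorm N (F' r) <= (1 + C) ^+ d.+1 * dl ^+ p * ep ^+ d.+1.
  by have := fder_mean_value dF hF' hs; rewrite F0 subr0.
move=> hr.
have -> : F' r = fps_w ^+ p * (M i.+1 r *
    (psi i r - \sum_(j < d) fps_cst (kap i j * r ^+ j) * fps_w ^+ j.+1)) +
  \sum_(j < d) fps_cst (kap i j * r ^+ j) *
    (fps_w ^+ (p + j.+1) * (M i.+1 r - e * taylor (d - j) i.+1 r)).
  have -> : \sum_(j < d) fps_cst (kap i j * r ^+ j) *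
    (fps_w ^+ (p + j.+1) * (M i.+1 r - e * taylor (d - j) i.+1 r)) =
    fps_w ^+ p * (M i.+1 r * \sum_(j < d) fps_cst (kap i j * r ^+ j) * fps_w ^+ j.+1
      - e * \sum_(j < d) fps_cst (kap i j * r ^+ j) * fps_w ^+ j.+1 * taylor (d - j) i.+1 r).
    rewrite mulrBr !mulr_sumr -sumrB; apply: eq_bigr => j _.
    by rewrite exprD; ring.
  rewrite /F'; set S1 := \sum_(q < d.+1) _; set S2 := \sum_(j < d) _ * taylor _ _ _.
  suff -> : S1 = S2 by ring.
  rewrite /S1 big_ord_recl mul0r mulr0 rmorph0 mulr0 add0r.
  transitivity (\sum_(q < d) \sum_(j < q.+1)
    (fps_cst (kap i j * r ^+ j) * fps_w ^+ j.+1 *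
     (fps_cst (f i.+1 (q - j)%N * r ^+ (q - j)) * fps_w ^+ (q - j)))).
    apply: eq_bigr => q _; rewrite lift0 /= mulrA [f i _ * _]mulrC.
    rewrite f_rec ?(leq_trans (ltn_ord q)) //; last first.
      by apply: leq_trans (ltnW hp); rewrite leq_addl.
    rewrite mulr_suml rmorph_sum mulr_sumr; apply: eq_bigr => j _.
    have jq : (j <= q)%N by rewrite -ltnS.
    have -> : r ^+ q = r ^+ j * r ^+ (q - j) by rewrite -exprD subnKC.
    have -> : fps_w ^+ q.+1 = fps_w ^+ j.+1 * fps_w ^+ (q - j) :> fps K.
      by rewrite -exprD addSn subnKC.
    by rewrite !rmorphM /=; ring.
  rewrite (triangle_sum (fun j q => fps_cst (kap i j * r ^+ j) * fps_w ^+ j.+1 *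
     (fps_cst (f i.+1 q * r ^+ q) * fps_w ^+ q))).
  by apply: eq_bigr => j _; rewrite -mulr_sumr.
apply: le_trans (fnormD _ _ _) _.
apply: (@le_trans _ _ (C * dl ^+ p * ep ^+ d.+1 +
  \sum_(j < d) C * ep ^+ j.+1 * dl ^+ p * ((1 + C) ^+ (d - j) * ep ^+ (d - j)))).
  apply: lerD; first exact: psi_le.
  apply: le_trans (fnorm_sum _ _ _ _) _; apply: ler_sum => j _.
  have jd := ltn_ord j.
  have jD : (j < D)%N by lia.
  rewrite fnormZ.
  apply: (@le_trans _ _ (`|kap i j| * ((1 + C) ^+ (d - j) * dl ^+ (p + j.+1) * ep ^+ (d - j)))).
    apply: ler_pM; rewrite ?fnorm_ge0 ?normr_ge0 //.
      have /andP[r0 r1] := hr.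
      by rewrite normrM ler_piMr // normrX ger0_norm // exprn_ile1.
    by apply: IH => //; lia.
  rewrite [leLHS](_ : _ = (`|kap i j| * dl ^+ j.+1) * (dl ^+ p * ((1 + C) ^+ (d - j) * ep ^+ (d - j)))).
    rewrite -[leRHS]mulrA ler_wpM2r ?kap_le //.
    by rewrite !mulr_ge0 ?exprn_ge0 ?addr_ge0.
  by rewrite exprD; ring.
rewrite (eq_bigr (fun j : 'I_d => C * dl ^+ p * ep ^+ d.+1 * (1 + C) ^+ (d - j))); last first.
  move=> j _.
  have -> : ep ^+ d.+1 = ep ^+ j.+1 * ep ^+ (d - j).
    by rewrite -exprD addSn subnKC // ltnW.
  by ring.
rewrite -mulr_sumr -[X in X + _]mulr1 -mulrDr.
have -> : C * dl ^+ p * ep ^+ d.+1 * (1 + \sum_(i0 < d) (1 + C) ^+ (d - i0)) =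
  C * (1 + \sum_(i0 < d) (1 + C) ^+ (d - i0)) * (dl ^+ p * ep ^+ d.+1) by ring.
by rewrite -[leRHS]mulrA ler_wpM2r ?geometric_bound // mulr_ge0 ?exprn_ge0.
Qed.

End TaylorFamily.

(** * Interpolation between the Poisson and the coupon law *)

Section Interpolation.
Context {K : realType}.
Implicit Types (b s t : K) (N : nat).

Lemma fbounded_subprob N (f : K -> fps K) :
  (forall s, 0 <= s <= 1 -> subprob (f s)) -> fbounded N f.
Proof. by move=> h; exists 1 => s hs; exact: h. Qed.

Lemma fder_expw N lam : 0 <= lam ->
  fder N (fun s => expw ((1 - s) * lam))
         (fun s => - fps_cst lam * fps_w * expw ((1 - s) * lam)).
Proof.
move=> l0.
have bE : fbounded N (fun s => expw ((1 - s) * lam)).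
  apply: fbounded_subprob => s /andP[s0 s1]; apply: subprob_expw.
  by rewrite mulr_ge0 // subr_ge0.
split; [by []|exact: fboundedM (fbounded_cst _ _) bE|].
exists ((7 + 6 * lam) * lam ^+ 2) => s t s0 st t1.
set h := (t - s) * lam.
have h0 : 0 <= h by rewrite mulr_ge0 // subr_ge0.
have hl : h <= lam by rewrite -[leRHS]mul1r ler_wpM2r //; lra.
(* Factoring at the later time t keeps both Poisson parameters nonnegative. *)
have -> : (1 - s) * lam = (1 - t) * lam + h by rewrite /h; ring.
rewrite expwD; set E := expw ((1 - t) * lam); set X := expw h.
have -> : E - E * X - fps_cst (t - s) * (- fps_cst lam * fps_w * (E * X)) =
   E * (- (X - 1 - fps_cst h * fps_w) + fps_cst h * (fps_w * (X - 1))).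
  by rewrite /h; ring.
have hX : fnorm N (X - 1 - fps_cst h * fps_w) <= 3 * h ^+ 2 := fnorm_expw_lin N h0.
have hE : fnorm N E <= 1 by apply: subprob_expw; rewrite mulr_ge0 // subr_ge0.
have hX1 : fnorm N (X - 1) <= 3 * h ^+ 2 + 2 * h.
  rewrite -[X - 1](subrK (fps_cst h * fps_w)).
  apply: le_trans (fnormD _ _ _) _; apply: lerD => //.
  rewrite fnormZ ger0_norm // mulrC; apply: ler_wpM2r => //; exact: fnorm_w.
have hwX : fnorm N (fps_w * (X - 1)) <= 2 * (3 * h ^+ 2 + 2 * h).
  apply: le_trans (fnormM _ _ _) _.
  by apply: ler_pM; rewrite ?fnorm_ge0 ?fnorm_w.
apply: le_trans (fnormM _ _ _) _.
apply: (@le_trans _ _ (1 * (3 * h ^+ 2 + h * (2 * (3 * h ^+ 2 + 2 * h))))).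
  apply: ler_pM; rewrite ?fnorm_ge0 //.
  apply: le_trans (fnormD _ _ _) _; rewrite fnormN; apply: lerD => //.
  by rewrite fnormZ ger0_norm // ler_wpM2l.
have -> : (7 + 6 * lam) * lam ^+ 2 * (t - s) ^+ 2 = 7 * h ^+ 2 + 6 * (lam * h ^+ 2).
  by rewrite /h; ring.
have : h * h ^+ 2 <= lam * h ^+ 2 by rewrite ler_wpM2r // exprn_ge0.
have -> : 1 * (3 * h ^+ 2 + h * (2 * (3 * h ^+ 2 + 2 * h))) = 7 * h ^+ 2 + 6 * (h * h ^+ 2).
  by ring.
lra.
Qed.

Lemma fder_geo N b : 0 <= b ->
  fder N (fun s => geo (s * b))
         (fun s => geo (s * b) * (fps_cst b * fps_w * geo (s * b))).
Proof.
move=> b0.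
have sG s : 0 <= s <= 1 -> subprob (geo (s * b)).
  by move=> /andP[s0 _]; apply: subprob_geo; rewrite mulr_ge0.
have bG : fbounded N (fun s => geo (s * b)) by apply: fbounded_subprob.
split; [by []|apply: fboundedM => //; exact: fboundedM (fbounded_cst _ _) bG|].
exists (4 * b ^+ 2) => s t s0 st t1.
have hs : 0 <= s <= 1 by rewrite s0 (le_trans st).
have ht : 0 <= t <= 1 by rewrite t1 (le_trans s0).
have es : (1 - fps_cst (s * b) * fps_w) * geo (s * b) = 1.
  by apply: geoK; rewrite mulr_ge0.
have et : (1 - fps_cst (t * b) * fps_w) * geo (t * b) = 1.
  by apply: geoK; rewrite mulr_ge0 // (le_trans s0).
set x := geo (s * b) in es *; set y := geo (t * b) in et *.
(* Resolvent identity. Used twice, it exhibits the error as (t - s)^2 b^2 w^2 x^2 y. *)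
have d : y - x = fps_cst (t - s) * (fps_cst b * fps_w * x * y).
  have -> : y - x = ((1 - fps_cst (s * b) * fps_w) * x) * y -
                    x * ((1 - fps_cst (t * b) * fps_w) * y).
    by rewrite es et; ring.
  by ring.
have -> : y - x - fps_cst (t - s) * (x * (fps_cst b * fps_w * x)) =
  fps_cst ((t - s) ^+ 2 * b ^+ 2) * (fps_w * (fps_w * (x * (x * y)))).
  transitivity (fps_cst (t - s) * fps_cst b * fps_w * x * (y - x)).
    by rewrite {1}d; ring.
  by rewrite d; ring.
rewrite fnormZ ger0_norm ?mulr_ge0 ?exprn_ge0 ?subr_ge0 //.
rewrite [leRHS](_ : _ = (t - s) ^+ 2 * b ^+ 2 * (2 * (2 * 1))); last by ring.
apply: ler_wpM2l; first by rewrite mulr_ge0 ?exprn_ge0 ?subr_ge0.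
do 2![apply: le_trans (fnormM _ _ _) _; apply: ler_pM; rewrite ?fnorm_ge0 ?fnorm_w //].
by apply: subprobM; [exact: sG|apply: subprobM; [exact: sG|exact: sG]].
Qed.

Context {T : Type}.
Variables (I : seq T) (b : T -> K).
Hypothesis b0 : forall k, 0 <= b k.

Definition psum j : K := \sum_(k <- I) b k ^+ j.

(** The sum of b (1 + b), the variances of the geometric factors; for the coupon parameters this is
    sigma_n^2. *)
Definition pois_mean : K := psum 1 + psum 2.

Definition geo_prod s : fps K := \prod_(k <- I) geo (s * b k).

Definition geo_sum j s : fps K := \sum_(k <- I) fps_cst (b k ^+ j) * geo (s * b k).

(* Interpolates between the Poisson law (s = 0) and the law of W - (n - m) + c
   (s = 1); its logarithm is the sum of the expected terms in [(s w)^r]. *)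
Definition interp c s : fps K :=
  expw ((1 - s) * pois_mean) * (1 + fps_cst s * fps_w) ^+ c * geo_prod s.

Lemma psum_ge0 j : 0 <= psum j.
Proof. by apply: sumr_ge0 => k _; rewrite exprn_ge0. Qed.

Lemma pois_mean_ge0 : 0 <= pois_mean.
Proof. by rewrite addr_ge0 ?psum_ge0. Qed.

Lemma subprob_geo_prod s : 0 <= s <= 1 -> subprob (geo_prod s).
Proof.
move=> /andP[s0 _]; apply: subprob_prod => k _.
by apply: subprob_geo; rewrite mulr_ge0.
Qed.

Lemma subprob_bern s : 0 <= s <= 1 -> subprob (1 + fps_cst s * fps_w : fps K).
Proof.
move=> hs; have -> : 1 + fps_cst s * fps_w = fps_cst s * fps_X + fps_cst (1 - s) * 1.
  by rewrite /fps_w; ring.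
by apply: subprob_mix => //; [exact: subprob_fps_X|exact: subprob1].
Qed.

Lemma interp0 c : interp c 0 = expw pois_mean.
Proof.
rewrite /interp subr0 mul1r rmorph0 mul0r addr0 expr1n mulr1 /geo_prod.
by rewrite big1 ?mulr1 // => k _; rewrite mul0r geo0.
Qed.

Lemma interp1 c : interp c 1 = fps_X ^+ c * geo_prod 1.
Proof. by rewrite /interp subrr mul0r expw0 mul1r rmorph1 mul1r /fps_w addrC subrK. Qed.

Lemma fder_geo_prod N :
  fder N geo_prod (fun s => geo_prod s * (fps_w * geo_sum 1 s)).
Proof.
rewrite /geo_prod /geo_sum; elim: I => [|k r IH].
  apply: fder_eq (fder_cst N 1) => s; first by rewrite big_nil.
  by rewrite !big_nil !mulr0.
apply: fder_eq (fderM (fder_geo N (b0 k)) IH) => s; first by rewrite big_cons.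
by rewrite !big_cons expr1; ring.
Qed.

Lemma fder_bern N c :
  fder N (fun s => (1 + fps_cst s * fps_w : fps K) ^+ c)
         (fun s => (1 + fps_cst s * fps_w) ^+ c.-1 *+ c * fps_w).
Proof.
apply: fderX; apply: fder_eq (fderD (fder_cst N 1) (fderZ fps_w (fder_id N))) => s.
  by rewrite mulrC.
by rewrite add0r mulr1.
Qed.

Definition drift s : fps K := - fps_cst pois_mean * fps_w + fps_w * geo_sum 1 s.

(** For c > 0 one factor 1 + s w is taken out of the power, so that the derivative of [interp c] is
    [interp c.-1] times an expression without inverse of 1 + s w. *)
Definition interp_psi c s : fps K :=
  if c is c'.+1 then (1 + fps_cst s * fps_w) * drift s + c%:R * fps_w
  else drift s.

Lemma fder_interp N c :
  fder N (interp c) (fun s => interp c.-1 s * interp_psi c s).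
Proof.
apply: fder_eq (fderM (fderM (fder_expw N pois_mean_ge0) (fder_bern N c)) (fder_geo_prod N)) => s //.
case: c => [|c] /=; rewrite /interp /drift.
  by rewrite mulr0n expr0; ring.
by rewrite -mulr_natr exprS; ring.
Qed.

(** Coefficients of s^j w^(j+1) in [interp_psi]. For c > 0 the factor 1 + s w cancels [psum 2] at j
    = 1, so below the cubic order the possibly large [psum 2] appears only through its difference
    with c. *)
Definition interp_kap c j : K :=
  if c is c'.+1 then
    match j with 0 => - (psum 2 - c%:R) | 1 => 0 | _ => psum j + psum j.+1 end
  else if j is 0 then - psum 2 else psum j.+1.

Lemma geo_sum_expand i J s : 0 <= s ->
  geo_sum i s = \sum_(j < J) fps_cst (psum (i + j) * s ^+ j) * fps_w ^+ j +
     fps_cst (s ^+ J) * fps_w ^+ J * geo_sum (i + J) s.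
Proof.
move=> s0; elim: J => [|J IH].
  by rewrite big_ord0 add0r !expr0 rmorph1 !mul1r addn0.
rewrite IH big_ord_recr /= -addrA; congr (_ + _).
rewrite /geo_sum /psum !mulr_sumr mulr_suml rmorph_sum mulr_suml -big_split.
apply: eq_bigr => k _ /=.
rewrite {1}geoE ?mulr_ge0 // addnS !exprS !rmorphM; ring.
Qed.

Lemma psum_sum_w i J s : 0 <= s ->
  \sum_(j < J) fps_cst (psum (i + j) * s ^+ j) * fps_w ^+ j =
  geo_sum i s - fps_cst (s ^+ J) * fps_w ^+ J * geo_sum (i + J) s.
Proof. by move=> s0; rewrite (geo_sum_expand i J s0) addrK. Qed.

Lemma drift_expand s : 0 <= s ->
  drift s = - fps_cst (psum 2) * fps_w + fps_cst s * fps_w ^+ 2 * geo_sum 2 s.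
Proof.
move=> s0; rewrite /drift (geo_sum_expand 1 1 s0) big_ord1 addn0 !expr0 mulr1 mulr1.
by rewrite !expr1 /pois_mean; ring.
Qed.

Lemma interp_psi_expand0 J s : 0 <= s ->
  interp_psi 0 s - \sum_(j < J.+1) fps_cst (interp_kap 0 j * s ^+ j) * fps_w ^+ j.+1 =
  fps_cst (s ^+ J.+1) * fps_w ^+ J.+2 * geo_sum J.+2 s.
Proof.
move=> s0; rewrite big_ord_recl /= expr0 mulr1 expr1 drift_expand //.
rewrite (eq_bigr (fun j : 'I_J => fps_cst s * fps_w ^+ 2 *
   (fps_cst (psum (2 + j) * s ^+ j) * fps_w ^+ j))); last first.
  by move=> j _; rewrite /bump /= !add1n !add2n !exprS; ring.
by rewrite -mulr_sumr psum_sum_w // add2n !exprS; ring.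
Qed.

Lemma interp_psi_expandS c J s : 0 <= s ->
  interp_psi c.+1 s -
    \sum_(j < J.+2) fps_cst (interp_kap c.+1 j * s ^+ j) * fps_w ^+ j.+1 =
  fps_cst (s ^+ J.+2) * fps_w ^+ J.+3 * (geo_sum J.+2 s + geo_sum J.+3 s).
Proof.
move=> s0; rewrite !big_ord_recl /= expr0 mulr1 expr1 mul0r rmorph0 mul0r add0r drift_expand //.
rewrite (eq_bigr (fun j : 'I_J => fps_cst (s ^+ 2) * fps_w ^+ 3 *
   (fps_cst (psum (2 + j) * s ^+ j) * fps_w ^+ j +
    fps_cst (psum (3 + j) * s ^+ j) * fps_w ^+ j))); last first.
  by move=> j _; rewrite /bump /= !add1n add2n add3n !exprS; ring.
rewrite -mulr_sumr big_split /= !psum_sum_w // add2n add3n.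
have := geo_sum_expand 2 1 s0.
rewrite big_ord1 addn0 addn1 !expr0 mulr1 mulr1 expr1 => e2.
have e2' : geo_sum 2 s = fps_cst (psum 2) + fps_cst s * fps_w * geo_sum 3 s.
  by rewrite {1}e2 expr1.
by rewrite !exprS e2'; ring.
Qed.

Lemma fnorm_geo_sum N (x : fps K) i s (B : K) : 0 <= s ->
  fnorm N x <= B -> fnorm N (x * geo_sum i s) <= psum i * B.
Proof.
move=> s0 hB; rewrite mulr_sumr mulr_suml.
apply: le_trans (fnorm_sum _ _ _ _) _; apply: ler_sum => k _.
rewrite mulrCA fnormZ ger0_norm ?exprn_ge0 //; apply: ler_wpM2l; first exact: exprn_ge0.
apply: le_trans (fnormM _ _ _) _; rewrite -[leRHS]mulr1.
apply: ler_pM; rewrite ?fnorm_ge0 //.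
by apply: subprob_geo; rewrite mulr_ge0.
Qed.

(** The p factors w are distributed over the P equal factors y, at most one to each, and every pair
    gains dl. *)
Lemma smooth_pow N (x y z : fps K) (dl : K) p P : subprob y -> subprob z ->
  fnorm N (fps_w * y) <= dl -> (p <= P)%N -> x = y ^+ P * z ->
  fnorm N (fps_w ^+ p * x) <= dl ^+ p.
Proof.
move=> hy hz hw pP ->; rewrite -(subnKC pP) exprD -mulrA mulrA -exprMn.
apply: le_trans (fnormM _ _ _) _; rewrite -[leRHS]mulr1.
apply: ler_pM; rewrite ?fnorm_ge0 //; last first.
  by apply: subprobM => //; exact: subprobX.
elim: p {pP} => [|p IH]; first by rewrite !expr0; exact: subprob1.
rewrite !exprS; apply: le_trans (fnormM _ _ _) _.
by apply: ler_pM; rewrite ?fnorm_ge0.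
Qed.

Lemma subprob_interp c s : 0 <= s <= 1 -> subprob (interp c s).
Proof.
move=> hs; apply: subprobM; last exact: subprob_geo_prod.
apply: subprobM; last by apply: subprobX; exact: subprob_bern.
by apply: subprob_expw; have /andP[s0 s1] := hs; rewrite mulr_ge0 ?pois_mean_ge0 ?subr_ge0.
Qed.

Lemma interp_smooth_trivial N c p s : 0 <= s <= 1 ->
  fnorm N (fps_w ^+ p * interp c s) <= 2 ^+ p.
Proof.
move=> hs; apply: (@smooth_pow _ _ 1 (interp c s) _ _ p) => //.
- exact: subprob1.
- exact: subprob_interp.
- by rewrite mulr1 fnorm_w.
- by rewrite expr1n mul1r.
Qed.

Lemma geo_prod_factor (r : seq T) s (b1 : K) : 0 <= s -> 0 <= b1 ->
  (forall i, (i < size r)%N -> forall k0, b1 <= s * b (nth k0 r i)) ->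
  exists2 z, subprob z & \prod_(k <- r) geo (s * b k) = geo b1 ^+ size r * z.
Proof.
move=> s0 b10; elim: r => [|k r IH] hr.
  by exists 1; [exact: subprob1|rewrite big_nil expr0 mul1r].
have [i hi k0|z hz ez] := IH; first by apply: (hr i.+1).
exists (((1 - fps_cst b1 * fps_w) * geo (s * b k)) * z).
  by apply: subprobM => //; apply: subprob_geo_ratio; rewrite b10; apply: (hr 0%N).
rewrite big_cons ez exprS -[LHS]mul1r -{1}(geoK b10) /=; ring.
Qed.

(** The law is cut into P equal factors and a bounded rest. For s <= 1/2 each factor is Poisson with
    parameter at least [pois_mean / (2 * P%:R)]; otherwise it consists of [k.+3] geometric laws of
    mean [b1 / 2], which is at most s times each mean in [I1]. *)
Lemma interp_smooth N c p s (I1 I2 : seq T) P k (b1 dl : K) :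
  I = I1 ++ I2 -> (0 < P)%N -> (P * k.+3 <= size I1)%N -> 0 < b1 ->
  (forall i, (i < size I1)%N -> forall k0, b1 <= b (nth k0 I1 i)) ->
  0 < pois_mean ->
  (Num.sqrt (pois_mean / (2 * P%:R)))^-1 <= dl ->
  (Num.sqrt (b1 / 2 * (1 + b1 / 2) * k.+1%:R))^-1 <= dl ->
  (p <= P)%N -> 0 <= s <= 1 -> fnorm N (fps_w ^+ p * interp c s) <= dl ^+ p.
Proof.
move=> eI P0 szI b10 hb sig0 dl1 dl2 pP hs; have /andP[s0 s1] := hs.
have sB := subprobX c (subprob_bern hs).
have P0' : 0 < P%:R :> K by rewrite ltr0n.
case: (leP s (1 / 2)) => [s2|s2].
  have h1 : pois_mean / (2 * P%:R) <= (1 - s) * pois_mean / P%:R.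
    rewrite invfM mulrA ler_wpM2r ?invr_ge0 ?ler0n // mulrC.
    by apply: ler_wpM2r; [exact: ltW|lra].
  have h0 : 0 < pois_mean / (2 * P%:R) by rewrite divr_gt0 // mulr_gt0.
  have h2 := lt_le_trans h0 h1.
  apply: (@smooth_pow _ _ (expw ((1 - s) * pois_mean / P%:R))
    ((1 + fps_cst s * fps_w) ^+ c * geo_prod s) _ _ P) => //.
  - exact/subprob_expw/ltW.
  - by apply: subprobM => //; exact: subprob_geo_prod.
  - apply: le_trans (poisson_smooth _ h2) _; apply: le_trans dl1.
    by rewrite lef_pV2 ?posrE ?sqrtr_gt0 // ler_sqrt // ltW.
  - have e : (1 - s) * pois_mean / P%:R *+ P = (1 - s) * pois_mean.
      by rewrite -[LHS]mulr_natr divfK ?gt_eqF.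
    by rewrite expwX e /interp mulrA.
have b12 : 0 < b1 / 2 by rewrite divr_gt0.
have [i hi k0|z hz ez] := @geo_prod_factor I1 s (b1 / 2) s0 (ltW b12).
  apply: (@le_trans _ _ (s * b1)); last by rewrite ler_wpM2l // hb.
  by rewrite mulrC ler_wpM2r ?(ltW b10) // -div1r ltW.
have g1 : subprob (geo (b1 / 2)) by apply/subprob_geo/ltW.
apply: (@smooth_pow _ _ (geo (b1 / 2) ^+ k.+3)
  (expw ((1 - s) * pois_mean) * (1 + fps_cst s * fps_w) ^+ c *
   (geo (b1 / 2) ^+ (size I1 - P * k.+3) * z * \prod_(k <- I2) geo (s * b k))) _ _ P) => //.
- exact: subprobX.
- apply: subprobM.
    by apply: subprobM => //; apply: subprob_expw; rewrite mulr_ge0 ?pois_mean_ge0 ?subr_ge0.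
  apply: subprobM; first by apply: subprobM => //; exact: subprobX.
  by apply: subprob_prod => j _; apply: subprob_geo; rewrite mulr_ge0.
- by apply: le_trans dl2; exact: nb_smooth.
rewrite /interp /geo_prod eI big_cat /= ez -{1}(subnKC szI) exprD -exprM mulnC; ring.
Qed.

Section Approximation.
Variables (N D c : nat) (dl ep C : K) (f : nat -> nat -> K).
Hypotheses (D3 : (3 <= D)%N) (dl0 : 0 <= dl) (ep01 : 0 <= ep <= 1) (C0 : 0 <= C).
(** The margin above D covers the extra powers of w in the remainders of [interp_psi]. *)
Hypothesis smooth : forall c' p s, (p <= D.+3)%N -> 0 <= s <= 1 ->
  fnorm N (fps_w ^+ p * interp c' s) <= dl ^+ p.
Hypothesis kap_le : forall i j, (i < D)%N -> (j < D)%N ->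
  `|interp_kap (c - i) j| * dl ^+ j.+1 <= C * ep ^+ j.+1.
Hypothesis f_0 : forall i, f i 0 = 1.
Hypothesis f_rec : forall i q, (i < D)%N -> (q < D)%N ->
  q.+1%:R * f i q.+1 = \sum_(j < q.+1) interp_kap (c - i) j * f i.+1 (q - j)%N.

Let M i := interp (c - i).

Lemma interp_geo_sum p J s i k l : (p + k <= D.+3)%N -> 0 <= s <= 1 ->
  fnorm N (fps_w ^+ p * (M i s * (fps_cst (s ^+ J) * fps_w ^+ k * geo_sum l s)))
  <= psum l * dl ^+ (p + k).
Proof.
move=> pk hs; have /andP[s0 s1] := hs.
have -> : fps_w ^+ p * (M i s * (fps_cst (s ^+ J) * fps_w ^+ k * geo_sum l s)) =
  fps_cst (s ^+ J) * (fps_w ^+ (p + k) * M i s * geo_sum l s) by rewrite exprD; ring.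
rewrite fnormZ -[leRHS]mul1r; apply: ler_pM; rewrite ?fnorm_ge0 ?normr_ge0 //.
  by rewrite ger0_norm ?exprn_ge0 // exprn_ile1.
by apply: fnorm_geo_sum => //; exact: smooth.
Qed.

(** The exact remainders carry the same power sums as a later coefficient [interp_kap], so [kap_le]
    bounds them as well. For J = 0 the linear term comes on top, hence the factor 2. *)
Lemma interp_psi_le i p J s : (i < D)%N -> (p + J < D)%N -> 0 <= s <= 1 ->
  fnorm N (fps_w ^+ p * (M i.+1 s * (interp_psi (c - i) s -
    \sum_(j < J) fps_cst (interp_kap (c - i) j * s ^+ j) * fps_w ^+ j.+1)))
  <= 2 * C * dl ^+ p * ep ^+ J.+1.
Proof.
move=> iD pJ hs; have /andP[s0 s1] := hs; have /andP[e0 e1] := ep01.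
have dp : 0 <= dl ^+ p by rewrite exprn_ge0.
have le_twice j k : (j <= k)%N -> C * dl ^+ p * ep ^+ k <= C * dl ^+ p * ep ^+ j.
  by move=> jk; rewrite ler_wpM2l ?mulr_ge0 // ler_wiXn2l.
have lin k0 x : `|k0| * dl <= C * ep ->
    fnorm N (fps_w ^+ p * (M i.+1 s * x)) <= C * dl ^+ p * ep ^+ 1 ->
    fnorm N (fps_w ^+ p * (M i.+1 s * (fps_cst k0 * fps_w + x))) <=
    2 * C * dl ^+ p * ep ^+ 1.
  move=> hk hx.
  have -> : fps_w ^+ p * (M i.+1 s * (fps_cst k0 * fps_w + x)) =
    fps_cst k0 * (fps_w ^+ p.+1 * M i.+1 s) + fps_w ^+ p * (M i.+1 s * x).
    by rewrite exprS; ring.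
  apply: le_trans (fnormD _ _ _) _.
  have -> : 2 * C * dl ^+ p * ep ^+ 1 = C * ep * dl ^+ p + C * dl ^+ p * ep ^+ 1 by ring.
  apply: lerD => //; rewrite fnormZ.
  apply: (@le_trans _ _ (`|k0| * dl ^+ p.+1)).
    by rewrite ler_wpM2l // smooth //; lia.
  by rewrite exprS mulrA ler_wpM2r.
have one j : C * dl ^+ p * ep ^+ j <= 2 * C * dl ^+ p * ep ^+ j.
  have : 0 <= C * dl ^+ p * ep ^+ j by rewrite !mulr_ge0 ?exprn_ge0.
  rewrite -!mulrA; lra.
have kl := kap_le iD.
case ci: (c - i)%N kl => [|c'] kl.
  have R1 J' : (p + J' < D)%N -> (J' < D.-1)%N ->
      fnorm N (fps_w ^+ p * (M i.+1 s *
        (fps_cst (s ^+ J'.+1) * fps_w ^+ J'.+2 * geo_sum J'.+2 s))) <=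
      C * dl ^+ p * ep ^+ J'.+2.
    move=> h1 h2; apply: le_trans (interp_geo_sum _ _ _ _ _) _ => //; first by lia.
    have h3 : (J'.+1 < D)%N by lia.
    have := kl _ h3; rewrite /= ger0_norm ?psum_ge0 // => h.
    by rewrite exprD [leLHS]mulrCA [C * _]mulrC -[leRHS]mulrA ler_wpM2l.
  case: J pJ => [|J] pJ.
    rewrite big_ord0 subr0.
    have -> : interp_psi 0 s = fps_cst (- psum 2) * fps_w +
      fps_cst (s ^+ 1) * fps_w ^+ 2 * geo_sum 2 s.
      by rewrite -(interp_psi_expand0 0 s0) big_ord1 /= expr0 mulr1 expr1 [RHS]addrC subrK.
    apply: lin; first by apply: (kl 0%N); lia.
    by apply: le_trans (R1 0%N _ _) _; [lia|lia|exact: le_twice].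
  rewrite interp_psi_expand0 //.
  by apply: le_trans (R1 _ _ _) _; [lia|lia|exact: one].
have R2 J' : (p + J' < D.+1)%N -> (J'.+2 < D)%N ->
    fnorm N (fps_w ^+ p * (M i.+1 s * (fps_cst (s ^+ J'.+2) * fps_w ^+ J'.+3 *
      (geo_sum J'.+2 s + geo_sum J'.+3 s)))) <= C * dl ^+ p * ep ^+ J'.+3.
  move=> h1 h2; rewrite [X in M _ _ * X]mulrDr mulrDr mulrDr.
  apply: le_trans (fnormD _ _ _) _.
  have h4 : (p + J'.+3 <= D.+3)%N by lia.
  apply: le_trans (lerD (interp_geo_sum _ _ _ h4 hs) (interp_geo_sum _ _ _ h4 hs)) _.
  have := kl _ h2; rewrite /= ger0_norm ?addr_ge0 ?psum_ge0 // => h.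
  by rewrite -mulrDl exprD [leLHS]mulrCA [C * _]mulrC -[leRHS]mulrA ler_wpM2l.
have e2 : interp_psi c'.+1 s = fps_cst (interp_kap c'.+1 0) * fps_w +
   fps_cst (s ^+ 2) * fps_w ^+ 3 * (geo_sum 2 s + geo_sum 3 s).
  rewrite -(interp_psi_expandS c' 0 s0) big_ord_recr big_ord1.
  by rewrite /= expr0 mulr1 expr1 mul0r rmorph0 mul0r addr0 [RHS]addrC subrK.
case: J pJ => [|[|J]] pJ.
- rewrite big_ord0 subr0 e2; apply: lin; first by apply: (kl 0%N); lia.
  by apply: le_trans (R2 0%N _ _) _; [lia|lia|exact: le_twice].
- rewrite big_ord1 expr0 mulr1 expr1 e2 [_ + _ * (_ + _)]addrC addrK.
  apply: le_trans (R2 0%N _ _) _; [lia|lia|].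
  by apply: le_trans (one _); exact: le_twice.
rewrite interp_psi_expandS //.
by apply: le_trans (R2 _ _ _) _; [lia|lia|exact: one].
Qed.

Lemma interp_approx :
  fnorm N (interp c 1 - expw pois_mean * \sum_(q < D) fps_cst (f 0 q) * fps_w ^+ q)
  <= (1 + 2 * C) ^+ D * ep ^+ D.
Proof.
have /andP[e0 e1] := ep01.
have h01 : 0 <= (1 : K) <= 1 by rewrite ler01 lexx.
have C2 : 0 <= 2 * C by rewrite mulr_ge0.
have h := @taylor_family K N D M (fun i => interp_psi (c - i)) (expw pois_mean)
  (fun i => interp_kap (c - i)) f dl ep (2 * C) dl0 e0 C2.
have := h _ _ _ _ _ f_0 f_rec D 0%N 0%N 1.
rewrite expr0 mul1r mulr1 /M subn0.
under eq_bigr => q _ do rewrite expr1n mulr1.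
apply => //.
- by move=> i iD; have := fder_interp N (c - i); rewrite subnS.
- by move=> i; exact: interp0.
- by move=> i p s pD hs; apply: smooth => //; lia.
- move=> i j iD jD; apply: le_trans (kap_le iD jD) _.
  by rewrite ler_wpM2r ?exprn_ge0 //; lra.
- exact: interp_psi_le.
Qed.

End Approximation.
End Interpolation.

(** * Poisson-Charlier approximation *)

Section TruncatedExponential.
Context {K : realType}.
Implicit Types (p q h y z : {poly K}) (A : nat -> K).

Definition eqmod Q p q := forall i, (i < Q)%N -> p`_i = q`_i.

Lemma eqmodM Q p p' q q' : eqmod Q p p' -> eqmod Q q q' -> eqmod Q (p * q) (p' * q').
Proof.
move=> hp hq i iQ; rewrite !coefM; apply: eq_bigr => j _.
by rewrite hp ?hq // (leq_ltn_trans _ iQ) ?leq_subr // -ltnS.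
Qed.

Lemma eqmodD Q p p' q q' : eqmod Q p p' -> eqmod Q q q' -> eqmod Q (p + q) (p' + q').
Proof. by move=> hp hq i iQ; rewrite !coefD hp ?hq. Qed.

Lemma coef_exp_low h k i : h`_0 = 0 -> (i < k)%N -> (h ^+ k)`_i = 0.
Proof.
move=> h0; elim: k i => // k IH i ik; rewrite exprS coefM big1 // => -[[|j] ji] _ /=.
  by rewrite h0 mul0r.
by rewrite IH ?mulr0 //; lia.
Qed.

(** The exponential truncated after h^L; H_R is this polynomial in h_R, evaluated at w. *)
Definition expp (L : nat) h : {poly K} := \sum_(l < L.+1) (l`!%:R)^-1 *: h ^+ l.

Lemma expp_coef0 L h : h`_0 = 0 -> (expp L h)`_0 = 1.
Proof.
move=> h0; rewrite /expp coef_sum big_ord_recl expr0 coefZ coef1 fact0 invr1 mulr1.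
by rewrite big1 ?addr0 // => i _; rewrite coefZ coef_exp_low ?mulr0.
Qed.

Lemma expp_ode Q h : h`_0 = 0 -> eqmod Q (expp Q h)^`() (h^`() * expp Q h).
Proof.
move=> h0.
have -> : (expp Q h)^`() = h^`() * \sum_(l < Q) (l`!%:R)^-1 *: h ^+ l.
  rewrite /expp raddf_sum big_ord_recl /= expr0 derivZ derivC scaler0 add0r mulr_sumr.
  apply: eq_bigr => l _; rewrite /bump add1n derivZ deriv_exp /= -scalerAr -[_ *+ l.+1]scaler_nat scalerA.
  congr (_ *: _); rewrite factS natrM invfM mulrC mulrA divff ?mul1r ?pnatr_eq0 //.
rewrite /expp big_ord_recr mulrDr => i iQ; rewrite coefD.
rewrite [X in _ = _ + X](_ : _ = 0) ?addr0 // coefM big1 // => j _.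
by rewrite coefZ coef_exp_low ?mulr0 // (leq_ltn_trans _ iQ) // leq_subr.
Qed.

Lemma ode_uniq Q h y z : y`_0 = z`_0 -> eqmod Q y^`() (h * y) ->
  eqmod Q z^`() (h * z) -> eqmod Q.+1 y z.
Proof.
move=> e0 hy hz; elim/ltn_ind => -[|i] IH // iQ.
have i1 : i.+1%:R != 0 :> K by rewrite pnatr_eq0.
apply: (mulIf i1); rewrite !mulr_natr -!coef_deriv hy // hz // !coefM.
by apply: eq_bigr => j _; rewrite IH //; lia.
Qed.

(** Expansion of log prod_k (1 - b_k w)^-1 - sigma^2 w: the linear coefficient is a_1 - (a_1 + a_2)
    = - a_2. Adding c log(1 + w) turns it into [logp], which is h_Q. *)
Definition logp0 A Q : {poly K} := \poly_(r < Q.+1)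
  match r with 0 => 0 | 1 => - A 2 | _ => A r / r%:R end.

Definition log1p Q : {poly K} := \poly_(r < Q.+1)
  if r == 0%N then 0 else (-1) ^+ r.+1 / r%:R.

Definition logp A c Q : {poly K} := logp0 A Q + c%:R *: log1p Q.

(** Convertible to [interp_kap] when A is [psum I b]. *)
Definition kap_seq A c j : K :=
  if c is c'.+1 then
    match j with 0 => - (A 2 - c%:R) | 1 => 0 | _ => A j + A j.+1 end
  else if j is 0 then - A 2 else A j.+1.

(** Model of M(1) / M(0). The power (1 + X)^c is kept as a product, so that lowering c is exact and
    [interp_poly_rec] can supply the recursion asked for by [taylor_family]. *)
Definition interp_poly A c Q : {poly K} := (1 + 'X) ^+ c * expp Q (logp0 A Q).

Lemma logp0_coef0 A Q : (logp0 A Q)`_0 = 0.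
Proof. by rewrite coef_poly. Qed.

Lemma logp_coef0 A c Q : (logp A c Q)`_0 = 0.
Proof. by rewrite coefD coefZ !coef_poly /= mulr0 addr0. Qed.

Lemma coef_logp0_deriv A Q j : (j < Q)%N ->
  (logp0 A Q)^`()`_j = if j is 0 then - A 2 else A j.+1.
Proof.
move=> jQ; rewrite coef_deriv coef_poly ltnS jQ; case: j jQ => [|j] _ //.
by rewrite -[LHS]mulr_natr divfK // pnatr_eq0.
Qed.

Lemma coef_log1p_deriv Q j : (j < Q)%N -> (log1p Q)^`()`_j = (-1) ^+ j.
Proof.
move=> jQ; rewrite coef_deriv coef_poly ltnS jQ /=.
by rewrite -[LHS]mulr_natr divfK ?pnatr_eq0 // !exprS; ring.
Qed.

Lemma log1p_deriv Q : eqmod Q ((1 + 'X) * (log1p Q)^`()) 1.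
Proof.
move=> j jQ; rewrite mulrDl mul1r coefD coefXM coef1 coef_log1p_deriv //.
case: j jQ => [|j] jQ; first by rewrite addr0.
by rewrite /= coef_log1p_deriv ?exprS ?(ltnW jQ) //=; ring.
Qed.

Lemma interp_poly_coef0 A c Q : (interp_poly A c Q)`_0 = 1.
Proof.
rewrite coefM big_ord1 expp_coef0 ?logp0_coef0 // mulr1.
elim: c => [|c IH]; first by rewrite expr0 coef1.
by rewrite exprS coefM big_ord1 IH coefD coef1 coefX addr0 mulr1.
Qed.

Lemma interp_polyS A c Q : interp_poly A c.+1 Q = (1 + 'X) * interp_poly A c Q.
Proof. by rewrite /interp_poly exprS mulrA. Qed.

Lemma deriv_1X : (1 + 'X : {poly K})^`() = 1.
Proof. by rewrite derivD derivX -polyC1 derivC add0r. Qed.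

Lemma interp_poly_ode A c Q :
  eqmod Q (interp_poly A c Q)^`() ((logp A c Q)^`() * interp_poly A c Q).
Proof.
elim: c => [|c IH].
  by rewrite /interp_poly /logp expr0 mul1r scale0r addr0; exact/expp_ode/logp0_coef0.
have -> : logp A c.+1 Q = logp A c Q + log1p Q.
  by rewrite /logp -natr1 scalerDl scale1r addrA.
rewrite interp_polyS derivM deriv_1X mul1r derivD.
set z := interp_poly A c Q in IH *; set l := (logp _ _ _)^`() in IH *.
have -> : (l + (log1p Q)^`()) * ((1 + 'X) * z) =
  ((1 + 'X) * (log1p Q)^`()) * z + (1 + 'X) * (l * z) by ring.
apply: eqmodD; last by apply: eqmodM.
by move=> i iQ; rewrite (eqmodM (@log1p_deriv Q) (q := z) (q' := z)) // mul1r.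
Qed.

(** Both sides start at 1 and solve y' = (logp)' y modulo X^Q, and in characteristic 0 such a
    solution is determined modulo X^(Q+1). *)
Lemma interp_poly_exp A c Q : eqmod Q.+1 (interp_poly A c Q) (expp Q (logp A c Q)).
Proof.
have l0 := logp_coef0 A c Q.
have h1 := @interp_poly_ode A c Q; have h2 := @expp_ode Q _ l0.
have e0 : (interp_poly A c Q)`_0 = (expp Q (logp A c Q))`_0.
  by rewrite interp_poly_coef0 expp_coef0.
exact: (@ode_uniq Q _ _ _ e0 h1 h2).
Qed.

Lemma interp_poly_rec A c Q (q : nat) : (q < Q)%N ->
  q.+1%:R * (interp_poly A c Q)`_q.+1 =
  \sum_(j < q.+1) kap_seq A c j * (interp_poly A c.-1 Q)`_(q - j).
Proof.
move=> qQ; rewrite mulrC mulr_natr -coef_deriv.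
case: c => [|c].
  rewrite (interp_poly_ode A 0) // coefM; apply: eq_bigr => j _; congr (_ * _).
  by rewrite /logp scale0r addr0 coef_logp0_deriv // (leq_trans (ltn_ord j)).
rewrite interp_polyS derivM deriv_1X mul1r /=.
set z := interp_poly A c Q.
have -> : (z + (1 + 'X) * z^`())`_q = ((1 + (1 + 'X) * (logp A c Q)^`()) * z)`_q.
  have -> : (1 + (1 + 'X) * (logp A c Q)^`()) * z =
      z + (1 + 'X) * ((logp A c Q)^`() * z) by ring.
  rewrite !coefD; congr (_ + _).
  by apply: (eqmodM (Q := Q)) => //; exact: interp_poly_ode.
rewrite coefM; apply: eq_bigr => j _; congr (_ * _).
have jQ : (j < Q)%N by rewrite (leq_trans (ltn_ord j)).
have cl i : (i < Q)%N -> (logp A c Q)^`()`_i =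
    (if i is 0 then - A 2 else A i.+1) + c%:R * (-1) ^+ i.
  by move=> iQ; rewrite /logp derivD derivZ coefD coefZ coef_logp0_deriv // coef_log1p_deriv.
rewrite coefD coef1 mulrDl mul1r coefD coefXM cl //.
case: (nat_of_ord j) jQ => [|i] iQ /=; first by rewrite -natr1 expr0; ring.
rewrite cl ?(ltnW iQ) // exprS; case: i iQ => [|i] _; first by rewrite expr0; ring.
by ring.
Qed.

Lemma size_logp A c Q : (size (logp A c Q) <= Q.+1)%N.
Proof.
apply: leq_trans (size_polyD _ _) _; rewrite geq_max size_poly.
by apply: leq_trans (size_scale_leq _ _) _; exact: size_poly.
Qed.

Lemma size_expp L Q h : (size h <= Q.+1)%N -> (size (expp L h) <= (Q * L).+1)%N.
Proof.
move=> hs; apply: leq_trans (size_sum _ _ _) _; apply/bigmax_leqP => l _.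
apply: leq_trans (size_scale_leq _ _) _; apply: leq_trans (size_poly_exp_leq _ _) _.
rewrite ltnS leq_mul //; last by rewrite -ltnS.
by move: hs; case: (size h).
Qed.

(** * Polynomials under a weighted l1 norm *)

Section WeightedNorm.
Variables (dl : K).
Hypothesis dl0 : 0 <= dl.

(** The weight dl is the size of w against the Poisson law: [fnorm_peval_w] turns this norm into an
    l1 bound for p evaluated at w. *)
Definition pnorm p := \sum_(i < size p) `|p`_i| * dl ^+ i.

Lemma pnormE n p : (size p <= n)%N -> pnorm p = \sum_(i < n) `|p`_i| * dl ^+ i.
Proof.
move=> h; rewrite /pnorm -(subnKC h) big_split_ord /= [X in _ + X]big1 ?addr0 // => i _.
by rewrite nth_default ?normr0 ?mul0r // leq_addr.
Qed.

Lemma pnorm_ge0 p : 0 <= pnorm p.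
Proof. by apply: sumr_ge0 => i _; rewrite mulr_ge0 ?exprn_ge0. Qed.

Lemma pnormD p q : pnorm (p + q) <= pnorm p + pnorm q.
Proof.
rewrite (pnormE (size_polyD p q)) (pnormE (leq_maxl (size p) (size q))).
rewrite (pnormE (leq_maxr (size p) (size q))) -big_split; apply: ler_sum => i _ /=.
by rewrite coefD -mulrDl ler_wpM2r ?exprn_ge0 ?ler_normD.
Qed.

Lemma pnorm0 : pnorm 0 = 0.
Proof. by rewrite /pnorm size_poly0 big_ord0. Qed.

Lemma pnorm1 : pnorm 1 = 1.
Proof. by rewrite /pnorm size_poly1 big_ord1 coef1 normr1 mulr1. Qed.

Lemma pnormZ a p : pnorm (a *: p) = `|a| * pnorm p.
Proof.
rewrite (pnormE (size_scale_leq a p)) mulr_sumr; apply: eq_bigr => i _.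
by rewrite coefZ normrM mulrA.
Qed.

Lemma pnorm_sum J (r : seq J) (P : pred J) (F : J -> {poly K}) :
  pnorm (\sum_(j <- r | P j) F j) <= \sum_(j <- r | P j) pnorm (F j).
Proof.
elim/big_rec2: _ => [|j a p _ h]; first by rewrite pnorm0.
by apply: le_trans (pnormD _ _) _; rewrite lerD2l.
Qed.

Lemma pnormM p q : pnorm (p * q) <= pnorm p * pnorm q.
Proof.
pose ab p := \poly_(i < size p) `|p`_i|.
have abE r i : (ab r)`_i = `|r`_i|.
  by rewrite coef_poly; case: ltnP => // h; rewrite nth_default ?normr0.
have nE r : pnorm r = (ab r).[dl].
  rewrite (horner_coef_wide _ (size_poly _ _)).
  by apply: eq_bigr => i _; rewrite abE.
have sz : (size (ab p * ab q)%R <= size p + size q)%N.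
  apply: leq_trans (size_polyMleq _ _) _; apply: leq_trans (leq_pred _) _.
  by apply: leq_add; exact: size_poly.
rewrite !nE -hornerM -nE (horner_coef_wide _ sz) (@pnormE (size p + size q)); last first.
  by apply: leq_trans (size_polyMleq _ _) (leq_pred _).
apply: ler_sum => i _; apply: ler_wpM2r; first exact: exprn_ge0.
rewrite !coefM; apply: le_trans (ler_norm_sum _ _ _) _.
by apply: ler_sum => j _; rewrite !abE normrM.
Qed.

Lemma pnormX p k : pnorm (p ^+ k) <= pnorm p ^+ k.
Proof.
elim: k => [|k IH]; first by rewrite !expr0 pnorm1.
rewrite !exprS; apply: le_trans (pnormM _ _) _.
by rewrite ler_wpM2l ?pnorm_ge0.
Qed.

Lemma pnormX_sub p q X l : pnorm p <= X -> pnorm q <= X ->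
  pnorm (p ^+ l - q ^+ l) <= l%:R * X ^+ l.-1 * pnorm (p - q).
Proof.
move=> hp hq; have X0 := le_trans (pnorm_ge0 p) hp.
rewrite subrXX; apply: le_trans (pnormM _ _) _; rewrite mulrC.
apply: ler_wpM2r; first exact: pnorm_ge0.
apply: le_trans (pnorm_sum _ _ _) _.
have -> : l%:R * X ^+ l.-1 = \sum_(i < l) X ^+ l.-1 by rewrite sumr_const card_ord mulr_natl.
apply: ler_sum => i _.
apply: le_trans (pnormM _ _) _.
have -> : X ^+ l.-1 = X ^+ (l.-1 - i) * X ^+ i.
  by rewrite -exprD subnK // -ltnS prednK // (leq_ltn_trans (leq0n i)).
apply: ler_pM; rewrite ?pnorm_ge0 //.
  apply: le_trans (pnormX _ _) _.
  by rewrite lerXn2r // nnegrE pnorm_ge0.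
by apply: le_trans (pnormX _ _) _; rewrite lerXn2r // nnegrE pnorm_ge0.
Qed.

(** [pnorm p ^+ L.+1] accounts for the powers of p beyond L, [pnorm (p - q)] for the replacement of
    p by q in the lower ones. *)
Lemma pnorm_expp_sub D L p q X : (L < D)%N -> 1 <= X -> pnorm p <= X -> pnorm q <= X ->
  pnorm (expp D p - expp L q) <=
  (D ^ 2)%:R * X ^+ D * (pnorm p ^+ L.+1 + pnorm (p - q)).
Proof.
move=> LD X1 hp hq; have X0 : 0 <= X by apply: le_trans X1.
have fi l : 0 <= (l`!%:R : K)^-1 <= 1.
  by rewrite invr_ge0 ler0n /= invf_le1 ?ltr0n ?fact_gt0 // ler1n fact_gt0.
have -> : expp D p - expp L q = \sum_(l < L.+1) (l`!%:R)^-1 *: (p ^+ l - q ^+ l) +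
    \sum_(l < D - L) ((L.+1 + l)`!%:R)^-1 *: p ^+ (L.+1 + l).
  have eD : D = (L + (D - L))%N by rewrite subnKC // ltnW.
  move: eD; move: (D - L)%N => k ->; rewrite /expp -addSn big_split_ord /= addrAC.
  by congr (_ + _); rewrite -sumrB; apply: eq_bigr => l _; rewrite scalerBr.
have x0 := pnorm_ge0 p; have y0 := pnorm_ge0 (p - q).
have XD l : (l <= D)%N -> X ^+ l <= X ^+ D by move=> lD; rewrite ler_weXn2l.
apply: le_trans (pnormD _ _) _; rewrite mulrDr addrC; apply: lerD.
  apply: le_trans (pnorm_sum _ _ _) _.
  apply: (@le_trans _ _ (\sum_(l < D - L) X ^+ D * pnorm p ^+ L.+1)).
    apply: ler_sum => l _; have /andP[f0 f1] := fi (L.+1 + l)%N.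
    rewrite pnormZ ger0_norm //; apply: (@le_trans _ _ (1 * pnorm p ^+ (L.+1 + l))).
      apply: ler_pM => //; rewrite ?pnorm_ge0 //; exact: pnormX.
    rewrite mul1r exprD mulrC ler_wpM2r ?exprn_ge0 //.
    apply: (@le_trans _ _ (X ^+ l)); first by rewrite lerXn2r ?nnegrE.
    by apply: XD; have := ltn_ord l; lia.
  rewrite sumr_const card_ord -[leLHS]mulr_natl mulrA.
  apply: ler_wpM2r; first exact: exprn_ge0.
  apply: ler_wpM2r; first exact: exprn_ge0.
  by rewrite ler_nat; nia.
apply: le_trans (pnorm_sum _ _ _) _.
apply: (@le_trans _ _ (\sum_(l < L.+1) D%:R * X ^+ D * pnorm (p - q))).
  apply: ler_sum => l _; have /andP[f0 f1] := fi l.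
  rewrite pnormZ ger0_norm //; apply: (@le_trans _ _ (1 * (l%:R * X ^+ l.-1 * pnorm (p - q)))).
    by apply: ler_pM => //; [exact: pnorm_ge0|exact: pnormX_sub].
  rewrite mul1r ler_wpM2r //; have lL := ltn_ord l.
  apply: ler_pM => //; rewrite ?exprn_ge0 ?ler_nat //; first by lia.
  by apply: XD; lia.
rewrite sumr_const card_ord -[leLHS]mulr_natl !mulrA -natrM.
apply: ler_wpM2r => //; apply: ler_wpM2r; first exact: exprn_ge0.
by rewrite ler_nat; nia.
Qed.

End WeightedNorm.

Definition peval_w p : fps K := (map_poly fps_cst p).[fps_w].

Lemma peval_wE n p : (size p <= n)%N ->
  peval_w p = \sum_(i < n) fps_cst p`_i * fps_w ^+ i.
Proof.
move=> h; rewrite /peval_w (@horner_coef_wide _ n); last first.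
  by apply: leq_trans h; rewrite size_map_poly.
by apply: eq_bigr => i _; rewrite coef_map.
Qed.

Lemma fnorm_peval_w N (e : fps K) dl D p : (size p <= D)%N ->
  (forall k, (k < D)%N -> fnorm N (fps_w ^+ k * e) <= dl ^+ k) ->
  fnorm N (e * peval_w p) <= pnorm dl p.
Proof.
move=> h he; rewrite (peval_wE h) (pnormE dl h) mulr_sumr.
apply: le_trans (fnorm_sum _ _ _ _) _; apply: ler_sum => i _.
rewrite mulrCA fnormZ ler_wpM2l // mulrC; exact: he.
Qed.

End TruncatedExponential.

Section PoissonCharlier.
Context {K : realType} {T : Type}.
Variables (I : seq T) (b : T -> K).
Hypothesis b0 : forall k, 0 <= b k.
Variables (N D c L R : nat) (dl ep C X : K).
Hypotheses (D3 : (3 <= D)%N) (dl0 : 0 <= dl) (ep01 : 0 <= ep <= 1) (C0 : 0 <= C).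
Hypotheses (RLD : (R * L < D)%N) (LD : (L < D)%N).
Hypothesis smooth : forall c' p s, (p <= D.+3)%N -> 0 <= s <= 1 ->
  fnorm N (fps_w ^+ p * interp I b c' s) <= dl ^+ p.
Hypothesis kap_le : forall i j, (i < D)%N -> (j < D)%N ->
  `|kap_seq (psum I b) (c - i) j| * dl ^+ j.+1 <= C * ep ^+ j.+1.

Let h := logp (psum I b) c.

Hypotheses (X1 : 1 <= X) (hX : pnorm dl (h D) <= X) (hX' : pnorm dl (h R) <= X).

(** The Taylor polynomial of order D is exp(h_D) modulo w^D. As R L < D, the polynomial H_R is not
    cut at that order, so the discrepancy is the part of [expp D (h D) - expp L (h R)] of degree
    below D, whose norm is at most that of the whole. *)
Lemma poisson_charlier_approx :
  fnorm N (interp I b c 1 - expw (pois_mean I b) * peval_w (expp L (h R))) <=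
  (1 + 2 * C) ^+ D * ep ^+ D +
  (D ^ 2)%:R * X ^+ D * (pnorm dl (h D) ^+ L.+1 + pnorm dl (h D - h R)).
Proof.
pose A := psum I b; pose e := expw (pois_mean I b); rewrite -/e.
pose f i q := (interp_poly A (c - i) D)`_q.
have f0 i : f i 0%N = 1 by exact: interp_poly_coef0.
have frec i q : (i < D)%N -> (q < D)%N -> q.+1%:R * f i q.+1 =
    \sum_(j < q.+1) interp_kap I b (c - i) j * f i.+1 (q - j)%N.
  by move=> _ qD; rewrite /f interp_poly_rec // subnS.
have ap := interp_approx b0 D3 dl0 ep01 C0 smooth kap_le f0 frec.
pose p := take_poly D (expp D (h D) - expp L (h R)).
have -> : interp I b c 1 - e * peval_w (expp L (h R)) =
  (interp I b c 1 - e * \sum_(q < D) fps_cst (f 0%N q) * fps_w ^+ q) + e * peval_w p.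
  rewrite (peval_wE (size_take_poly _ _)) (@peval_wE _ D); last first.
    by apply: leq_trans (size_expp _ (size_logp _ _ _)) _.
  have -> : \sum_(i < D) fps_cst p`_i * fps_w ^+ i =
      \sum_(q < D) fps_cst (f 0%N q) * fps_w ^+ q -
      \sum_(i < D) fps_cst (expp L (h R))`_i * fps_w ^+ i.
    rewrite -sumrB; apply: eq_bigr => q _.
    rewrite coef_take_poly ltn_ord coefB /f subn0 interp_poly_exp ?(ltnW (ltn_ord q)) //.
      by rewrite rmorphB mulrBl.
    by rewrite ltnS ltnW.
  by ring.
apply: le_trans (fnormD _ _ _) _; apply: lerD => //.
apply: le_trans (@fnorm_peval_w _ N e dl D p (size_take_poly _ _) _) _.
  by move=> q qD; rewrite /e -(interp0 I b 0); apply: smooth; [lia|rewrite lexx ler01].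
apply: le_trans (pnorm_expp_sub dl0 LD X1 hX hX').
set r := _ - _ in p *.
rewrite (pnormE dl (size_take_poly _ _)) (@pnormE K dl (D + size r)) ?leq_addl //.
rewrite big_split_ord /= -[leLHS]addr0; apply: lerD.
  by apply: ler_sum => i _; rewrite coef_take_poly ltn_ord.
by apply: sumr_ge0 => i _; rewrite mulr_ge0 ?exprn_ge0.
Qed.

End PoissonCharlier.

(** * Error bound with uniform constants *)

Section CoreBound.
Context {K : realType}.

Lemma coef_logp_bound (A : nat -> K) c Q r : (forall j, 0 <= A j) -> (0 < r <= Q)%N ->
  `|(logp A c Q)`_r| <= if (r <= 2)%N then `|A 2 - c%:R| else A r + c%:R.
Proof.
move=> A0 /andP[r0 rQ]; rewrite coefD coefZ !coef_poly ltnS rQ.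
case: r r0 rQ => [|[|[|r]]] //= _ rQ.
- have -> : - A 2 + c%:R * ((-1) ^+ 2 / 1) = - (A 2 - c%:R) by rewrite divr1; ring.
  by rewrite normrN.
- have -> : A 2 / 2 + c%:R * ((-1) ^+ 3 / 2) = (A 2 - c%:R) / 2 by field.
  by rewrite normrM ler_piMr // ger0_norm; lra.
have r1 : 1 <= r.+3%:R :> K by rewrite ler1n.
have ri : 0 <= (r.+3%:R : K)^-1 <= 1 by rewrite invr_ge0 ler0n invf_le1 // ltr0n.
have /andP[i0 i1] := ri.
apply: le_trans (ler_normD _ _) _; apply: lerD.
  by rewrite normrM (ger0_norm (A0 _)) ger0_norm // ler_piMr.
by rewrite normrM [`|_ / _|]normrM normrX normrN1 expr1n mul1r normr_nat ger0_norm // ler_piMr.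
Qed.

Lemma pnorm_le (p : {poly K}) dl D E : 0 <= dl -> 0 <= E -> (size p <= D.+1)%N ->
  p`_0 = 0 -> (forall r, (0 < r <= D)%N -> `|p`_r| * dl ^+ r <= E) ->
  pnorm dl p <= D%:R * E.
Proof.
move=> d0 E0 sp p0 h; rewrite (pnormE dl sp) big_ord_recl p0 normr0 mul0r add0r.
have -> : D%:R * E = \sum_(i < D) E by rewrite sumr_const card_ord mulr_natl.
by apply: ler_sum => i _; rewrite lift0; apply: h; rewrite /= ltn_ord.
Qed.

(** B is the rate to be reached and [E1] the size of the terms of h under smoothing. Three errors
    must be below B: the powers of h beyond L ([E1 ^+ L.+1]), the coefficients of h beyond R, and
    the Taylor remainder [ep ^+ D]. The constant is fixed before the family b, hence uniform in n
    and m. *)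
Lemma core_bound (C1 : K) (D L R : nat) : 1 <= C1 -> (3 <= D)%N -> (R <= D)%N ->
  (R * L < D)%N -> (L < D)%N -> exists2 C2 : K, 0 < C2 &
  forall (T : Type) (I : seq T) (b : T -> K), (forall k, 0 <= b k) ->
  forall (c : nat) (dl ep E1 B : K), 0 <= dl -> 0 <= ep <= 1 -> 0 <= B -> 0 <= E1 <= C1 ->
  (forall N c' p s, (p <= D.+3)%N -> 0 <= s <= 1 ->
    fnorm N (fps_w ^+ p * interp I b c' s) <= dl ^+ p) ->
  (forall i j, (i < D)%N -> (j < D)%N ->
    `|kap_seq (psum I b) (c - i) j| * dl ^+ j.+1 <= C1 * ep ^+ j.+1) ->
  (forall r, (0 < r <= D)%N -> `|(logp (psum I b) c D)`_r| * dl ^+ r <= E1) ->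
  (forall r, (R < r <= D)%N -> `|(logp (psum I b) c D)`_r| * dl ^+ r <= C1 * B) ->
  E1 ^+ L.+1 <= C1 * B -> ep ^+ D <= C1 * B ->
  forall N, fnorm N (interp I b c 1 -
    expw (pois_mean I b) * peval_w (expp L (logp (psum I b) c R))) <= C2 * B.
Proof.
move=> C1_1 D3 RD RLD LD; have C10 : 0 < C1 by rewrite (lt_le_trans ltr01).
have D1 : 1 <= D%:R :> K by rewrite ler1n; lia.
have D0 := ltW (lt_le_trans ltr01 D1).
exists ((1 + 2 * C1) ^+ D * C1 + (D ^ 2)%:R * (D%:R * C1) ^+ D * (D%:R ^+ L.+1 * C1 + D%:R * C1)).
  apply: ltr_pwDl; first by rewrite mulr_gt0 // exprn_gt0 //; lra.
  by rewrite !mulr_ge0 ?exprn_ge0 ?addr_ge0 ?mulr_ge0 ?exprn_ge0 // ltW.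
move=> T I b b0 c dl ep E1 B dl0 ep01 B0 /andP[E10 E1C] smooth kap hE1 hE2 hE1L hep N.
have CB : 0 <= C1 * B by rewrite mulr_ge0 // ltW.
set h := logp (psum I b) c in hE1 hE2 *.
have hRc r : (r <= R)%N -> (h R)`_r = (h D)`_r.
  move=> rR; rewrite /h /logp !coefD !coefZ !coef_poly !ltnS rR.
  by rewrite (leq_trans rR RD).
have szR : (size (h R) <= D.+1)%N by apply: leq_trans (size_logp _ _ _) _.
have hRc' r : (R < r)%N -> (h R)`_r = 0.
  by move=> rR; rewrite nth_default // (leq_trans (size_logp _ _ _)).
have nD : pnorm dl (h D) <= D%:R * E1.
  by apply: pnorm_le => //; [exact: size_logp|exact: logp_coef0].
have nR : pnorm dl (h R) <= D%:R * E1.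
  apply: pnorm_le => //; first exact: logp_coef0.
  move=> r rD; case: (leqP r R) => rR; first by rewrite hRc // hE1.
  by rewrite hRc' // normr0 mul0r.
have nB : pnorm dl (h D - h R) <= D%:R * (C1 * B).
  apply: pnorm_le => //.
  - by apply: leq_trans (size_polyD _ _) _; rewrite size_polyN geq_max size_logp.
  - by rewrite coefB !logp_coef0 subrr.
  move=> r /andP[r0 rD]; rewrite coefB; case: (leqP r R) => rR.
    by rewrite hRc // subrr normr0 mul0r.
  by rewrite hRc' // subr0; apply: hE2; rewrite rR.
have X1 : 1 <= D%:R * C1 by rewrite -[leLHS]mulr1 ler_pM.
have DE : D%:R * E1 <= D%:R * C1 by rewrite ler_wpM2l.
have := @poisson_charlier_approx K T I b b0 N D c L R dl ep C1 (D%:R * C1) D3 dl0 ep01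
  (ltW C10) RLD LD (smooth N) kap X1 (le_trans nD DE) (le_trans nR DE).
move=> /le_trans; apply; rewrite [leRHS]mulrDl; apply: lerD.
  by rewrite -mulrA ler_wpM2l // exprn_ge0 //; lra.
rewrite -[leRHS]mulrA; apply: ler_wpM2l; first by rewrite mulr_ge0 ?exprn_ge0 // (le_trans ler01).
rewrite mulrDl; apply: lerD; last by rewrite -mulrA.
apply: (@le_trans _ _ ((D%:R * E1) ^+ L.+1)).
  by rewrite lerXn2r ?nnegrE ?pnorm_ge0 ?mulr_ge0.
by rewrite exprMn -mulrA ler_wpM2l ?exprn_ge0.
Qed.

(** Lowering c by i < D moves [A 2 - c%:R] by at most D. If [c - i] is 0 then c < D, and [A 2]
    itself is at most D + 1. This is the origin of the factor [D.+1]. *)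
Lemma kap_bound (A : nat -> K) (c D : nat) (dl ep C : K) : (forall j, 0 <= A j) ->
  1 <= C -> 0 <= dl -> 0 <= ep -> 0 <= A 2 - c%:R <= 1 -> dl <= C * ep ->
  (forall j, (2 <= j < D)%N -> (A j + A j.+1) * dl ^+ j.+1 <= C * ep ^+ j.+1) ->
  forall i j, (i < D)%N -> (j < D)%N ->
  `|kap_seq A (c - i) j| * dl ^+ j.+1 <= (D.+1%:R * C ^+ 2) * ep ^+ j.+1.
Proof.
move=> A0 C1 d0 e0 /andP[Ac0 Ac1] de hA i j iD jD.
have C0 : 0 <= C by apply: le_trans C1.
have D1 : 1 <= D.+1%:R :> K by rewrite ler1n.
have CC : C <= D.+1%:R * C ^+ 2.
  rewrite -[leLHS]mul1r; apply: ler_pM => //.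
  by rewrite expr2 ler_peMr.
have lin (x : K) : 0 <= x <= D.+1%:R -> x * dl ^+ 1 <= D.+1%:R * C ^+ 2 * ep ^+ 1.
  move=> /andP[x0 xD]; rewrite !expr1 -mulrA; apply: ler_pM => //.
  apply: le_trans de _; apply: ler_wpM2r => //; by rewrite expr2 ler_peMr.
have sqr (x : K) : 0 <= x <= D.+1%:R -> x * dl ^+ 2 <= D.+1%:R * C ^+ 2 * ep ^+ 2.
  move=> /andP[x0 xD]; rewrite -mulrA; apply: ler_pM; rewrite ?exprn_ge0 //.
  by rewrite -exprMn lerXn2r ?nnegrE // mulr_ge0.
have big : (2 <= j)%N -> (A j + A j.+1) * dl ^+ j.+1 <= D.+1%:R * C ^+ 2 * ep ^+ j.+1.
  move=> j2; apply: le_trans (hA j _) _; first by rewrite j2.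
  by rewrite ler_wpM2r ?exprn_ge0.
case ci: (c - i)%N => [|c'].
  have A2 : 0 <= A 2 <= D.+1%:R.
    rewrite A0 -natr1; have : c%:R <= D%:R :> K by rewrite ler_nat; lia.
    by lra.
  case: j jD big => [|[|j]] jD big /=; rewrite ?normrN ger0_norm //; [exact: lin|exact: sqr|].
  apply: le_trans (big _) => //; apply: ler_wpM2r; first exact: exprn_ge0.
  by rewrite lerDr.
case: j jD big => [|[|j]] jD big /=.
- rewrite normrN; have : c'.+1%:R <= c%:R :> K by rewrite ler_nat; lia.
  have : c%:R <= c'.+1%:R + D%:R :> K by rewrite -natrD ler_nat; lia.
  move=> h1 h2; apply: lin; rewrite normr_ge0 /= ger0_norm -?natr1; lra.
- by rewrite normr0 mul0r mulr_ge0 ?exprn_ge0 ?mulr_ge0 ?exprn_ge0.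
by rewrite ger0_norm ?addr_ge0 //; apply: big.
Qed.

End CoreBound.

(** * Power sums and smoothing for the coupon parameters *)

Section CouponParameters.
Context {K : realType}.
Implicit Types n m k : nat.

(** With k coupons missing a draw is new with probability k / n; this is the ratio of failure to
    success, the mean of the k-th geometric variable. *)
Definition odds n k : K := (n - k)%:R / k%:R.

Definition odds_range m n := index_iota m.+1 n.+1.

Lemma odds_ge0 n k : 0 <= odds n k.
Proof. by rewrite divr_ge0. Qed.

Lemma acoef_psum n m j : acoef n m j = psum (odds_range m n) (odds n) j :> K.
Proof.
rewrite /acoef /psum /odds_range big_nat_cond [RHS]big_nat_cond.
by apply: eq_bigr => k /andP[/andP[mk kn] _]; rewrite /odds natrB // -ltnS.
Qed.

Lemma sigma_sq_pois n m : sigma_sq n m = pois_mean (odds_range m n) (odds n) :> K.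
Proof.
rewrite /pois_mean -!acoef_psum /sigma_sq /acoef mulr_sumr -big_split.
apply: eq_big_nat => k /andP[mk kn] /=.
by field; rewrite pnatr_eq0; lia.
Qed.

Lemma psum_le n m j (B : K) : (m <= n)%N -> (forall k, (m < k <= n)%N -> odds n k <= B) ->
  psum (odds_range m n) (odds n) j <= (n - m)%:R * B ^+ j.
Proof.
move=> mn h; rewrite /psum /odds_range big_nat_cond.
apply: (@le_trans _ _ (\sum_(m.+1 <= k < n.+1 | (m.+1 <= k < n.+1)%N && true) B ^+ j)).
  apply: ler_sum => k /andP[/andP[mk kn] _].
  by rewrite lerXn2r ?nnegrE ?odds_ge0 // ?(le_trans (odds_ge0 n k)) // h // mk -ltnS.
by rewrite -big_nat_cond sumr_const_nat subSS mulr_natl.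
Qed.

Lemma psum_ge n m j r (B : K) : (m + r <= n)%N -> 0 <= B ->
  (forall k, (m < k <= m + r)%N -> B <= odds n k) ->
  r%:R * B ^+ j <= psum (odds_range m n) (odds n) j.
Proof.
move=> mn B0 h; rewrite /psum /odds_range (@big_cat_nat _ _ _ (m + r).+1) ?ltnS ?leq_addr //=.
apply: ler_wpDr; first by apply: sumr_ge0 => k _; rewrite exprn_ge0 ?odds_ge0.
rewrite big_nat_cond.
apply: (@le_trans _ _ (\sum_(m.+1 <= k < (m + r).+1 | (m.+1 <= k < (m + r).+1)%N && true) B ^+ j)).
  by rewrite -big_nat_cond sumr_const_nat subSS addKn mulr_natl.
apply: ler_sum => k /andP[/andP[mk kn] _].
by rewrite lerXn2r ?nnegrE ?odds_ge0 // h // mk -ltnS.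
Qed.

Lemma sqrtV_le (x y : K) : 0 < y -> y ^- 2 <= x -> (Num.sqrt x)^-1 <= y.
Proof.
move=> y0 h; have y2 : 0 < y ^- 2 by rewrite invr_gt0 exprn_gt0.
have x0 := lt_le_trans y2 h.
rewrite -[leRHS]invrK lef_pV2 ?posrE ?sqrtr_gt0 ?invr_gt0 //.
have yi : 0 <= y^-1 by rewrite invr_ge0 ltW.
by rewrite -[leLHS](ger0_norm yi) -sqrtr_sqr ler_wsqrtr // exprVn.
Qed.

(** The r factors with k in (m, m + r] are dealt out to P groups of [r %/ P] each, that is [k.+3]
    factors with k = [r %/ P - 3]. The condition on [16 * P] makes r at most [4 * P * k.+1], hence
    the constant 4 in the hypothesis on dl. *)
Lemma odds_smooth n m r P (b1 dl : K) : (0 < P)%N -> (m + r <= n)%N -> (16 * P <= r.+1 * 2)%N ->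
  0 < b1 -> (forall k, (m < k <= m + r)%N -> b1 <= odds n k) -> 0 < dl ->
  dl ^- 2 <= b1 / 2 * (1 + b1 / 2) * (r%:R / (4 * P%:R)) ->
  forall N c' p s, (p <= P)%N -> 0 <= s <= 1 ->
  fnorm N (fps_w ^+ p * interp (odds_range m n) (odds n) c' s) <= dl ^+ p.
Proof.
move=> P0 mr rP b10 hb dl0 hdl N c' p s pP hs.
have P0' : 0 < P%:R :> K by rewrite ltr0n.
have kk : (P * (r %/ P - 3).+3 <= r)%N.
  have h3 : (3 <= r %/ P)%N by rewrite leq_divRL //; lia.
  have -> : ((r %/ P - 3).+3 = r %/ P)%N by lia.
  by rewrite mulnC leq_divM.
have kk1 : (r <= 4 * P * (r %/ P - 3).+1)%N.
  have := ltn_ceil r P0; nia.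
have r1 : (1 <= r)%N by lia.
have sz : size (index_iota m.+1 (m + r).+1) = r by rewrite size_iota subSS addKn.
have split : odds_range m n = index_iota m.+1 (m + r).+1 ++ index_iota (m + r).+1 n.+1.
  rewrite /odds_range /index_iota !subSS addKn.
  have -> : ((m + r).+1 = m.+1 + r)%N by rewrite addSn.
  by rewrite -iotaD; congr iota; lia.
have hsum : r%:R * b1 ^+ 1 <= psum (odds_range m n) (odds n) 1 := psum_ge 1 mr (ltW b10) hb.
have hsum2 : r%:R * b1 ^+ 2 <= psum (odds_range m n) (odds n) 2 := psum_ge 2 mr (ltW b10) hb.
have r0 : 0 < r%:R :> K by rewrite ltr0n.
have pm : r%:R * (b1 * (1 + b1)) <= pois_mean (odds_range m n) (odds n).
  rewrite /pois_mean; have -> : r%:R * (b1 * (1 + b1)) = r%:R * b1 ^+ 1 + r%:R * b1 ^+ 2 by ring.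
  exact: lerD.
have pm0 : 0 < r%:R * (b1 * (1 + b1)) by rewrite !mulr_gt0 // addr_gt0.
apply: (@interp_smooth K _ _ _ (@odds_ge0 n) N c' p s _ _ P (r %/ P - 3) b1 dl split) => //.
- by rewrite sz.
- rewrite sz => i ir k0; apply: hb.
  by rewrite nth_iota ?subSS ?addKn //; move: ir; clear; lia.
- exact: lt_le_trans pm.
- apply: sqrtV_le => //; apply: le_trans hdl _.
  rewrite ler_pdivlMr ?mulr_gt0 //; apply: le_trans pm.
  rewrite [leLHS](_ : _ = r%:R * (b1 * (1 + b1 / 2) / 4)); last by field; rewrite gt_eqF.
  rewrite ler_pM2l //; have : 0 < b1 ^+ 2 by rewrite exprn_gt0.
  lra.
apply: sqrtV_le => //; apply: le_trans hdl _.
apply: ler_wpM2l; first by rewrite mulr_ge0 //; lra.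
rewrite ler_pdivrMr ?mulr_gt0 // mulrC -!natrM ler_nat.
exact: kk1.
Qed.

End CouponParameters.

(* [lia] after dropping the hypotheses that are not about natural numbers,
   whose preprocessing can be very slow. *)
Ltac nat_fact P :=
  lazymatch P with
  | is_true (leq _ _) => idtac
  | is_true (andb (leq _ _) (leq _ _)) => idtac
  | @eq nat _ _ => idtac
  end.
Ltac nlia :=
  repeat match goal with H := _ : _ |- _ => clearbody H end;
  repeat match goal with H : ?P |- _ =>
    lazymatch type of P with
    | Prop => tryif nat_fact P then fail else clear H
    end end;
  lia.

(** * The regimes of the parameters *)

Section Regimes.
Context {K : realType}.
Implicit Types (n m k : nat).

Lemma sixth_root (x : K) : 1 <= x ->
  exists2 e : K, 0 < e <= 1 & x = e ^- 6 /\ Num.sqrt x = e ^- 3.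
Proof.
move=> x1; have x0 : 0 < x by rewrite (lt_le_trans ltr01).
pose q := x `^ (6%:R^-1).
have q0 : 0 < q by rewrite powR_gt0.
have q6 : q ^+ 6 = x.
  by rewrite -powR_mulrn ?ltW // /q -powRrM mulVf ?pnatr_eq0 // powRr1 // ltW.
have q1 : 1 <= q.
  rewrite leNgt; apply/negP => lt.
  have : q ^+ 6 < 1 by rewrite exprn_ilt1 // ltW.
  by rewrite q6 ltNge x1.
exists q^-1; first by rewrite invr_gt0 q0 invf_le1.
split; first by rewrite exprVn invrK.
rewrite exprVn invrK -q6 (_ : q ^+ 6 = (q ^+ 3) ^+ 2); last by rewrite -exprM.
by rewrite sqrtr_sqr ger0_norm // exprn_ge0 // ltW.
Qed.

Lemma odds_le_half n m k : (0 < m < n)%N -> (n <= 2 * m)%N -> (m < k <= n)%N ->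
  odds n k <= 2 * ((n - m)%:R / n%:R) :> K.
Proof.
move=> /andP[m0 mn] nm /andP[mk kn]; rewrite /odds.
have k0 : 0 < k%:R :> K by rewrite ltr0n; lia.
have n0 : 0 < n%:R :> K by rewrite ltr0n; lia.
rewrite mulrA ler_pdivrMr // mulrAC ler_pdivlMr // -!natrM ler_nat.
nia.
Qed.

Lemma odds_ge_half n m k : (m < n)%N -> (m < k <= m + (n - m) %/ 2)%N ->
  (n - m)%:R / n%:R / 2 <= odds n k :> K.
Proof.
move=> mn /andP[mk kn]; rewrite /odds.
have k0 : 0 < k%:R :> K by rewrite ltr0n; lia.
have n0 : 0 < n%:R :> K by rewrite ltr0n; lia.
rewrite -mulrA -invfM ler_pdivrMr ?mulr_gt0 // mulrAC ler_pdivlMr // -!natrM ler_nat.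
nia.
Qed.

(** The lower half of the range has ratios at least (n - m) / (2 n). When a_{n,2} < 1 this forces (n
    - m)^3 <= 16 n^2. *)
Lemma psum2_ge n m : (m < n)%N -> (2 <= n - m)%N ->
  (n - m)%:R ^+ 3 / (16 * n%:R ^+ 2) <= psum (odds_range m n) (odds n) 2 :> K.
Proof.
move=> mn N2.
have n0 : 0 < n%:R :> K by rewrite ltr0n; lia.
have b10 : 0 <= (n - m)%:R / n%:R / 2 :> K by rewrite !divr_ge0.
have mr : (m + (n - m) %/ 2 <= n)%N by lia.
apply: le_trans (psum_ge 2 mr b10 _); last by move=> k hk; exact: odds_ge_half.
apply: (@le_trans _ _ ((n - m)%:R / 4 * ((n - m)%:R / n%:R / 2) ^+ 2)).
  by apply: le_of_eq; field; rewrite gt_eqF.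
rewrite ler_wpM2r ?exprn_ge0 // ler_pdivrMr // -natrM ler_nat; lia.
Qed.

(** About (n - m) / 2 geometric factors of ratio at least (n - m) / (2 n) have total variance of
    order (n - m)^2 / n; its inverse square root is the order of the bound. *)
Lemma half_smooth n m P : (0 < P)%N -> (m < n)%N -> (16 * P <= n - m)%N ->
  forall N c' p s, (p <= P)%N -> 0 <= s <= 1 ->
  fnorm N (fps_w ^+ p * interp (odds_range m n) (odds n) c' s) <=
  (64 * P%:R * Num.sqrt n%:R / (n - m)%:R : K) ^+ p.
Proof.
move=> P0 mn PN.
have n0 : 0 < n%:R :> K by rewrite ltr0n; lia.
have P0' : 1 <= P%:R :> K by rewrite ler1n.
have N0 : 0 < (n - m)%:R :> K by rewrite ltr0n; lia.
have s0 : 0 < Num.sqrt n%:R :> K by rewrite sqrtr_gt0.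
have ss : Num.sqrt n%:R ^+ 2 = n%:R :> K by rewrite sqr_sqrtr // ltW.
apply: (@odds_smooth K n m ((n - m) %/ 2) P ((n - m)%:R / n%:R / 2)) => //.
- by lia.
- by lia.
- by rewrite !divr_gt0.
- by move=> k; exact: odds_ge_half.
- by rewrite divr_gt0 ?mulr_gt0 //; lra.
have PP : 0 < P%:R :> K by rewrite (lt_le_trans ltr01).
set x : K := (n - m)%:R in N0 *.
rewrite [leLHS](_ : _ = x ^+ 2 / (64 * n%:R) / (64 * P%:R ^+ 2)); last first.
  rewrite -[in RHS]ss; set s : K := Num.sqrt _ in s0 *.
  by field; rewrite !gt_eqF.
set b1 := x / n%:R / 2.
have b10 : 0 < b1 by rewrite /b1 !divr_gt0.
have rx : x / 4 <= ((n - m) %/ 2)%:R.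
  by rewrite ler_pdivrMr // /x -natrM ler_nat; lia.
apply: (@le_trans _ _ (b1 / 2 * 1 * (x / 4 / (4 * P%:R)))).
  rewrite [leRHS](_ : _ = x ^+ 2 / (64 * n%:R) / P%:R); last first.
    by rewrite /b1; field; rewrite !gt_eqF.
  apply: ler_wpM2l; first by rewrite divr_ge0 ?exprn_ge0 ?mulr_ge0 // ltW.
  rewrite lef_pV2 ?posrE ?mulr_gt0 ?exprn_gt0 //.
  have : P%:R * 1 <= P%:R ^+ 2 :> K by rewrite expr2 ler_pM2l.
  by lra.
have b1' := ltW b10; have x' := ltW N0; have PP' := ltW PP.
apply: ler_pM.
- by rewrite mulr1 divr_ge0.
- by rewrite !divr_ge0 ?mulr_ge0.
- by apply: ler_wpM2l; [rewrite divr_ge0|lra].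
- by apply: ler_wpM2r => //; rewrite invr_ge0 mulr_ge0.
Qed.

(** Here x is n - m, e is n^(-1/6) and T is the rate to be proved. The quantity y = x e^4 is at most
    3, and the terms of h are at most of order y e. Since T = y e^(3R-1), it takes 3R - 1 factors of
    h to fall below T: this is why H_R runs up to l = 3R - 2. *)
Lemma regime_small_coefs (R D : nat) (A : nat -> K) (B e x dl : K) :
  (3 <= R)%N -> (3 * R + 3 <= D)%N -> 1 <= B -> 0 < e <= 1 -> 1 <= x ->
  x ^+ 3 * e ^+ 12 <= 16 -> (forall j, 0 <= A j) ->
  (forall j, A j <= x * (2 * (x * e ^+ 6)) ^+ j) ->
  0 <= dl -> 2 * dl <= B -> 2 * (x * dl * e ^+ 3) <= B ->
  let C1 := (3 * (36 * B ^+ D.+1)) ^+ (3 * R) in let T := x * e ^+ (3 * R + 3) in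
  exists E1 : K, [/\ 0 <= E1 <= C1,
    forall i j, (i < D)%N -> (j < D)%N ->
      `|kap_seq A (0 - i) j| * dl ^+ j.+1 <= C1 * e ^+ j.+1,
    forall r, (0 < r <= D)%N -> `|(logp A 0 D)`_r| * dl ^+ r <= E1,
    forall r, (R < r <= D)%N -> `|(logp A 0 D)`_r| * dl ^+ r <= C1 * T &
    E1 ^+ (3 * R - 2).+1 <= C1 * T /\ e ^+ D <= C1 * T].
Proof.
move=> R3 RD B1 /andP[e0 e1] x1 x3 A0 Aj dl0 dlB xdl C1 T.
have B0 : 0 <= B by lra.
have BD : 1 <= B ^+ D.+1 by rewrite exprn_ege1.
have BB : B <= B ^+ D.+1 by rewrite -{1}[B]expr1 ler_weXn2l.
pose C0 := 36 * B ^+ D.+1.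
have C01 : 36 <= C0 by rewrite /C0; lra.
have C0B : 36 * B <= C0 by rewrite /C0; lra.
have BC0 : B ^+ D.+1 <= C0 by rewrite /C0; lra.
have C0C1 : 3 * C0 <= C1.
  by rewrite -[leLHS]expr1 /C1 -/C0; apply: ler_weXn2l; [lra|nlia].
have C0le : C0 <= C1 by lra.
have C13 : 3 * B ^+ D.+1 <= C1 by lra.
have BC1 : B ^+ D.+1 <= C1 by lra.
have C11 : 1 <= C1 by lra.
have C10 : 0 <= C1 by lra.
have C00 : 0 <= C0 by lra.
have C1E : C1 = 3 ^+ (3 * R) * C0 ^+ (3 * R) by rewrite /C1 -/C0 exprMn.
clearbody C1 C0.
have BDge : 0 <= B ^+ D.+1 by lra.
have BDn j : (j <= D.+1)%N -> B ^+ j <= B ^+ D.+1 by move=> h; exact: ler_weXn2l.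
move: (B ^+ D.+1) BD BB C0B BC0 C13 BC1 BDge BDn => BQ BD BB C0B BC0 C13 BC1 BDge BDn.
have ei0 := ltW e0.
have x0 : 0 <= x by lra.
set y := x * e ^+ 4.
have y0 : 0 <= y by rewrite mulr_ge0 ?exprn_ge0.
have y3 : y <= 3.
  rewrite -(@ler_pXn2r _ 3) ?nnegrE //.
  by rewrite /y exprMn -exprM; lra.
have Adl j : (j.+2 <= D.+1)%N -> A j.+2 * dl ^+ j.+2 <= BQ * (y * e ^+ (3 * j + 2)).
  move=> jD; apply: (@le_trans _ _ (x * (2 * (x * e ^+ 6)) ^+ j.+2 * dl ^+ j.+2)).
    by rewrite ler_wpM2r ?exprn_ge0.
  rewrite -mulrA -exprMn [X in X ^+ _](_ : _ = 2 * (x * dl * e ^+ 3) * e ^+ 3); last by ring.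
  rewrite exprMn mulrCA; apply: ler_pM.
  - by rewrite exprn_ge0 // !mulr_ge0 ?exprn_ge0.
  - by rewrite mulr_ge0 ?exprn_ge0.
  - apply: (@le_trans _ _ (B ^+ j.+2)); last exact: BDn.
    by rewrite lerXn2r ?nnegrE // !mulr_ge0 ?exprn_ge0.
  apply: le_of_eq; rewrite /y -exprM -mulrA -exprD; congr (_ * _ ^+ _); nlia.
have A2dl : A 2 * dl <= 36 * B * (y * e).
  apply: (@le_trans _ _ (x * (2 * (x * e ^+ 6)) ^+ 2 * dl)); first by rewrite ler_wpM2r.
  rewrite [leLHS](_ : _ = 2 * y * (y * e) * (2 * (x * dl * e ^+ 3))); last by rewrite /y; ring.
  have ye : 0 <= y * e by rewrite mulr_ge0.
  apply: (@le_trans _ _ (2 * 3 * (y * e) * B)); last first.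
    have : 0 <= B * (y * e) by rewrite mulr_ge0.
    by lra.
  have hy : 2 * y <= 2 * 3 by lra.
  by apply: ler_pM => //; rewrite ?mulr_ge0 ?exprn_ge0 //; apply: ler_wpM2r.
have ee k : e ^+ k.+1 <= e by rewrite exprS ler_piMr // exprn_ile1.
have ye0 : 0 <= y * e by rewrite mulr_ge0.
have ye3 : y * e <= 3 by rewrite -[leRHS]mulr1; apply: ler_pM.
have TE : T = y * e ^+ (3 * R - 1).
  rewrite /T /y -mulrA -exprD; congr (_ * _ ^+ _); nlia.
have key j : (j.+2 <= D.+1)%N -> A j.+2 * dl ^+ j.+2 <= C0 * (y * e).
  move=> jD; apply: le_trans (Adl j jD) _.
  apply: ler_pM => //; first by rewrite mulr_ge0 ?exprn_ge0.
  by rewrite addnS ler_wpM2l.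
exists (C0 * (y * e)); split.
- rewrite mulr_ge0 //=; apply: le_trans C0C1; rewrite mulrC; exact: ler_wpM2r.
- move=> i [|j] _ jD; rewrite sub0n /= ?normrN ger0_norm //.
    rewrite !expr1; apply: le_trans A2dl _.
    apply: (@le_trans _ _ (36 * B * (3 * e))).
      by apply: ler_wpM2l; [lra|apply: ler_wpM2r].
    by rewrite mulrA; apply: ler_wpM2r => //; lra.
  apply: le_trans (Adl j _) _; first by nlia.
  apply: (@le_trans _ _ (BQ * (3 * e ^+ j.+2))).
    apply: ler_wpM2l => //; apply: ler_pM; rewrite ?exprn_ge0 //.
    by apply: ler_wiXn2l => //; nlia.
  have -> : BQ * (3 * e ^+ j.+2) = 3 * BQ * e ^+ j.+2 by ring.
  by apply: ler_wpM2r => //; exact: exprn_ge0.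
- move=> r rD; apply: (@le_trans _ _ ((if (r <= 2)%N then `|A 2 - 0%:R| else A r + 0%:R) * dl ^+ r)).
    by rewrite ler_wpM2r ?exprn_ge0 // coef_logp_bound.
  move: rD => /andP[r0 rD]; rewrite subr0 addr0 ger0_norm //.
  case: r r0 rD => [|[|[|r]]] //= _ rD.
  + by rewrite expr1; apply: le_trans A2dl _; apply: ler_wpM2r.
  + by apply: (key 0%N); nlia.
  + by apply: (key r.+1); nlia.
- move=> r /andP[rR rD].
  apply: (@le_trans _ _ ((if (r <= 2)%N then `|A 2 - 0%:R| else A r + 0%:R) * dl ^+ r)).
    by rewrite ler_wpM2r ?exprn_ge0 // coef_logp_bound // rD andbT; nlia.
  rewrite ifF ?addr0; last by nlia.
  have -> : r = (r - 2).+2 by nlia.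
  apply: le_trans (Adl _ _) _; first by nlia.
  rewrite TE; apply: ler_pM => //; first by rewrite mulr_ge0 ?exprn_ge0.
  by apply: ler_wpM2l => //; apply: ler_wiXn2l => //; nlia.
- rewrite TE; split.
    have -> : ((3 * R - 2).+1 = 3 * R - 1)%N by nlia.
    clear TE Adl A2dl ee ye0 ye3 key; clearbody y; rewrite !exprMn.
    have -> : y ^+ (3 * R - 1) = y ^+ (3 * R - 2) * y by rewrite -exprSr; congr (_ ^+ _); nlia.
    rewrite !mulrA; apply: ler_wpM2r; first exact: exprn_ge0.
    apply: ler_wpM2r => //; rewrite C1E mulrC; apply: ler_pM; rewrite ?exprn_ge0 //.
      apply: (@le_trans _ _ (3 ^+ (3 * R - 2))); first by rewrite lerXn2r ?nnegrE.
      by apply: ler_weXn2l; [lra|nlia].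
    by apply: ler_weXn2l; [lra|nlia].
  rewrite -TE /T -[leLHS]mul1r; apply: ler_pM; rewrite ?exprn_ge0 //.
  rewrite -[leLHS]mul1r; apply: ler_pM; rewrite ?exprn_ge0 //.
  by apply: ler_wiXn2l.
Qed.

Lemma regime_small R : (3 <= R)%N -> exists nR : nat, exists2 C : K, 0 < C &
  forall n m, (0 < m < n)%N -> psum (odds_range m n) (odds n) 2 < 1 :> K -> (nR <= n)%N ->
  forall N, fnorm N (interp (odds_range m n) (odds n) 0 1 -
    expw (pois_mean (odds_range m n) (odds n)) *
    peval_w (expp (3 * R - 2) (logp (psum (odds_range m n) (odds n)) 0 R))) <=
  C * ((n - m)%:R / Num.sqrt n%:R ^+ R.+1).
Proof.
move=> R3.
(* D exceeds the degree of H_R, and [3 * R + 3 <= D] puts e^D below the rate. *)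
have [D [D3 RD D4 D5 D6]] : exists D : nat,
    [/\ (3 <= D)%N, (R <= D)%N, (R * (3 * R - 2) < D)%N, (3 * R - 2 < D)%N & (3 * R + 3 <= D)%N].
  by exists (3 * R * R + 4)%N; split; nia.
have [P P0 DP] : exists2 P : nat, (0 < P)%N & (D.+3 <= P)%N by exists D.+3.
pose B : K := 128 * P%:R.
have P1 : 1 <= P%:R :> K by rewrite ler1n.
have B1 : 1 <= B by rewrite /B; lra.
have C11 : 1 <= (3 * (36 * B ^+ D.+1)) ^+ (3 * R).
  by apply: exprn_ege1; have : 1 <= B ^+ D.+1; [exact: exprn_ege1|lra].
have [C2 C20 core] := core_bound C11 D3 RD D4 D5.
(* With n >= 128 the bound (n - m)^3 <= 16 n^2 implies n <= 2 m; the square ensures that n - m >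
   sqrt n leaves enough factors for P groups. *)
have [nR [nR1 nR2]] : exists nR : nat, (128 <= nR)%N /\ ((16 * P) ^ 2 <= nR)%N.
  by exists (maxn 128 ((16 * P) ^ 2)); rewrite leq_maxl leq_maxr.
exists nR, C2 => // n m /andP[m0 mn] A2lt nn N.
have n128 := leq_trans nR1 nn; have nP := leq_trans nR2 nn.
have n1 : 1 <= n%:R :> K by rewrite ler1n (leq_trans _ n128).
have n00 : 0 < n%:R :> K by rewrite (lt_le_trans ltr01).
have [e /andP[e0 e1] [ne se]] := sixth_root n1.
have en : e != 0 by rewrite gt_eqF.
have n12 : n%:R ^+ 2 = e ^- 12 by rewrite ne -exprVn -exprM exprVn.
set x : K := (n - m)%:R.
have x1 : 1 <= x by rewrite ler1n subn_gt0.
have x0 : 0 <= x by lra.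
have x3 : x ^+ 3 <= 16 * n%:R ^+ 2.
  case: (leqP 2 (n - m)) => N2.
    have := le_trans (psum2_ge mn N2) (ltW A2lt).
    by rewrite ler_pdivrMr ?mul1r // mulr_gt0 // exprn_gt0.
  have -> : x = 1 by rewrite /x; have -> : (n - m = 1)%N by move: mn N2; clear; nlia.
  have : 1 <= n%:R ^+ 2 :> K by rewrite exprn_ege1.
  by rewrite expr1n; lra.
have nm : (n <= 2 * m)%N.
  rewrite leqNgt; apply/negP => nm.
  have : 16 * n%:R ^+ 2 < x ^+ 3.
    rewrite /x -!natrX -natrM ltr_nat.
    have h1 : (n < 2 * (n - m))%N by move: nm mn; clear; nlia.
    move: (n - m)%N h1 => l h1; move: n128 h1; clear => h2 h1.
    have : (n ^ 3 < (2 * l) ^ 3)%N by rewrite ltn_exp2r.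
    rewrite expnMn => h3; have : (128 * n ^ 2 <= n ^ 3)%N by rewrite (expnS n 2) leq_mul2r h2 orbT.
    by move: h3; nlia.
  by rewrite ltNge => /negP; apply.
have Aj j : psum (odds_range m n) (odds n) j <= x * (2 * (x * e ^+ 6)) ^+ j.
  apply: psum_le; first exact: ltnW.
  move=> k hk; apply: le_trans (odds_le_half _ nm hk) _; first by rewrite m0.
  by rewrite ne invrK.
have b0 := @odds_ge0 K n.
have A0 j : 0 <= psum (odds_range m n) (odds n) j :> K by apply: psum_ge0 => k; exact: b0.
(* When n - m <= sqrt n smoothing gains nothing, and the trivial bound 2 for w suffices because x
   e^3 <= 1. *)
pose dl : K := if x <= e ^- 3 then 2 else 64 * P%:R * Num.sqrt n%:R / x.
have [dl0 dlB xdl] : [/\ 0 <= dl, 2 * dl <= B & 2 * (x * dl * e ^+ 3) <= B].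
  rewrite /dl; case: (leP x (e ^- 3)) => h.
    split; [by []|by rewrite /B; lra|].
    have : x * e ^+ 3 <= 1 by rewrite -ler_pdivlMr ?exprn_gt0 // mul1r.
    by rewrite /B; lra.
  have x00 : 0 < x by lra.
  have h1 : e ^- 3 / x <= 1 by rewrite ler_pdivrMr // mul1r ltW.
  split; first by rewrite divr_ge0 ?mulr_ge0 ?sqrtr_ge0 //.
    rewrite se -!mulrA /B.
    have : P%:R * (e ^- 3 / x) <= P%:R * 1 by rewrite ler_wpM2l.
    by lra.
  by rewrite se; apply: le_of_eq; rewrite /B; field; rewrite en gt_eqF.
have smooth N' c' p s : (p <= D.+3)%N -> 0 <= s <= 1 ->
    fnorm N' (fps_w ^+ p * interp (odds_range m n) (odds n) c' s) <= dl ^+ p.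
  move=> pD hs; rewrite /dl; case: (leP x (e ^- 3)) => h; first exact: interp_smooth_trivial.
  apply: half_smooth => //; last exact: leq_trans DP.
  have : (16 * P)%:R < x.
    apply: le_lt_trans h; rewrite -se -(@ler_pXn2r _ 2) ?nnegrE ?sqrtr_ge0 //.
    by rewrite sqr_sqrtr // -natrX ler_nat.
  by rewrite ltr_nat => /ltnW.
have x3' : x ^+ 3 * e ^+ 12 <= 16 by rewrite -ler_pdivlMr ?exprn_gt0 // -n12.
have e01 : 0 < e <= 1 by rewrite e0.
have [E1 [E1C kap hE1 hE2 [hE3 hE4]]] :=
  regime_small_coefs R3 D6 B1 e01 x1 x3' A0 Aj dl0 dlB xdl.
have TE : x / Num.sqrt n%:R ^+ R.+1 = x * e ^+ (3 * R + 3).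
  by rewrite se -exprVn invrK -exprM; congr (_ * _ ^+ _); move: (R); clear; nlia.
have T0 : 0 <= x * e ^+ (3 * R + 3) by rewrite mulr_ge0 ?exprn_ge0 // ltW.
have ep01 : 0 <= e <= 1 by rewrite ltW.
by rewrite TE; apply: (core _ _ _ b0 0%N dl e E1).
Qed.

End Regimes.

(** * The two regimes with a_{n,2} at least of order 1 *)

Section LargeRegimes.
Context {K : realType}.
Implicit Types (n m k : nat).

(** Since c is within 1 of [A 2], the linear and quadratic coefficients of h are at most 1. Only the
    orders from 3 on depend on the regime, and their bounds are left as hypotheses. *)
Lemma regime_large_coefs (R D : nat) (A : nat -> K) (C e E T dl : K) (c : nat) :
  (3 <= R)%N -> (R <= D)%N -> 8 <= C -> 0 < e <= 1 -> 0 <= E <= 2 -> 0 <= T -> 0 <= dl ->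
  (forall j, 0 <= A j) -> 0 <= A 2 - c%:R <= 1 -> dl <= C * e -> dl <= C * E ->
  (forall r, (3 <= r <= D)%N -> (A r + c%:R) * dl ^+ r <= C * E) ->
  (forall r, (R < r <= D)%N -> (A r + c%:R) * dl ^+ r <= C * T) ->
  (forall j, (2 <= j < D)%N -> (A j + A j.+1) * dl ^+ j.+1 <= C * e ^+ j.+1) ->
  E ^+ R.+1 <= 8 * T -> e ^+ D <= T ->
  let C1 := 8 * D.+1%:R * C ^+ (2 * R.+1) in
  [/\ 0 <= C ^+ 2 * E <= C1,
    forall i j, (i < D)%N -> (j < D)%N ->
      `|kap_seq A (c - i) j| * dl ^+ j.+1 <= C1 * e ^+ j.+1,
    forall r, (0 < r <= D)%N -> `|(logp A c D)`_r| * dl ^+ r <= C ^+ 2 * E,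
    forall r, (R < r <= D)%N -> `|(logp A c D)`_r| * dl ^+ r <= C1 * T &
    (C ^+ 2 * E) ^+ R.+1 <= C1 * T /\ e ^+ D <= C1 * T].
Proof.
move=> R3 RD C8 /andP[e0 e1] /andP[E0 E2] T0 dl0 A0 /andP[Ac0 Ac1] dle dlE h3 hR hk hE he C1.
have D1 : 1 <= D.+1%:R :> K by rewrite ler1n.
have C0 : 0 <= C by lra.
have C1' : 1 <= C by lra.
have CC : C <= C ^+ 2 by rewrite expr2 ler_peMr.
have C2 : C ^+ 2 <= C ^+ (2 * R.+1) by apply: ler_weXn2l => //; nlia.
have CR1 : 0 <= C ^+ (2 * R.+1) by rewrite exprn_ge0.
have DC : D.+1%:R * C ^+ (2 * R.+1) <= C1.
  have : 0 <= D.+1%:R * C ^+ (2 * R.+1) by rewrite mulr_ge0.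
  by rewrite /C1 -mulrA; lra.
have C1R : 8 * C ^+ (2 * R.+1) <= C1.
  by rewrite /C1 mulrAC; apply: ler_peMr => //; rewrite mulr_ge0.
have cE : C1 = 8 * D.+1%:R * C ^+ (2 * R.+1) by [].
clearbody C1.
have C1C : C <= C1 by lra.
have C11 : 1 <= C1 by lra.
have coef r : (0 < r <= D)%N -> `|(logp A c D)`_r| * dl ^+ r <=
    (if (r <= 2)%N then A 2 - c%:R else A r + c%:R) * dl ^+ r.
  move=> rD; apply: ler_wpM2r; first exact: exprn_ge0.
  by apply: le_trans (coef_logp_bound _ A0 rD) _; rewrite ger0_norm.
have dlC : dl <= C by apply: le_trans dle _; rewrite ler_piMr.
split.
- rewrite mulr_ge0 ?exprn_ge0 //=; apply: le_trans C1R.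
  have : C ^+ 2 * E <= C ^+ 2 * 2 by rewrite ler_wpM2l ?exprn_ge0.
  lra.
- move=> i j iD jD; apply: (le_trans (kap_bound A0 C1' dl0 (ltW e0) _ dle hk iD jD)).
    by rewrite Ac0.
  apply: ler_wpM2r; first by rewrite exprn_ge0 // ltW.
  by apply: le_trans DC; rewrite ler_wpM2l.
- move=> r rD; apply: le_trans (coef r rD) _; move: rD => /andP[r0 rD].
  have CE : C * E <= C ^+ 2 * E by rewrite ler_wpM2r.
  case: r r0 rD => [|[|[|r]]] //= _ rD.
  + by rewrite expr1; apply: le_trans CE; apply: le_trans dlE; rewrite ler_piMl.
  + apply: (@le_trans _ _ (dl ^+ 2)); first by rewrite ler_piMl ?exprn_ge0.
    by rewrite !expr2 -mulrA; apply: ler_pM.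
  + by apply: le_trans CE; apply: h3.
- move=> r rD; apply: le_trans (coef r _) _; first by nlia.
  rewrite ifF; last by nlia.
  by apply: le_trans (hR r rD) _; rewrite ler_wpM2r.
split; last by apply: le_trans he _; rewrite ler_peMl.
rewrite exprMn -exprM; apply: (@le_trans _ _ (C ^+ (2 * R.+1) * (8 * T))).
  by rewrite ler_wpM2l.
have -> : C ^+ (2 * R.+1) * (8 * T) = 8 * C ^+ (2 * R.+1) * T by ring.
by rewrite ler_wpM2r.
Qed.

(** Here e is n^(-1/6) and the number w is n^(2/3) / (n - m), so that a_{n,2} w^3 is bounded and w e
    = sqrt n / (n - m) is the smoothing size. As E^(R+1) = w^3 T with w <= 2, the exponential may
    stop at l = R. *)
Lemma half_coefs (R D : nat) (A : nat -> K) (B e w : K) (c : nat) :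
  (3 <= R)%N -> (3 * R <= D)%N -> 1 <= B -> 0 < e <= 1 -> 0 < w <= 2 -> 2 * e ^+ 2 <= w ->
  (forall j, 0 <= A j) -> (forall j, (2 <= j)%N -> A j <= A 2) -> 0 <= A 2 - c%:R <= 1 ->
  A 2 * w ^+ 3 <= 4 ->
  let C := 8 * (2 * B) ^+ D in let dl := B * (w * e) in let E := w * e in
  let T := w ^+ (R - 2) * e ^+ R.+1 in
  [/\ 0 <= E <= 2, dl <= C * e, dl <= C * E,
  (forall r, (3 <= r <= D)%N -> (A r + c%:R) * dl ^+ r <= C * E) /\
  (forall r, (R < r <= D)%N -> (A r + c%:R) * dl ^+ r <= C * T) &
  (forall j, (2 <= j < D)%N -> (A j + A j.+1) * dl ^+ j.+1 <= C * e ^+ j.+1) /\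
  (E ^+ R.+1 <= 8 * T /\ e ^+ D <= T)].
Proof.
move=> R3 RD B1 /andP[e0 e1] /andP[w0 w2] ew A0 Aj /andP[Ac0 Ac1] Aw C dl E T.
have B0 : 0 <= B by lra.
have ei := ltW e0; have wi := ltW w0.
have B2 : 1 <= 2 * B by lra.
have BD : 2 * B <= (2 * B) ^+ D by rewrite -{1}[2 * B]expr1; apply: ler_weXn2l => //; nlia.
have we0 : 0 <= w * e by rewrite mulr_ge0.
have we2 : w * e <= 2 by rewrite -[leRHS]mulr1; apply: ler_pM.
have key r : (3 <= r)%N -> 2 * A 2 * dl ^+ r <= 8 * B ^+ r * ((w * e) ^+ (r - 3) * e ^+ 3).
  move=> r3; have -> : dl ^+ r = w ^+ 3 * (B ^+ r * ((w * e) ^+ (r - 3) * e ^+ 3)).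
    rewrite /dl exprMn (_ : (w * e) ^+ r = (w * e) ^+ (r - 3) * (w * e) ^+ 3).
      by ring.
    by rewrite -exprD subnK.
  rewrite [leLHS](_ : _ = (A 2 * w ^+ 3) * (2 * (B ^+ r * ((w * e) ^+ (r - 3) * e ^+ 3)))); last by ring.
  rewrite [leRHS](_ : _ = 4 * (2 * (B ^+ r * ((w * e) ^+ (r - 3) * e ^+ 3)))); last by ring.
  by apply: ler_wpM2r => //; rewrite !mulr_ge0 ?exprn_ge0.
have twoB r k : (r + k <= D + r)%N -> (r <= D)%N -> (k <= r)%N -> B ^+ r * 2 ^+ k <= (2 * B) ^+ D.
  move=> _ rD kr; apply: (@le_trans _ _ ((2 * B) ^+ r)); last by apply: ler_weXn2l.
  rewrite exprMn mulrC; apply: ler_wpM2r; first exact: exprn_ge0.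
  by apply: ler_weXn2l => //; lra.
have twow k : (w * e) ^+ k <= 2 ^+ k by rewrite lerXn2r ?nnegrE.
have sum2 r : (3 <= r)%N -> (A r + c%:R) * dl ^+ r <= 2 * A 2 * dl ^+ r.
  move=> r3; apply: ler_wpM2r; first by rewrite exprn_ge0 // mulr_ge0.
  by have := Aj r (ltnW r3); lra.
split.
- by rewrite we0.
- rewrite /dl mulrA; apply: ler_wpM2r => //; rewrite mulrC.
  apply: (@le_trans _ _ (2 * B)); first by rewrite ler_wpM2r.
  by rewrite /C; lra.
- by rewrite /dl /E; apply: ler_wpM2r => //; rewrite /C; lra.
- split=> r /andP[r3 rD].
    apply: le_trans (sum2 r r3) _; apply: le_trans (key r r3) _.
    rewrite /C /E -!mulrA; apply: ler_wpM2l => //.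
    have e3 : e ^+ 3 <= w * e.
      rewrite exprSr; apply: ler_wpM2r => //; have := sqr_ge0 e; lra.
    apply: (@le_trans _ _ (B ^+ r * 2 ^+ (r - 3) * (w * e))).
      rewrite -mulrA; apply: ler_wpM2l; first exact: exprn_ge0.
      by apply: ler_pM; rewrite ?exprn_ge0.
    by apply: ler_wpM2r => //; apply: twoB => //; nlia.
  have r3' : (3 <= r)%N by nlia.
  apply: le_trans (sum2 r r3') _; apply: le_trans (key r r3') _.
  rewrite /C -!mulrA; apply: ler_wpM2l => //.
  have -> : (w * e) ^+ (r - 3) * e ^+ 3 = (w * e) ^+ (r - R.+1) * T.
    have -> : (r - 3 = (r - R.+1) + (R - 2))%N by nlia.
    rewrite exprD -mulrA (exprMn (R - 2)) /T -mulrA -exprD; congr (_ * (_ * _ ^+ _)); nlia.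
  rewrite mulrA; apply: ler_wpM2r; first by rewrite mulr_ge0 ?exprn_ge0.
  apply: (@le_trans _ _ (B ^+ r * 2 ^+ (r - R.+1))).
    by apply: ler_wpM2l => //; exact: exprn_ge0.
  by apply: twoB => //; nlia.
split; last split.
- move=> j /andP[j2 jD]; apply: (@le_trans _ _ (2 * A 2 * dl ^+ j.+1)).
    apply: ler_wpM2r; first by rewrite exprn_ge0 // mulr_ge0.
    by have := Aj j j2; have := Aj j.+1 (ltnW j2); lra.
  apply: le_trans (key _ _) _ => //; rewrite /C -!mulrA; apply: ler_wpM2l => //.
  have -> : e ^+ j.+1 = e ^+ (j.+1 - 3) * e ^+ 3 by rewrite -exprD; congr (_ ^+ _); nlia.
  have hk : B ^+ j.+1 * 2 ^+ (j.+1 - 3) <= (2 * B) ^+ D by apply: twoB => //; nlia.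
  move: (j.+1 - 3)%N hk => k hk.
  have -> : B ^+ j.+1 * ((w * e) ^+ k * e ^+ 3) = B ^+ j.+1 * w ^+ k * (e ^+ k * e ^+ 3).
    by rewrite exprMn; ring.
  apply: ler_wpM2r; first by rewrite mulr_ge0 ?exprn_ge0.
  apply: le_trans hk; apply: ler_wpM2l; first exact: exprn_ge0.
  by rewrite lerXn2r ?nnegrE.
- rewrite /E exprMn /T mulrA; apply: ler_wpM2r; first exact: exprn_ge0.
  have -> : w ^+ R.+1 = w ^+ 3 * w ^+ (R - 2) by rewrite -exprD; congr (_ ^+ _); nlia.
  apply: ler_wpM2r; first exact: exprn_ge0.
  have -> : 8 = 2 ^+ 3 :> K by ring.
  by rewrite lerXn2r ?nnegrE.
rewrite /T; apply: (@le_trans _ _ (e ^+ (2 * (R - 2)) * e ^+ R.+1)).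
  by rewrite -exprD; apply: ler_wiXn2l => //; nlia.
apply: ler_wpM2r; first exact: exprn_ge0.
rewrite exprM lerXn2r ?nnegrE ?exprn_ge0 //.
by have := sqr_ge0 e; lra.
Qed.

(** Here e is m^(-1/6) and dl is of order sqrt m / n. From a_j <= n^j / m^(j-1) it follows that a_j
    dl^j is of order m^(1-j/2) = e^(3(j-2)). The rate T is m^(-(R-1)/2). *)
Lemma tail_coefs (R D : nat) (A : nat -> K) (B e dl : K) (c : nat) :
  (3 <= R)%N -> (3 * R <= D)%N -> 1 <= B -> 0 < e <= 1 -> 0 <= dl -> dl <= B * e ^+ 3 ->
  (forall j, 0 <= A j) -> 0 <= A 2 - c%:R <= 1 ->
  (forall j, A j.+2 * dl ^+ j.+2 <= B ^+ j.+2 * e ^+ (3 * j)) ->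
  let C := 8 * B ^+ D in let E := e ^+ 3 in let T := e ^+ (3 * R - 3) in
  [/\ 0 <= E <= 2, dl <= C * e, dl <= C * E,
  (forall r, (3 <= r <= D)%N -> (A r + c%:R) * dl ^+ r <= C * E) /\
  (forall r, (R < r <= D)%N -> (A r + c%:R) * dl ^+ r <= C * T) &
  (forall j, (2 <= j < D)%N -> (A j + A j.+1) * dl ^+ j.+1 <= C * e ^+ j.+1) /\
  (E ^+ R.+1 <= 8 * T /\ e ^+ D <= T)].
Proof.
move=> R3 RD B1 /andP[e0 e1] dl0 dle A0 /andP[Ac0 Ac1] Aj C E T.
have B0 : 0 <= B by lra.
have ei := ltW e0.
have BD r : (r <= D)%N -> B ^+ r <= B ^+ D by move=> h; exact: ler_weXn2l.
have B1D : B <= B ^+ D by rewrite -{1}[B]expr1; apply: BD; nlia.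
have BD0 : 0 <= B ^+ D by rewrite exprn_ge0.
have em k l : (k <= l)%N -> e ^+ l <= e ^+ k by move=> h; exact: ler_wiXn2l.
have A2 : A 2 * dl ^+ 2 <= B ^+ 2 by have := Aj 0%N; rewrite muln0 expr0 mulr1.
have key r : (3 <= r)%N -> (A r + c%:R) * dl ^+ r <= 2 * (B ^+ r * e ^+ (3 * (r - 2))).
  move=> r3; have er : (r = (r - 2).+2)%N by nlia.
  rewrite mulrDl (_ : 2 * _ = B ^+ r * e ^+ (3 * (r - 2)) + B ^+ r * e ^+ (3 * (r - 2))); last by ring.
  apply: lerD; first by rewrite {1 2 3}er.
  apply: (@le_trans _ _ (A 2 * dl ^+ r)).
    by apply: ler_wpM2r; [exact: exprn_ge0|lra].
  have -> : dl ^+ r = dl ^+ 2 * dl ^+ (r - 2) by rewrite -exprD; congr (_ ^+ _); nlia.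
  have -> : B ^+ r * e ^+ (3 * (r - 2)) = B ^+ 2 * (B * e ^+ 3) ^+ (r - 2).
    rewrite exprMn -exprM mulrA -exprD; congr (_ ^+ _ * _); nlia.
  rewrite mulrA; apply: ler_pM; rewrite ?mulr_ge0 ?exprn_ge0 //.
  by rewrite lerXn2r ?nnegrE ?mulr_ge0 ?exprn_ge0.
have fin r k (x : K) : (r <= D)%N -> x <= 2 * (B ^+ r * e ^+ (3 * (r - 2))) ->
    (k <= 3 * (r - 2))%N -> x <= C * e ^+ k.
  move=> rD hx hk; apply: le_trans hx _; apply: (@le_trans _ _ (2 * (B ^+ D * e ^+ k))).
    by apply: ler_wpM2l => //; apply: ler_pM; rewrite ?exprn_ge0 ?BD ?em.
  rewrite mulrA; apply: ler_wpM2r; first exact: exprn_ge0.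
  by rewrite /C; lra.
have dlE : dl <= C * E.
  apply: le_trans dle _; apply: ler_wpM2r; first exact: exprn_ge0.
  by rewrite /C; lra.
split => //.
- by rewrite exprn_ge0 //=; have : e ^+ 3 <= 1; [rewrite exprn_ile1|rewrite /E; lra].
- apply: le_trans dlE _; apply: ler_wpM2l; first by rewrite /C; lra.
  by rewrite -[leRHS]expr1; exact: em.
- split=> r /andP[r3 rD].
    by apply: (fin r) => //; [exact: key|nlia].
  by apply: (fin r) => //; [apply: key; nlia|nlia].
split; last split.
- move=> j /andP[j2 jD]; apply: (fin j.+1) => //; last by nlia.
  rewrite mulrDl (_ : 2 * _ = B ^+ j.+1 * e ^+ (3 * (j.+1 - 2)) + B ^+ j.+1 * e ^+ (3 * (j.+1 - 2))); last by ring.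
  have ej : (j = (j - 2).+2)%N by nlia.
  apply: lerD; last first.
    have -> : (j.+1 = (j.+1 - 2).+2)%N by nlia.
    have -> : ((j.+1 - 2).+2 - 2 = j.+1 - 2)%N by nlia.
    exact: Aj.
  rewrite exprSr mulrA; apply: (@le_trans _ _ (B ^+ j * e ^+ (3 * (j - 2)) * (B * e ^+ 3))).
    apply: ler_pM => //; first by rewrite mulr_ge0 ?exprn_ge0.
    by rewrite {1 2 3}ej.
  apply: le_of_eq; rewrite [B ^+ j.+1]exprSr.
  have -> : (3 * (j.+1 - 2) = 3 * (j - 2) + 3)%N by nlia.
  by rewrite exprD; move: (e ^+ (3 * (j - 2))) => z; ring.
- rewrite /E -exprM /T; apply: (@le_trans _ _ (e ^+ (3 * R - 3))); first by apply: em; nlia.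
  by apply: ler_peMl; [exact: exprn_ge0|lra].
by rewrite /T; apply: em; nlia.
Qed.

Lemma pow_quot (e w : K) k : e != 0 -> w != 0 ->
  (e ^- 3) ^+ k / (e ^- 4 * w^-1) ^+ k.+1 = w ^+ k.+1 * e ^+ k.+4.
Proof.
move=> e0 w0; have step (a b : K) i : a ^+ i.+1 / b ^+ i.+2 = (a / b) * (a ^+ i / b ^+ i.+1).
  by rewrite (exprS a) (exprS b i.+1) invfM mulrACA.
elim: k => [|k IH]; first by rewrite expr0 !expr1; field; rewrite e0 w0.
rewrite step IH (exprS w k.+1) (exprS e k.+4).
by have -> : e ^- 3 / (e ^- 4 / w) = w * e; [field; rewrite e0 w0|rewrite mulrACA].
Qed.

Lemma regime_half R : (3 <= R)%N -> exists nR : nat, exists2 C : K, 0 < C &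
  forall n m c, (0 < m < n)%N -> (n <= 2 * m)%N ->
  0 <= (psum (odds_range m n) (odds n) 2 : K) - c%:R <= 1 ->
  1 <= psum (odds_range m n) (odds n) 2 :> K -> (nR <= n)%N ->
  forall N, fnorm N (interp (odds_range m n) (odds n) c 1 -
    expw (pois_mean (odds_range m n) (odds n)) *
    peval_w (expp R (logp (psum (odds_range m n) (odds n)) c R))) <=
  C * (Num.sqrt n%:R ^+ (R - 3) / (n - m)%:R ^+ (R - 2)).
Proof.
move=> R3.
have [D [D3 RD D4 D5 D6]] : exists D : nat,
    [/\ (3 <= D)%N, (R <= D)%N, (R * R < D)%N, (R < D)%N & (3 * R <= D)%N].
  by exists (3 * R * R + 4)%N; split; nia.
have [P P0 DP] : exists2 P : nat, (0 < P)%N & (D.+3 <= P)%N by exists D.+3.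
pose B : K := 64 * P%:R.
have P1 : 1 <= P%:R :> K by rewrite ler1n.
have B1 : 1 <= B by rewrite /B; lra.
pose C := 8 * (2 * B) ^+ D.
have C8 : 8 <= C.
  by rewrite /C; have : 1 <= (2 * B) ^+ D; [apply: exprn_ege1; lra|lra].
have C11 : 1 <= 8 * D.+1%:R * C ^+ (2 * R.+1).
  have h1 : 1 <= C ^+ (2 * R.+1) by apply: exprn_ege1; lra.
  have h2 : 1 <= D.+1%:R :> K by rewrite ler1n.
  by rewrite -[leLHS]mulr1; apply: ler_pM => //; lra.
have [C2 C20 core] := core_bound C11 D3 RD D4 D5.
(* This threshold gives n - m >= sqrt n / 2 >= 16 P, as [half_smooth] requires. *)
exists ((32 * P) ^ 2)%N, C2 => // n m c /andP[m0 mn] nm Ac A2 nP N.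
have n1 : 1 <= n%:R :> K by rewrite ler1n (leq_ltn_trans _ mn).
have [e /andP[e0 e1] [ne se]] := sixth_root n1.
have en : e != 0 by rewrite gt_eqF.
have ei := ltW e0.
set x : K := (n - m)%:R.
have x1 : 1 <= x by rewrite ler1n subn_gt0.
have x0 : 0 < x by lra.
have Aj j : psum (odds_range m n) (odds n) j <= x * (2 * (x * e ^+ 6)) ^+ j.
  apply: psum_le; first exact: ltnW.
  move=> k hk; apply: le_trans (odds_le_half _ nm hk) _; first by rewrite m0.
  by rewrite ne invrK.
have b0 := @odds_ge0 K n.
have A0 j : 0 <= psum (odds_range m n) (odds n) j :> K by apply: psum_ge0 => k; exact: b0.
have xe : 2 * (x * e ^+ 6) <= 1.
  rewrite mulrA -ler_pdivlMr ?exprn_gt0 // mul1r -ne /x -natrM ler_nat.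
  by move: mn nm; clear; lia.
have Ad j : (2 <= j)%N ->
    psum (odds_range m n) (odds n) j <= psum (odds_range m n) (odds n) 2 :> K.
  move=> j2; rewrite /psum /odds_range big_nat_cond [leRHS]big_nat_cond; apply: ler_sum => k.
  rewrite andbT ltnS => hk; apply: ler_wiXn2l => //; apply: le_trans (odds_le_half _ nm hk) _.
    by rewrite m0.
  by rewrite ne invrK.
set A := psum (odds_range m n) (odds n) in A0 Aj Ad Ac A2 *.
set y := x * e ^+ 4.
have y0 : 0 < y by rewrite mulr_gt0 ?exprn_gt0.
have A4 : A 2 <= 4 * y ^+ 3.
  by apply: le_trans (Aj 2) _; apply: le_of_eq; rewrite /y; ring.
(* The lower bound on a_{n,2} enters here: it keeps n - m at least of order n^(2/3). *)
have y2 : 1 / 2 <= y.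
  rewrite leNgt; apply/negP => lt.
  have : y ^+ 3 < (1 / 2) ^+ 3 by rewrite ltrXn2r ?nnegrE // ?ltW.
  by have -> : (1 / 2) ^+ 3 = 1 / 8 :> K by [field|]; lra.
pose w := y^-1.
have w0 : 0 < w by rewrite invr_gt0.
have w2 : w <= 2 by rewrite /w -div1r ler_pdivrMr //; lra.
have ew : 2 * e ^+ 2 <= w.
  by rewrite /w -[leRHS]div1r ler_pdivlMr // /y -mulrA [e ^+ 2 * _]mulrCA -exprD.
have Aw : A 2 * w ^+ 3 <= 4.
  by rewrite /w exprVn ler_pdivrMr ?exprn_gt0.
have e01 : 0 < e <= 1 by rewrite e0.
have w02 : 0 < w <= 2 by rewrite w0.
have [h1 h2 h3 [h4 h5] [h6 [h7 h8]]] := half_coefs R3 D6 B1 e01 w02 ew A0 Ad Ac Aw.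
set dl := B * (w * e) in h2 h3 h4 h5 h6.
have dl0 : 0 <= dl by rewrite !mulr_ge0 ?(le_trans ler01 B1) // ltW.
have T0 : 0 <= w ^+ (R - 2) * e ^+ R.+1 by rewrite mulr_ge0 ?exprn_ge0 // ltW.
have [g1 g2 g3 g4 [g5 g6]] := regime_large_coefs R3 RD C8 e01 h1 T0 dl0 A0 Ac h2 h3 h4 h5 h6 h7 h8.
have xE : x = e ^- 4 * w^-1 by rewrite /w /y invrK; field.
have dlE : dl = 64 * P%:R * Num.sqrt n%:R / x.
  by rewrite se xE /dl /B; field; rewrite en gt_eqF.
have smooth N' c' p s : (p <= D.+3)%N -> 0 <= s <= 1 ->
    fnorm N' (fps_w ^+ p * interp (odds_range m n) (odds n) c' s) <= dl ^+ p.
  move=> pD hs; rewrite dlE; apply: half_smooth => //; last exact: leq_trans DP.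
  have : (16 * P)%:R <= x.
    apply: (@le_trans _ _ (Num.sqrt n%:R / 2)).
      rewrite ler_pdivlMr // -natrM -(@ler_pXn2r _ 2) ?nnegrE ?sqrtr_ge0 //.
      by rewrite sqr_sqrtr // -natrX ler_nat; apply: leq_trans nP; rewrite leq_exp2r //; clear; lia.
    rewrite se ler_pdivrMr // xE.
    have : e ^- 3 <= e ^- 4 by rewrite lef_pV2 ?posrE ?exprn_gt0 // ler_wiXn2l.
    have : e ^- 4 * 1 <= e ^- 4 * (w^-1 * 2).
      apply: ler_wpM2l; first by rewrite invr_ge0 exprn_ge0.
      by rewrite /w invrK; move: y2; clear; lra.
    by move: (e ^- 3) (e ^- 4) (w^-1) => u v z; clear; lra.
  by rewrite ler_nat.
have ep01 : 0 <= e <= 1 by rewrite ei.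
have TE : Num.sqrt n%:R ^+ (R - 3) / x ^+ (R - 2) = w ^+ (R - 2) * e ^+ R.+1.
  have e1' : (R - 2 = (R - 3).+1)%N by move: R3; clear; lia.
  have e2' : (R.+1 = (R - 3).+4)%N by move: R3; clear; lia.
  by rewrite se xE e1' e2' pow_quot // gt_eqF.
rewrite TE; apply: (core _ _ _ b0 c dl e _ _ dl0 ep01 T0 g1) => //.
Qed.

Lemma odds_ge_sixth n m k : (0 < m)%N -> (2 * m <= n)%N -> (m < k <= m + m %/ 2)%N ->
  n%:R / (6 * m%:R) <= odds n k :> K.
Proof.
move=> m0 mn /andP[mk km]; rewrite /odds.
have k0 : 0 < k%:R :> K by rewrite ltr0n; lia.
have m00 : 0 < m%:R :> K by rewrite ltr0n.
rewrite ler_pdivrMr ?mulr_gt0 // mulrAC ler_pdivlMr // -!natrM ler_nat.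
have : (2 * k <= 3 * m)%N by lia.
have : (k <= n)%N by lia.
move: mn; clear; nia.
Qed.

Lemma inv_sq_sum m n : (0 < m <= n)%N ->
  \sum_(m.+1 <= k < n.+1) (k%:R ^- 2 : K) <= m%:R^-1 - n%:R^-1.
Proof.
move=> /andP[m0 mn]; rewrite -(subnKC mn); elim: (n - m)%N => [|j IH].
  by rewrite addn0 big_geq // subrr.
rewrite addnS big_nat_recr /=; last by rewrite ltnS leq_addr.
apply: le_trans (lerD IH (lexx _)) _.
set k := (m + j)%N; have k0 : 0 < k%:R :> K by rewrite ltr0n addn_gt0 m0.
have k1 : 0 < k%:R + 1 :> K by rewrite addr_gt0.
rewrite -(natr1 k) -addrA lerD2l -subr_ge0.
have -> : - (k%:R + 1)^-1 - (- k%:R^-1 + (k%:R + 1) ^- 2) =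
    (k%:R * (k%:R + 1) ^+ 2)^-1 :> K.
  by field; rewrite !gt_eqF.
by rewrite invr_ge0 mulr_ge0 ?exprn_ge0 // ltW.
Qed.

(** Two of the factors 1/k are summed by [inv_sq_sum]; each of the others is at most 1/m. *)
Lemma psum_tail_le n m j : (0 < m <= n)%N ->
  psum (odds_range m n) (odds n) j.+2 <= n%:R ^+ j.+2 / m%:R ^+ j.+1 :> K.
Proof.
move=> /andP[m0 mn]; have m00 : 0 < m%:R :> K by rewrite ltr0n.
have h0 := @inv_sq_sum m n; rewrite m0 mn in h0; have {}h0 := h0 isT.
have h1 : \sum_(m.+1 <= k < n.+1) (k%:R ^- 2 : K) <= m%:R^-1.
  by apply: le_trans h0 _; rewrite lerBlDr lerDl invr_ge0.
rewrite (_ : _ / _ = n%:R ^+ j.+2 / m%:R ^+ j * m%:R^-1); last first.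
  by rewrite [m%:R ^+ j.+1]exprSr invfM mulrA.
apply: le_trans (ler_wpM2l _ h1); last by rewrite divr_ge0 ?exprn_ge0.
rewrite mulr_sumr /psum /odds_range big_nat_cond [leRHS]big_nat_cond; apply: ler_sum => k.
rewrite andbT => /andP[mk kn]; have k0 : 0 < k%:R :> K by rewrite ltr0n (leq_trans _ mk).
rewrite /odds exprMn -[X in _ <= X]mulrA; apply: ler_pM; rewrite ?exprn_ge0 ?invr_ge0 //.
  by rewrite lerXn2r ?nnegrE // ler_nat leq_subr.
rewrite -[j.+2]addn2 exprD exprVn exprVn; apply: ler_wpM2r; first by rewrite invr_ge0 exprn_ge0.
by rewrite lef_pV2 ?posrE ?exprn_gt0 // lerXn2r ?nnegrE // ler_nat ltnW.
Qed.

(** About m / 2 factors have ratio at least n / (6 m). Their variance is of order m (n / m)^2 = n^2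
    / m, which gives dl of order sqrt m / n. *)
Lemma tail_smooth n m P : (0 < P)%N -> (0 < m)%N -> (2 * m <= n)%N -> (16 * P <= m)%N ->
  forall N c' p s, (p <= P)%N -> 0 <= s <= 1 ->
  fnorm N (fps_w ^+ p * interp (odds_range m n) (odds n) c' s) <=
  (48 ^+ 2 * P%:R * Num.sqrt m%:R / n%:R : K) ^+ p.
Proof.
move=> P0 m0 mn Pm.
have [Q QE] : exists Q : K, Q = 48 ^+ 2 by exists (48 ^+ 2).
have Q1 : 1 <= Q by rewrite QE exprn_ege1 // ler1n.
have Q0 := lt_le_trans ltr01 Q1.
rewrite -QE.
have P1 : 1 <= P%:R :> K by rewrite ler1n.
have PP : 0 < P%:R :> K by lra.
have m00 : 0 < m%:R :> K by rewrite ltr0n.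
have n00 : 0 < n%:R :> K by rewrite ltr0n; lia.
have s0 : 0 < Num.sqrt m%:R :> K by rewrite sqrtr_gt0.
have ss : Num.sqrt m%:R ^+ 2 = m%:R :> K by rewrite sqr_sqrtr // ltW.
have d0 : 0 < Q * P%:R * Num.sqrt m%:R / n%:R :> K.
  by rewrite divr_gt0 // mulr_gt0 // mulr_gt0.
have c0 : 0 < n%:R / (6 * m%:R) :> K by rewrite divr_gt0 // mulr_gt0.
have h1 : (m + m %/ 2 <= n)%N by move: mn; clear; lia.
have h2 : (16 * P <= (m %/ 2).+1 * 2)%N by move: Pm; clear; lia.
have h3 k : (m < k <= m + m %/ 2)%N -> n%:R / (6 * m%:R) <= odds n k :> K.
  exact: odds_ge_sixth.
apply: (odds_smooth P0 h1 h2 c0 h3 d0).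
have rx : m%:R / 4 <= (m %/ 2)%:R :> K.
  by rewrite ler_pdivrMr // -natrM ler_nat; move: Pm P0; clear; lia.
set x : K := n%:R in n00 *.
rewrite [leLHS](_ : _ = x ^+ 2 / (Q * m%:R) / (Q * P%:R ^+ 2)); last first.
  rewrite -[in RHS]ss; set s : K := Num.sqrt _ in s0 *.
  by field; rewrite !gt_eqF.
set b1 := x / (6 * m%:R).
have b10 : 0 < b1 by rewrite /b1 divr_gt0 // mulr_gt0.
have b1' := ltW b10; have x' := ltW n00; have PP' := ltW PP; have m0' := ltW m00.
apply: (@le_trans _ _ (b1 / 2 * (b1 / 2) * (m%:R / 4 / (4 * P%:R)))).
  rewrite [leRHS](_ : _ = x ^+ 2 / (Q * m%:R) / P%:R); last first.
    by rewrite QE /b1; field; rewrite !gt_eqF.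
  apply: ler_wpM2l.
    by apply: divr_ge0; [exact: exprn_ge0|apply: mulr_ge0 => //; exact: ltW].
  rewrite lef_pV2 ?posrE ?mulr_gt0 ?exprn_gt0 //.
  have h4 : P%:R * 1 <= P%:R ^+ 2 :> K by rewrite expr2 ler_pM2l.
  apply: (@le_trans _ _ (P%:R ^+ 2)); first by rewrite mulr1 in h4.
  by rewrite ler_peMl // exprn_ge0.
apply: ler_pM.
- by rewrite mulr_ge0 ?divr_ge0.
- by rewrite !divr_ge0 ?mulr_ge0.
- by apply: ler_wpM2l; [rewrite divr_ge0|lra].
- by apply: ler_wpM2r => //; rewrite invr_ge0 mulr_ge0.
Qed.

Lemma regime_tail R : (3 <= R)%N -> exists mR : nat, exists2 C : K, 0 < C &
  forall n m c, (0 < m)%N -> (2 * m <= n)%N -> (mR <= m)%N ->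
  0 <= (psum (odds_range m n) (odds n) 2 : K) - c%:R <= 1 ->
  forall N, fnorm N (interp (odds_range m n) (odds n) c 1 -
    expw (pois_mean (odds_range m n) (odds n)) *
    peval_w (expp R (logp (psum (odds_range m n) (odds n)) c R))) <=
  C * (Num.sqrt (pois_mean (odds_range m n) (odds n)) *
       ln (Num.sqrt (pois_mean (odds_range m n) (odds n)))) * (1 / Num.sqrt m%:R) ^+ R.
Proof.
move=> R3.
have [D [D3 RD D4 D5 D6]] : exists D : nat,
    [/\ (3 <= D)%N, (R <= D)%N, (R * R < D)%N, (R < D)%N & (3 * R <= D)%N].
  by exists (3 * R * R + 4)%N; split; nia.
have [P P0 DP] : exists2 P : nat, (0 < P)%N & (D.+3 <= P)%N by exists D.+3.
pose B : K := 48 ^+ 2 * P%:R.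
have P1 : 1 <= P%:R :> K by rewrite ler1n.
have B1 : 1 <= B.
  by rewrite /B -[leLHS]mulr1; apply: ler_pM => //; rewrite exprn_ege1 // ler1n.
have B0 : 0 <= B by lra.
pose C := 8 * B ^+ D.
have C8 : 8 <= C by rewrite /C; have : 1 <= B ^+ D; [exact: exprn_ege1|lra].
have C11 : 1 <= 8 * D.+1%:R * C ^+ (2 * R.+1).
  have h1 : 1 <= C ^+ (2 * R.+1) by apply: exprn_ege1; lra.
  have h2 : 1 <= D.+1%:R :> K by rewrite ler1n.
  by rewrite -[leLHS]mulr1; apply: ler_pM => //; lra.
have [C2 C20 core] := core_bound C11 D3 RD D4 D5.
(* Since sigma_n^2 >= m / 36, this threshold gives sigma_n >= e and hence log sigma_n >= 1. *)
pose Z : K := 36 * expR 1 ^+ 2.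
have [mR [mR1 mR2]] : exists mR : nat, (16 * P <= mR)%N /\ Z <= mR%:R.
  exists (maxn (16 * P) (Num.truncn Z).+1); rewrite leq_maxl; split => //.
  by apply: le_trans (ltW (truncnS_gt Z)) _; rewrite ler_nat leq_maxr.
exists mR, (6 * C2); first by rewrite mulr_gt0.
move=> n m c m0 mn mRm Ac N.
have Pm := leq_trans mR1 mRm.
have Zm : Z <= m%:R by apply: le_trans mR2 _; rewrite ler_nat.
have m1 : 1 <= m%:R :> K by rewrite ler1n.
have m00 : 0 < m%:R :> K by lra.
have mn' : (m <= n)%N by move: mn; clear; lia.
have [e /andP[e0 e1] [me se]] := sixth_root m1.
have en : e != 0 by rewrite gt_eqF.
have ei := ltW e0.
have b0 := @odds_ge0 K n.
have A0 j : 0 <= psum (odds_range m n) (odds n) j :> K by apply: psum_ge0 => k; exact: b0.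
have n00 : 0 < n%:R :> K by rewrite ltr0n (leq_trans m0).
pose dl := B * Num.sqrt m%:R / n%:R.
have dl0 : 0 <= dl.
  apply: divr_ge0; last exact: ltW.
  by apply: mulr_ge0 => //; exact: sqrtr_ge0.
have dle : dl <= B * e ^+ 3.
  rewrite /dl -mulrA; apply: ler_wpM2l => //; rewrite ler_pdivrMr // se.
  rewrite -ler_pdivrMl ?exprn_gt0 // -invfM -exprD -me ler_nat.
  exact: mn'.
have Aj j : psum (odds_range m n) (odds n) j.+2 * dl ^+ j.+2 <= B ^+ j.+2 * e ^+ (3 * j).
  have h0 : (0 < m <= n)%N by rewrite m0.
  apply: le_trans (ler_wpM2r _ (psum_tail_le j h0)) _; first exact: exprn_ge0.
  apply: le_of_eq; rewrite /dl !exprMn se me -!exprVn invrK -!exprM.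
  have -> : (6 * j.+1 = 3 * j + 3 * j.+2)%N by clear; lia.
  rewrite exprD; move: (e ^+ (3 * j)) => z.
  rewrite [e^-1 ^+ _]exprVn exprVn.
  by field; rewrite !expf_neq0 //= gt_eqF.
have smooth N' c' p s : (p <= D.+3)%N -> 0 <= s <= 1 ->
    fnorm N' (fps_w ^+ p * interp (odds_range m n) (odds n) c' s) <= dl ^+ p.
  by move=> pD hs; apply: tail_smooth => //; exact: leq_trans DP.
have e01 : 0 < e <= 1 by rewrite e0.
have pm0 : m%:R / 36 <= pois_mean (odds_range m n) (odds n) :> K.
  have mr : (m + m %/ 2 <= n)%N by move: mn; clear; lia.
  have q0 : 0 <= n%:R / (6 * m%:R) :> K by rewrite divr_ge0 ?mulr_ge0.
  apply: (@le_trans _ _ (psum (odds_range m n) (odds n) 2)); last by rewrite lerDr.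
  apply: le_trans (psum_ge 2 mr q0 _); last by move=> k; exact: odds_ge_sixth.
  apply: (@le_trans _ _ (m%:R / 4 * (1 / 3) ^+ 2)).
    by apply: le_of_eq; field.
  apply: ler_pM; rewrite ?exprn_ge0 ?divr_ge0 //.
    by rewrite ler_pdivrMr // -natrM ler_nat; move: Pm P0; clear; lia.
  rewrite lerXn2r ?nnegrE ?divr_ge0 // ler_pdivlMr ?mulr_gt0 //.
  rewrite (_ : 1 / 3 * (6 * m%:R) = (2 * m)%:R); last by rewrite natrM; field.
  by rewrite ler_nat.
set A := psum (odds_range m n) (odds n) in A0 Aj Ac *.
have [h1 h2 h3 [h4 h5] [h6 [h7 h8]]] := tail_coefs R3 D6 B1 e01 dl0 dle A0 Ac Aj.
have T0 : 0 <= e ^+ (3 * R - 3) by rewrite exprn_ge0.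
have [g1 g2 g3 g4 [g5 g6]] := regime_large_coefs R3 RD C8 e01 h1 T0 dl0 A0 Ac h2 h3 h4 h5 h6 h7 h8.
have ep01 : 0 <= e <= 1 by rewrite ei.
(* The rate reached is m^(-(R-1)/2) = sqrt m times m^(-R/2); the stated form follows from sqrt m <=
   6 sigma_n and 1 <= log sigma_n. *)
apply: (@le_trans _ _ (C2 * e ^+ (3 * R - 3))).
  by apply: (core _ _ _ b0 c dl e _ _ dl0 ep01 T0 g1).
set pm := pois_mean _ _ in pm0 *.
have smE : Num.sqrt m%:R <= 6 * Num.sqrt pm.
  rewrite -(@ler_pXn2r _ 2) ?nnegrE ?sqrtr_ge0 ?mulr_ge0 ?sqrtr_ge0 //.
  rewrite exprMn !sqr_sqrtr //; last by apply: le_trans pm0; rewrite divr_ge0.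
  by lra.
have ln1 : 1 <= ln (Num.sqrt pm).
  rewrite -[leLHS](expRK 1) ler_ln ?posrE ?expR_gt0 //; last first.
    by rewrite sqrtr_gt0; apply: lt_le_trans pm0; rewrite divr_gt0.
  rewrite -(@ler_pXn2r _ 2) ?nnegrE ?sqrtr_ge0 ?expR_ge0 // sqr_sqrtr.
    by apply: le_trans pm0; rewrite ler_pdivlMr // mulrC.
  by apply: le_trans pm0; rewrite divr_ge0.
have -> : e ^+ (3 * R - 3) = Num.sqrt m%:R * (1 / Num.sqrt m%:R) ^+ R.
  rewrite se -exprVn div1r -exprVn invrK -exprM.
  have -> : (3 * R = 3 + (3 * R - 3))%N by move: R3; clear; lia.
  by rewrite addKn exprD mulrA -exprMn mulVf // expr1n mul1r.
rewrite mulrA; apply: ler_wpM2r; first by rewrite exprn_ge0 // divr_ge0 ?sqrtr_ge0.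
rewrite [6 * C2]mulrC -!mulrA; apply: ler_wpM2l; first exact: ltW.
apply: le_trans smE _; rewrite ler_pM2l //; apply: ler_peMr => //; exact: sqrtr_ge0.
Qed.

End LargeRegimes.

Import ComplexField.Normc.

(** * Characteristic functions *)

Section ComplexSeries.
Context {K : realType}.
Local Open Scope complex_scope.
Implicit Types (u v : nat -> K[i]) (z l : K[i]) (x : fps K) (t : K).

Lemma normcD z l : normc (z + l) <= normc z + normc l.
Proof. exact: le_normcD. Qed.

Lemma normc_opp z : normc (- z) = normc z.
Proof. exact: normcN. Qed.

Definition ccvg u l := forall ep : K, 0 < ep ->
  exists J0, forall J, (J0 <= J)%N -> normc (u J - l) <= ep.

Lemma normc_real (a : K) : normc a%:C = `|a|.
Proof. by rewrite /normc /= expr0n addr0 sqrtr_sqr. Qed.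

Lemma normc_ge0 z : 0 <= normc z.
Proof. by case: z => a b; rewrite /normc sqrtr_ge0. Qed.

Lemma normr_normc z : `|z| = (normc z)%:C.
Proof. by rewrite normc_def; case: z. Qed.

Lemma normc_sum I (r : seq I) (F : I -> K[i]) :
  normc (\sum_(i <- r) F i) <= \sum_(i <- r) normc (F i).
Proof.
elim: r => [|i r IH]; first by rewrite !big_nil normc0.
by rewrite !big_cons; apply: le_trans (normcD _ _) _; rewrite lerD2l.
Qed.

Lemma normcX z j : normc (z ^+ j) = normc z ^+ j.
Proof. by elim: j => [|j IH]; rewrite ?expr0 ?normc1 // !exprS normcM IH. Qed.

Lemma normc_le z : normc z <= `|complex.Re z| + `|complex.Im z|.
Proof.
case: z => a b /=; rewrite -(ger0_norm (addr_ge0 (normr_ge0 a) (normr_ge0 b))) -sqrtr_sqr.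
rewrite ler_wsqrtr // sqrrD !real_normK ?num_real // lerD2r lerDl.
by rewrite mulrn_wge0 // mulr_ge0.
Qed.

Lemma ccvg_squeeze u l (e : nat -> K) : (forall J, normc (u J - l) <= e J) ->
  (forall ep, 0 < ep -> exists J0, forall J, (J0 <= J)%N -> e J <= ep) -> ccvg u l.
Proof. by move=> h he ep ep0; have [J0 hJ] := he _ ep0; exists J0 => J /hJ; apply: le_trans. Qed.

Lemma ccvgD u v l l' : ccvg u l -> ccvg v l' -> ccvg (fun J => u J + v J) (l + l').
Proof.
move=> hu hv ep ep0; have e2 : 0 < ep / 2 by rewrite divr_gt0.
have [J0 h0] := hu _ e2; have [J1 h1] := hv _ e2.
exists (maxn J0 J1) => J; rewrite geq_max => /andP[/h0 a0 /h1 a1].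
have -> : u J + v J - (l + l') = (u J - l) + (v J - l') by ring.
by apply: le_trans (normcD _ _) _; lra.
Qed.

Lemma ccvgZ z u l : ccvg u l -> ccvg (fun J => z * u J) (z * l).
Proof.
move=> hu ep ep0; have n0 : 0 < normc z + 1 by rewrite ltr_wpDl ?normc_ge0.
have [J0 h0] := hu (ep / (normc z + 1)) (divr_gt0 ep0 n0).
exists J0 => J /h0 h; rewrite -mulrBr normcM.
apply: (@le_trans _ _ ((normc z + 1) * normc (u J - l))).
  by rewrite ler_wpM2r ?normc_ge0 // lerDl.
by rewrite mulrC -ler_pdivlMr.
Qed.

Lemma ccvg_sum I (r : seq I) (F : I -> nat -> K[i]) (G : I -> K[i]) :
  (forall i, ccvg (F i) (G i)) ->
  ccvg (fun J => \sum_(i <- r) F i J) (\sum_(i <- r) G i).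
Proof.
move=> h; elim: r => [|i r IH].
  by move=> ep ep0; exists 0%N => J _; rewrite !big_nil subrr normc0 ltW.
have h2 := ccvgD (h i) IH.
by move=> ep /h2[J0 h3]; exists J0 => J /h3; rewrite !big_cons.
Qed.

Lemma ccvgM u v l l' : ccvg u l -> ccvg v l' -> ccvg (fun J => u J * v J) (l * l').
Proof.
move=> hu hv ep ep0.
have nv : 0 < normc l' + 1 by rewrite ltr_wpDl ?normc_ge0.
have nu : 0 < normc l + 1 by rewrite ltr_wpDl ?normc_ge0.
have [J0 h0] := hu _ (divr_gt0 (divr_gt0 ep0 (ltr0Sn _ 1)) nv).
have [J1 h1] := hv _ (divr_gt0 (divr_gt0 ep0 (ltr0Sn _ 1)) nu).
have [J2 h2] := hv _ ltr01.
exists (maxn J0 (maxn J1 J2)) => J; rewrite !geq_max => /andP[/h0 a0 /andP[/h1 a1 /h2 a2]].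
have -> : u J * v J - l * l' = (u J - l) * v J + l * (v J - l') by ring.
apply: le_trans (normcD _ _) _; rewrite !normcM.
have vb : normc (v J) <= normc l' + 1.
  rewrite -[v J](subrK l') addrC; apply: le_trans (normcD _ _) _.
  by rewrite lerD2l.
have -> : ep = ep / 2 / (normc l' + 1) * (normc l' + 1) + (normc l + 1) * (ep / 2 / (normc l + 1)).
  by field; rewrite !gt_eqF.
apply: lerD; apply: ler_pM; rewrite ?normc_ge0 //.
by rewrite lerDl.
Qed.

Lemma cvg_eps (f : nat -> K) (a : K) : (f @ \oo --> a)%classic ->
  forall ep, 0 < ep -> exists J0, forall J, (J0 <= J)%N -> `|f J - a| <= ep.
Proof.
move=> /cvgrPdist_le h ep ep0; have [J0 _ hJ] := h _ ep0.
by exists J0 => J JJ; rewrite distrC; exact: hJ.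
Qed.

Lemma ccvg_complex (f g : nat -> K) a b : (f @ \oo --> a)%classic ->
  (g @ \oo --> b)%classic -> ccvg (fun J => f J +i* g J) (a +i* b).
Proof.
move=> /cvg_eps hf /cvg_eps hg ep ep0; have e2 : 0 < ep / 2 by rewrite divr_gt0.
have [J0 h0] := hf _ e2; have [J1 h1] := hg _ e2.
exists (maxn J0 J1) => J; rewrite geq_max => /andP[/h0 a0 /h1 a1].
by apply: le_trans (normc_le _) _ => /=; lra.
Qed.

Lemma ccvg_of_cvg u l : ((u : nat -> K[i]^o) @ \oo --> (l : K[i]^o))%classic -> ccvg u l.
Proof.
move=> /cvgrPdist_le h ep ep0.
have e0 : 0 < ep%:C :> K[i] by rewrite ltcR.
have [J0 _ hJ] := h _ e0.
exists J0 => J JJ; have := hJ _ JJ; rewrite /= distrC.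
by rewrite (normr_normc (u J - l)) lecR.
Qed.

Definition exp_sum (F : numFieldType) (J : nat) (a : F) : F := \sum_(j < J) a ^+ j / j`!%:R.

Lemma sum_split_at (V : zmodType) (G : nat -> V) J i : (i <= J)%N ->
  \sum_(j < J) G j = \sum_(j < J - i) G j + \sum_(j < i) G (J - i + j)%N.
Proof. by move=> h; rewrite -[in LHS](subnK h) big_split_ord. Qed.

Lemma exp_sum_mul (F : numFieldType) J (a b : F) :
  exp_sum J a * exp_sum J b - exp_sum J (a + b) =
  \sum_(i < J) \sum_(j < i) (a ^+ i / i`!%:R) * (b ^+ (J - i + j)%N / (J - i + j)%N`!%:R).
Proof.
have -> : exp_sum J (a + b) =
    \sum_(i < J) \sum_(j < J - i) (a ^+ i / i`!%:R) * (b ^+ j / j`!%:R).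
  rewrite -(triangle_sum (fun i j => (a ^+ i / i`!%:R) * (b ^+ j / j`!%:R))).
  apply: eq_bigr => q _; rewrite addrC exprDn mulr_suml; apply: eq_bigr => i _.
  have iq : (i <= q)%N by rewrite -ltnS.
  have := bin_fact iq => /(congr1 (fun k => k%:R : F)); rewrite !natrM => <-.
  have f1 : (i`!)%:R != 0 :> F by rewrite pnatr_eq0 -lt0n fact_gt0.
  have f2 : ((q - i)`!)%:R != 0 :> F by rewrite pnatr_eq0 -lt0n fact_gt0.
  have f3 : ('C(q, i))%:R != 0 :> F by rewrite pnatr_eq0 -lt0n bin_gt0.
  by rewrite -mulr_natr; field; rewrite f1 f2 f3.
rewrite /exp_sum mulr_suml -sumrB; apply: eq_bigr => i _.
have iJ : (i <= J)%N := ltnW (ltn_ord i).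
rewrite mulr_sumr (sum_split_at (fun j => a ^+ i / i`!%:R * (b ^+ j / j`!%:R)) iJ).
by rewrite addrAC subrr add0r.
Qed.

Lemma exp_sum_cvg (a : K) : ((fun J => exp_sum J a) @ \oo --> expR a)%classic.
Proof.
rewrite (_ : (fun J => exp_sum J a) = series (exp_coeff a)); first exact: is_cvg_series_exp_coeff.
by apply/funext => J; rewrite /exp_sum /series /= big_mkord.
Qed.

Lemma exp_sum_mul_small (a b : K) : forall ep, 0 < ep -> exists J0, forall J, (J0 <= J)%N ->
  exp_sum J a * exp_sum J b - exp_sum J (a + b) <= ep.
Proof.
move=> ep ep0.
have h : ((fun J => exp_sum J a * exp_sum J b - exp_sum J (a + b)) @ \oo
    --> expR a * expR b - expR (a + b))%classic.
  by apply: cvgB; [apply: cvgM|]; exact: exp_sum_cvg.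
have [J0 hJ] := cvg_eps h ep0.
exists J0 => J /hJ; rewrite expRD subrr subr0; apply: le_trans; exact: ler_norm.
Qed.

Lemma normc_nat k : normc (k%:R : K[i]) = k%:R.
Proof. by rewrite -[k%:R](rmorph_nat (real_complex K)) normc_real normr_nat. Qed.

(** By [exp_sum_mul] the defect between the product of partial sums and the partial sum at z + z' is
    a sum of monomials. Termwise it is dominated by the same defect at the moduli, which tends to 0
    by [expRD]. *)
Lemma exp_sum_mul_ccvg z z' (l : K[i]) :
  ccvg (fun J => exp_sum J z * exp_sum J z') l -> ccvg (fun J => exp_sum J (z + z')) l.
Proof.
move=> h.
have d : ccvg (fun J => - (exp_sum J z * exp_sum J z' - exp_sum J (z + z'))) 0.
  apply: (@ccvg_squeeze _ _ (fun J => exp_sum J (normc z) * exp_sum J (normc z') -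
      exp_sum J (normc z + normc z'))); last exact: exp_sum_mul_small.
  move=> J; rewrite subr0 normc_opp !exp_sum_mul.
  apply: le_trans (normc_sum _ _) _; apply: ler_sum => i _.
  apply: le_trans (normc_sum _ _) _; apply: ler_sum => j _.
  by rewrite !normcM !normcV !normcX !normc_nat.
have := ccvgD h d; rewrite addr0 => h2 ep ep0; have [J0 h3] := h2 ep ep0.
exists J0 => J /h3; rewrite (_ : _ + _ - l = exp_sum J (z + z') - l) //; ring.
Qed.

Lemma cexpD z z' : cexp (z + z') = cexp z * cexp z'.
Proof.
case: z z' => [a b] [a' b']; rewrite /cexp /= expRD cosD sinD.
by apply/eqP; rewrite eq_complex /= !mul0r !subr0 !addr0; apply/andP; split; apply/eqP; ring.
Qed.

Lemma cexp0 : cexp (0 : K[i]) = 1.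
Proof. by rewrite /cexp /= expR0 cos0 sin0 mul1r. Qed.

Lemma cexp_real (a : K) : cexp a%:C = (expR a)%:C.
Proof. by rewrite /cexp /= cos0 sin0 mulr1. Qed.

Lemma exp_sum_real J (a : K) : exp_sum J a%:C = (exp_sum J a)%:C.
Proof.
rewrite /exp_sum rmorph_sum; apply: eq_bigr => j _.
by rewrite rmorphM rmorphXn fmorphV rmorph_nat.
Qed.

Lemma expr_imag (b : K) j : (b *i : K[i]) ^+ j =
  ((~~ odd j)%:R * (-1) ^+ j./2 * b ^+ j) +i* ((odd j)%:R * (-1) ^+ j.-1./2 * b ^+ j).
Proof.
elim: j => [|j IH]; first by rewrite !expr0 !mul1r !mul0r.
have mulI p q : (b *i : K[i]) * (p +i* q) = (- (b * q)) +i* (b * p).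
  by apply/eqP; rewrite eq_complex /=; apply/andP; split; apply/eqP; ring.
rewrite exprS IH mulI /= uphalf_half; case: (boolP (odd j)) => oj /=.
  have -> : (j./2 = j.-1./2)%N by case: j oj {IH} => //= j oj; rewrite uphalf_half (negbTE oj).
  by congr (_ +i* _); rewrite ?add1n !exprS; ring.
by congr (_ +i* _); rewrite ?add0n !exprS; ring.
Qed.

(** [cexp] is defined through real and imaginary parts, whereas the Poisson transform needs its
    power series. The real part uses the real exponential series, the imaginary part those of cosine
    and sine. *)
Lemma ccvg_exp z : ccvg (fun J => exp_sum J z) (cexp z).
Proof.
have -> : z = (complex.Re z)%:C + (complex.Im z) *i.
  by case: z => a b; apply/eqP; rewrite eq_complex /= addr0 add0r !eqxx.
move: (complex.Re z) (complex.Im z) => a b {z}; rewrite cexpD.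
apply: exp_sum_mul_ccvg; apply: ccvgM.
  have h0 : ((fun=> 0 : K) @ \oo --> (0 : K))%classic by exact: cvg_cst.
  have h := ccvg_complex (@exp_sum_cvg a) h0.
  by rewrite cexp_real => ep ep0; have [J0 hJ] := h _ ep0; exists J0 => J /hJ; rewrite exp_sum_real.
have hc : (series (cos_coeff b) @ \oo --> cos b)%classic.
  by rewrite unlock; exact: is_cvg_series_cos_coeff.
have hs : (series (sin_coeff b) @ \oo --> sin b)%classic.
  by rewrite unlock; exact: is_cvg_series_sin_coeff.
have h := ccvg_complex hc hs.
have -> : cexp (b *i) = cos b +i* sin b by rewrite /cexp /= expR0 mul1r.
move=> ep ep0; have [J0 hJ] := h _ ep0; exists J0 => J /hJ.
congr (normc (_ - _) <= _); rewrite /series /= !big_mkord.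
elim: J => [|J IH]; first by rewrite /exp_sum !big_ord0.
rewrite /exp_sum !big_ord_recr /= -[in RHS]/(exp_sum J _) -IH expr_imag.
rewrite -[J`!%:R](rmorph_nat (real_complex K)) -fmorphV.
apply/eqP; rewrite eq_complex /= !mulr0 subr0 add0r /cos_coeff /sin_coeff /=.
by rewrite -!exprnP !eqxx.
Qed.

End ComplexSeries.

(** * Fourier transforms of sequences and their uniqueness *)

Section Fourier.
Context {K : realType}.
Local Open Scope complex_scope.
Implicit Types (x y : fps K) (t : K) (l : K[i]).

Definition ftrans (d : nat -> K) t l :=
  ccvg (fun J => \sum_(j < J) cexp ((t * j%:R) *i) * (d j)%:C) l.

Lemma cexp_natmul t j : cexp ((t * j%:R) *i) = cexp (t *i) ^+ j.
Proof.
elim: j => [|j IH]; first by rewrite mulr0 expr0 -cexp0.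
rewrite exprS -IH -cexpD; congr cexp.
by apply/eqP; rewrite eq_complex /= addr0 eqxx -natr1; apply/eqP; ring.
Qed.

Lemma normc_cexp t : normc (cexp (t *i)) = 1.
Proof. by rewrite /cexp expR0 mul1r /normc cos2Dsin2 sqrtr1. Qed.

Lemma ftrans_ext (d d' : nat -> K) t l : d =1 d' -> ftrans d t l -> ftrans d' t l.
Proof. by move=> /funext ->. Qed.

Lemma ftransD (d d' : nat -> K) t l l' : ftrans d t l -> ftrans d' t l' ->
  ftrans (fun j => d j + d' j) t (l + l').
Proof.
move=> h h' ep /(ccvgD h h')[J0 hJ]; exists J0 => J /hJ.
by rewrite -big_split; under eq_bigr do rewrite /= -mulrDr -rmorphD.
Qed.

Lemma ftransZ (d : nat -> K) a t l : ftrans d t l -> ftrans (fun j => a * d j) t (a%:C * l).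
Proof.
move=> h ep /(ccvgZ a%:C h)[J0 hJ]; exists J0 => J /hJ.
by rewrite mulr_sumr; under eq_bigr do rewrite mulrCA -rmorphM.
Qed.

Lemma ftransX x t l : ftrans (fcoef x) t l ->
  ftrans (fcoef (fps_X * x)) t (cexp (t *i) * l).
Proof.
move=> h ep /(ccvgZ (cexp (t *i)) h)[J0 hJ]; exists J0.+1 => -[//|J] /hJ.
rewrite big_ord_recl fcoef_XM rmorph0 mulr0 add0r mulr_sumr.
congr (normc (_ - _) <= _); apply: eq_bigr => j _.
by rewrite lift0 fcoef_XM mulrA cexp_natmul -exprS -cexp_natmul.
Qed.

Lemma ftrans_w x t l : ftrans (fcoef x) t l ->
  ftrans (fcoef (fps_w * x)) t ((cexp (t *i) - 1) * l).
Proof.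
move=> h; have := ftransD (ftransX h) (ftransZ (-1) h).
rewrite (_ : _ * l + _ = (cexp (t *i) - 1) * l); last by rewrite rmorphN1; ring.
by apply: ftrans_ext => j; rewrite /fps_w mulrBl mul1r fcoefB mulN1r.
Qed.

Lemma peval_wMXaddC (p : {poly K}) c :
  peval_w (p * 'X + c%:P) = peval_w p * fps_w + fps_cst c.
Proof. by rewrite /peval_w rmorphD rmorphM /= map_polyX map_polyC hornerMXaddC. Qed.

Lemma ftrans_peval x (p : {poly K}) t l : ftrans (fcoef x) t l ->
  ftrans (fcoef (x * peval_w p)) t (l * (map_poly (real_complex K) p).[cexp (t *i) - 1]).
Proof.
move=> h; elim/poly_ind: p => [|p c IH].
  rewrite /peval_w !map_poly0 !horner0 !mulr0.
  have := ftransZ 0 h; rewrite (_ : (0 : K)%:C * l = 0); last by rewrite rmorph0 mul0r.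
  by apply: ftrans_ext => j; rewrite mul0r.
rewrite peval_wMXaddC rmorphD rmorphM /= map_polyX map_polyC hornerMXaddC.
have := ftransD (ftrans_w IH) (ftransZ c h).
set z := cexp _ - 1; rewrite (_ : z * _ + _ = l * ((map_poly (real_complex K) p).[z] * z + c%:C)).
  apply: ftrans_ext => j; rewrite -fcoef_cstM -fcoefD; congr (fcoef _ j); ring.
by ring.
Qed.

Lemma ftrans_expw lam t :
  ftrans (fcoef (expw lam)) t (cexp (lam%:C * (cexp (t *i) - 1))).
Proof.
have h := ccvgZ (cexp (- lam)%:C) (@ccvg_exp K (lam%:C * cexp (t *i))).
rewrite -cexpD in h.
have -> : lam%:C * (cexp (t *i) - 1) = (- lam)%:C + lam%:C * cexp (t *i).
  by rewrite rmorphN; ring.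
move=> ep /h[J0 hJ]; exists J0 => J /hJ; congr (normc (_ - _) <= _).
rewrite cexp_real /exp_sum mulr_sumr; apply: eq_bigr => j _.
rewrite cexp_natmul /= exprMn !rmorphM fmorphV rmorphXn rmorph_nat; ring.
Qed.

Lemma tail_small (d : nat -> K) (B : K) : (forall N, \sum_(j < N) `|d j| <= B) ->
  forall ep, 0 < ep -> exists M0, forall M J, (M0 <= M <= J)%N -> \sum_(M <= j < J) `|d j| <= ep.
Proof.
move=> hB ep ep0; pose u N := \sum_(j < N) `|d j|.
have uE a b : (a <= b)%N -> u b = u a + \sum_(a <= j < b) `|d j|.
  by move=> ab; rewrite /u -!(big_mkord xpredT (fun j => `|d j|)) -big_cat_nat.
have nd : nondecreasing_seq u.
  by move=> a b ab; rewrite (uE _ _ ab) lerDl sumr_ge0.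
have cv : (cvgn u).
  by apply: nondecreasing_is_cvgn => //; exists B => _ [N _ <-]; exact: hB.
have [M0 hM] := cvg_eps cv ep0; exists M0 => M J /andP[M0M MJ].
have h1 := nondecreasing_cvgn_le nd cv J.
have := hM M M0M; rewrite distrC => /(le_trans (ler_norm _)).
have := uE _ _ MJ; lra.
Qed.

Lemma root_unity M r : (0 < r < M)%N -> cexp ((pi *+ 2 / M%:R) *i) ^+ r != 1 :> K[i].
Proof.
move=> /andP[r0 rM]; rewrite -cexp_natmul; apply/negP => /eqP /(congr1 (@complex.Re K)).
rewrite /cexp expR0 mul1r.
have M0 : 0 < M%:R :> K by rewrite ltr0n (leq_ltn_trans _ rM).
have -> : pi *+ 2 / M%:R * r%:R = (pi * r%:R / M%:R) *+ 2 :> K.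
  by rewrite !mulrnAl mulrAC.
have a0 : 0 < (pi * r%:R / M%:R : K) < pi.
  apply/andP; split; first by rewrite divr_gt0 // mulr_gt0 ?pi_gt0 ?ltr0n.
  by rewrite ltr_pdivrMr // ltr_pM2l ?pi_gt0 // ltr_nat.
have := sin_gt0_pi a0; set th := pi * r%:R / M%:R => s0.
have := cos2Dsin2 th; have : 0 < sin th ^+ 2 by rewrite exprn_gt0.
by rewrite /= cos_mulr2n -mulr_natr; lra.
Qed.

Lemma root_unity1 M : (0 < M)%N -> cexp ((pi *+ 2 / M%:R) *i) ^+ M = 1 :> K[i].
Proof.
move=> M0; rewrite -cexp_natmul divfK ?pnatr_eq0 -?lt0n //.
rewrite /cexp expR0 mul1r sin2pi.
have -> : cos (pi *+ 2) = 1 :> K by rewrite cos_mulr2n cospi sqrrN expr1n; lra.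
by [].
Qed.

(** Averaging over the M-th roots of unity isolates [d k] up to the aliases [d j] with j >= M. Their
    mass and the error of the limit are each at most a third of [|d k|], so a nonzero [d k] is
    impossible. The exponent [M - k] stands for - k. *)
Lemma trig_uniq (d : nat -> K) (B : K) : (forall N, \sum_(j < N) `|d j| <= B) ->
  (forall t, ftrans d t 0) -> forall k, d k = 0.
Proof.
move=> hB hd k; apply/eqP/negPn/negP => dk.
have e0 : 0 < `|d k| / 3 by rewrite divr_gt0 ?normr_gt0.
have [M0 hM] := tail_small hB e0.
pose M := (maxn M0 k.+1); have kM : (k < M)%N by rewrite leq_maxr.
have Mpos : (0 < M)%N by apply: leq_ltn_trans kM.
have M0M : (M0 <= M)%N by rewrite leq_maxl.
have MR : 0 < M%:R :> K by rewrite ltr0n.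
pose om : K[i] := cexp ((pi *+ 2 / M%:R) *i).
have omM : om ^+ M = 1 by exact: root_unity1.
have nom j : normc (om ^+ j) = 1 by rewrite normcX normc_cexp expr1n.
pose S s J := \sum_(j < J) cexp ((pi *+ 2 / M%:R * s%:R * j%:R) *i) * (d j)%:C.
have SE s J : S s J = \sum_(j < J) om ^+ (s * j) * (d j)%:C.
  by apply: eq_bigr => j _; rewrite -mulrA -natrM cexp_natmul.
have hS : ccvg (fun J => \sum_(s < M) om ^+ (s * (M - k)) * S s J) 0.
  have := @ccvg_sum K _ (index_enum 'I_M) (fun s J => om ^+ (s * (M - k)) * S s J) (fun=> 0).
  rewrite big1 //; apply => s.
  rewrite -[X in ccvg _ X](mulr0 (om ^+ (s * (M - k)))); apply: ccvgZ; exact: hd.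
have [J0 hJ] := hS _ (mulr_gt0 MR e0).
pose J := maxn J0 M; have MJ : (M <= J)%N by rewrite leq_maxr.
have := hJ J (leq_maxl _ _); rewrite subr0.
pose W j := \sum_(s < M) om ^+ (s * (j + (M - k))).
have -> : \sum_(s < M) om ^+ (s * (M - k)) * S s J = \sum_(j < J) W j * (d j)%:C.
  under eq_bigr => s _ do rewrite SE mulr_sumr.
  rewrite exchange_big /=; apply: eq_bigr => j _.
  rewrite mulr_suml; apply: eq_bigr => s _.
  by rewrite mulrA -exprD -mulnDr addnC.
have Wle j : normc (W j) <= M%:R.
  apply: le_trans (normc_sum _ _) _.
  by under eq_bigr do rewrite nom; rewrite sumr_const card_ord.
have W0 j : (j < M)%N -> j != k -> W j = 0.
  move=> jM jk; rewrite /W; set q := (j + (M - k))%N.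
  have oq : om ^+ q != 1.
    rewrite -(expr_mod q omM); apply: root_unity; rewrite ltn_mod Mpos andbT lt0n.
    apply/negP => /eqP e; have := divn_eq q M; rewrite e addn0 => e2.
    have q2 : (q < 2 * M)%N by rewrite /q; lia.
    have q0 : (0 < q)%N by rewrite /q; lia.
    have : (q %/ M = 1)%N by move: e2 q2 q0; move: (q %/ M)%N => v; clear; nia.
    by move=> e3; move: e2; rewrite e3 mul1n /q; move: jk; clear -kM jM; lia.
  have : (om ^+ q - 1) * W j = 0.
    rewrite /W; under eq_bigr => s _ do rewrite mulnC exprM.
    by rewrite -subrX1 -exprM mulnC exprM omM expr1n subrr.
  by move=> /eqP; rewrite mulf_eq0 subr_eq0 (negbTE oq) /= => /eqP.
have Wk : W k = M%:R.
  rewrite /W subnKC ?(ltnW kM) //; under eq_bigr => s _ do rewrite mulnC exprM omM expr1n.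
  by rewrite sumr_const card_ord.
rewrite -(big_mkord xpredT (fun j => W j * (d j)%:C)) (big_cat_nat (n := M)) //= big_mkord.
rewrite (bigD1 (Ordinal kM)) //= big1 ?addr0; last first.
  by move=> j jk; rewrite W0 ?mul0r.
set R := \sum_(M <= j < J) _ => hn.
have hR : normc R <= M%:R * (`|d k| / 3).
  apply: le_trans (normc_sum _ _) _.
  apply: (@le_trans _ _ (\sum_(M <= j < J) M%:R * `|d j|)).
    apply: ler_sum => j _; rewrite normcM normc_real; apply: ler_wpM2r => //; exact: Wle.
  by rewrite -mulr_sumr; apply: ler_wpM2l; [exact: ltW|apply: hM; rewrite M0M].
have : normc (W k * (d k)%:C) <= M%:R * (`|d k| / 3) + M%:R * (`|d k| / 3).
  rewrite -[X in normc X](addrK R); apply: le_trans (normcD _ _) _.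
  by rewrite normc_opp; apply: lerD.
rewrite Wk normcM normc_nat normc_real => h.
have : 0 < M%:R * (`|d k| / 3) by rewrite mulr_gt0.
by move: h; rewrite (_ : M%:R * `|d k| = 3 * (M%:R * (`|d k| / 3))); [lra|field].
Qed.

End Fourier.

(** * Signed measures on the integers *)

Section PointSeries.
Context {K : realType}.
Local Open Scope classical_set_scope.
Implicit Types (mu nu : set int -> \bar K) (A : set int).

(** What the law of the shifted waiting time and nu_R have in common; point masses determine such a
    set function. *)
Record signed_law mu : Prop := SignedLaw {
  law_sigma : semi_sigma_additive mu ;
  law_fin : forall A, mu A \is a fin_num ;
  law_neg : forall A, A `<=` [set j | j < 0] -> mu A = 0%E }.

Lemma int_measurable A : measurable A.
Proof. by []. Qed.

Lemma law_point_series mu A : signed_law mu ->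
  (fun N => \sum_(j < N) fine (mu (A `&` [set j%:Z]))) @ \oo --> fine (mu A).
Proof.
move=> [sig fin neg].
pose F i := if i is j.+1 then A `&` [set j%:Z] else A `&` [set j | j < 0].
have FA : \bigcup_n F n = A.
  apply/seteqP; split => [z [[|j] _ [//]]|z Az].
  case: (ltP z 0) => [z0|z0]; first by exists 0%N.
  by exists `|z|%N.+1 => //; split => //=; rewrite gez0_abs.
have triv : trivIset setT F.
  move=> [|i] [|j] _ _ //= [z [[_ /= h1] [_ /= h2]]].
  - by move: h1; rewrite h2.
  - by move: h2; rewrite h1.
  - by move: h1; rewrite h2 => -[->].
have := sig F (fun=> int_measurable _) triv (int_measurable _).
rewrite FA -(fineK (fin A)) => /fine_cvg.
rewrite -cvg_shiftS; apply: cvg_trans; apply: near_eq_cvg; near=> N => /=.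
rewrite big_nat_recl //= neg ?add0e; last by move=> z [].
by rewrite big_mkord -sum_fine.
Unshelve. all: by end_near. Qed.

Lemma law_point mu A j : signed_law mu ->
  fine (mu (A `&` [set j%:Z])) = if `[< A j%:Z >] then fine (mu [set j%:Z]) else 0.
Proof.
move=> [_ _ neg]; case: asboolP => Aj.
  by congr (fine (mu _)); apply/seteqP; split => [z []//|z /= ->].
by rewrite neg // => z [Az /= e]; case: Aj; rewrite -e.
Qed.

(** With A the set of points of nonnegative mass, the modulus of each point mass is twice its part
    in A minus itself, so the partial sums follow from two convergent point series. The 3 collects
    an error of 1 in each series, with weights 2 and 1. *)
Lemma law_summable mu : signed_law mu ->
  exists B, forall N, \sum_(j < N) `|fine (mu [set j%:Z])| <= B.
Proof.
move=> h; pose A := [set z | 0 <= fine (mu [set z])].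
have cA := law_point_series (A:=A) h; have cT := law_point_series (A:=setT) h.
have [J0 h0] := cvg_eps cA ltr01; have [J1 h1] := cvg_eps cT ltr01.
exists (2 * fine (mu A) - fine (mu setT) + 3) => N; pose J := maxn (maxn J0 J1) N.
apply: (@le_trans _ _ (\sum_(j < J) `|fine (mu [set j%:Z])|)).
  rewrite -!(big_mkord xpredT (fun j => `|fine (mu [set (j : nat)%:Z])|)).
  by rewrite [leRHS](big_cat_nat (n := N)) ?leq_maxr //= lerDl sumr_ge0.
have -> : \sum_(j < J) `|fine (mu [set j%:Z])| =
    2 * \sum_(j < J) fine (mu (A `&` [set j%:Z])) - \sum_(j < J) fine (mu (setT `&` [set j%:Z])).
  rewrite mulr_sumr -sumrB; apply: eq_bigr => j _.
  rewrite !law_point // [X in _ - (if X then _ else _)]asboolT //.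
  case: asboolP => [p|/negP]; first by rewrite ger0_norm //; lra.
  by rewrite -ltNge => p; rewrite ltr0_norm //; lra.
have /h0 : (J0 <= J)%N by rewrite /J -maxnA leq_maxl.
have /h1 : (J1 <= J)%N by rewrite /J -maxnA maxnCA leq_maxl.
rewrite !ler_norml => /andP[b _] /andP[_ a].
move: a b; clear; lra.
Qed.

Lemma dTV_le mu nu (B : K) : signed_law mu -> signed_law nu ->
  (forall N, \sum_(j < N) `|fine (mu [set j%:Z]) - fine (nu [set j%:Z])| <= B) ->
  (dTV mu nu <= B%:E)%E.
Proof.
move=> hm hn hB; apply: ge_ereal_sup => _ [A _ <-].
rewrite -(fineK (law_fin hm A)) -(fineK (law_fin hn A)) -EFinB abse_EFin lee_fin.
rewrite leNgt; apply/negP => lt.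
have cv : (fun N => \sum_(j < N) fine (mu (A `&` [set j%:Z])) -
    \sum_(j < N) fine (nu (A `&` [set j%:Z]))) @ \oo --> fine (mu A) - fine (nu A).
  by apply: cvgB; exact: law_point_series.
move: cv; set l := (_ - _) in lt *; have e0 : 0 < (`|l| - B) / 2 by lra.
move=> cv; have [J0 /(_ J0 (leqnn _))] := cvg_eps cv e0.
rewrite -sumrB; set S := \sum_(j < _) _ => h.
have : `|S| <= B.
  apply: le_trans (hB J0); apply: le_trans (ler_norm_sum _ _ _) _.
  apply: ler_sum => j _; rewrite !law_point //.
  by case: asboolP => // _; rewrite subrr normr0.
have := ler_distD S l 0; rewrite !subr0 (distrC l S); move: h lt; clear; lra.
Qed.

Lemma charge_law (nu : {charge set int -> \bar K}) :
  (forall A, A `<=` [set j | j < 0] -> nu A = 0%E) -> signed_law nu.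
Proof.
move=> neg; split => //; first exact: charge_semi_sigma_additive.
by move=> A; exact: fin_num_measure.
Qed.

End PointSeries.

(** * Point masses of the Poisson-Charlier measure *)

Section CharlierCoefficients.
Context {K : realType}.
Local Open Scope complex_scope.

Lemma horner_map_expp L (p : {poly K}) (z : K[i]) :
  (map_poly (real_complex K) (expp L p)).[z] =
  \sum_(0 <= l < L.+1) (map_poly (real_complex K) p).[z] ^+ l / l`!%:R.
Proof.
rewrite big_mkord /expp rmorph_sum horner_sum; apply: eq_bigr => l _.
by rewrite /= map_polyZ hornerZ rmorphXn horner_exp mulrC fmorphV rmorph_nat.
Qed.

Lemma horner_map_logp (A : nat -> K) c R (z : K[i]) : (3 <= R)%N ->
  (map_poly (real_complex K) (logp A c R)).[z] =
  - (A 2 - c%:R)%:C * z + (A 2 - c%:R)%:C * (z ^+ 2 / 2) +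
  \sum_(3 <= r < R.+1) (A r + (-1) ^+ r.+1 * c%:R)%:C * (z ^+ r / r%:R).
Proof.
case: R => [|[|[|R]]] // _; rewrite (@horner_coef_wide _ R.+4) ?size_map_poly ?size_logp //.
rewrite -(big_mkord xpredT (fun i => (map_poly (real_complex K) (logp A c R.+3))`_i * z ^+ i)).
rewrite big_ltn // big_ltn // big_ltn //.
have cf r : (map_poly (real_complex K) (logp A c R.+3))`_r = ((logp A c R.+3)`_r)%:C by rewrite coef_map.
have sc (a b : K) (y : K[i]) r : a = b / r%:R -> a%:C * y = b%:C * (y / r%:R).
  by move=> ->; rewrite rmorphM fmorphV rmorph_nat -!mulrA (mulrC y).
rewrite !cf logp_coef0 rmorph0 mul0r add0r expr1 addrA; congr (_ + _ + _).
- congr (_ * _); rewrite coefD coefZ !coef_poly /=.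
  by rewrite -rmorphN; congr _%:C; rewrite expr2; field.
- by apply: (sc _ _ _ 2); rewrite coefD coefZ !coef_poly /= !exprS expr0; field.
- apply: eq_big_nat => r /andP[r3 rR]; rewrite cf; apply: sc.
  rewrite coefD coefZ !coef_poly rR; move: r3; case: r {rR} => [//|[//|r]] _ /=.
  by rewrite mulrDl [in RHS](mulrC _ c%:R) -[in RHS]mulrA.
Qed.

Lemma HR_horner n m R c (z : K[i]) : (3 <= R)%N ->
  (1 < acoef n m 2 :> K -> Num.floor (acoef n m 2 : K) = c%:Z) ->
  (~~ (1 < acoef n m 2 :> K) -> c = 0%N) ->
  HR n m R z = (map_poly (real_complex K)
    (expp (if 1 < acoef n m 2 :> K then R else (3 * R - 2)%N) (logp (acoef n m) c R))).[z].
Proof.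
move=> R3 h1 h0; rewrite horner_map_expp horner_map_logp //.
apply: eq_bigr => l _; congr (_ ^+ _ / _); rewrite /hR.
case: ifP => [/h1 ->|/negbT /h0 ->]; first by rewrite -pmulrn.
rewrite subr0; congr (_ + _); apply: eq_bigr => r _.
by rewrite mulr0 addr0.
Qed.

Lemma fnorm_charlier (lam : K) p : 0 <= lam ->
  exists B, forall N, fnorm N (expw lam * peval_w p) <= B.
Proof.
move=> lam0; exists (pnorm 2 p) => N; apply: (@fnorm_peval_w _ _ _ _ (size p)) => // k _.
elim: k => [|k IH]; first by rewrite expr0 mul1r; exact: subprob_expw.
rewrite exprS -mulrA exprS; apply: le_trans (fnormM _ _ _) _.
by apply: ler_pM; rewrite ?fnorm_ge0 // fnorm_w.
Qed.

(** The point masses of nu and the coefficients on the right are both absolutely summable and have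
    the same transform, so [trig_uniq] applies to their difference. *)
Lemma poisson_charlier_coef n m R c (nu : {charge set int -> \bar K}) k : (3 <= R)%N ->
  (1 < acoef n m 2 :> K -> Num.floor (acoef n m 2 : K) = c%:Z) ->
  (~~ (1 < acoef n m 2 :> K) -> c = 0%N) ->
  poisson_charlier n m R nu ->
  fine (nu [set k%:Z]%classic) =
  fcoef (expw (sigma_sq n m) * peval_w
    (expp (if 1 < acoef n m 2 :> K then R else (3 * R - 2)%N) (logp (acoef n m) c R))) k.
Proof.
move=> R3 h1 h0 [neg ft]; set p := expp _ _; set x := expw _ * _.
have [B1 hB1] := law_summable (charge_law neg).
have [|B2 hB2] := @fnorm_charlier (sigma_sq n m) p.
  by rewrite sigma_sq_pois; apply: pois_mean_ge0 => j; exact: odds_ge0.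
apply/eqP; rewrite -subr_eq0; apply/eqP.
apply: (@trig_uniq _ (fun k => fine (nu [set k%:Z]%classic) - fcoef x k) (B1 + B2)) => [N|t].
  apply: le_trans (lerD (hB1 N) (hB2 N)).
  by rewrite -big_split; apply: ler_sum => j _; exact: ler_normB.
have h : ftrans (fun k => fine (nu [set k%:Z]%classic)) t
    (cexp ((sigma_sq n m)%:C * (cexp (t *i) - 1)) * HR n m R (cexp (t *i) - 1)).
  move=> ep /(ccvg_of_cvg (ft t))[J0 hJ]; exists J0 => J /hJ.
  by rewrite /series /= big_mkord.
have h2 := ftransZ (-1) (ftrans_peval p (ftrans_expw (sigma_sq n m) t)).
have := ftransD h h2; rewrite (HR_horner _ R3 h1 h0) rmorphN1 mulN1r subrr.
by apply: ftrans_ext => j; rewrite mulN1r.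
Qed.

End CharlierCoefficients.

(** * The law of the waiting time *)

Section Draws.
Context {K : realType} {d : measure_display} {T : measurableType d}.
Context (n : nat) (P : probability T K) (X : nat -> T -> 'I_n).
Hypotheses (n0 : (0 < n)%N) (hX : iid_uniform_draws P X).
Local Open Scope classical_set_scope.

Lemma prob_mem (S : eqType) (f : T -> S) (r : seq S) :
  (forall x, measurable [set w | f w = x]) -> uniq r ->
  measurable [set w | f w \in r] /\
  P [set w | f w \in r] = (\sum_(x <- r) P [set w | f w = x])%E.
Proof.
move=> mf; elim: r => [_|x r IH /= /andP[xr /IH[mr Pr]]].
  by rewrite (_ : [set _ | _] = set0) ?measure0 ?big_nil //; apply/seteqP; split.
have -> : [set w | f w \in x :: r] = [set w | f w = x] `|` [set w | f w \in r].
  apply/seteqP; split => w /=; rewrite inE; first by move=> /orP[/eqP|]; [left|right].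
  by move=> [->|->]; rewrite ?eqxx ?orbT.
split; first exact: measurableU.
rewrite big_cons -Pr; apply: measureU => //.
by apply/seteqP; split => // w [/= -> h]; rewrite h in xr.
Qed.

(** The latest draw comes first, so that one more draw is a cons. *)
Fixpoint word (t : nat) (w : T) : t.-tuple 'I_n :=
  if t is t'.+1 then [tuple of X t' w :: word t' w] else [tuple].

Lemma wordE t w : rev (word t w) = [seq X i w | i <- iota 0 t].
Proof.
elim: t => [//|t IH]; rewrite -[t.+1 in RHS]addn1 iotaD map_cat -IH /= rev_cons.
by rewrite -cats1.
Qed.

Lemma word_eqP t w (x : t.-tuple 'I_n) :
  (forall i, i \in iota 0 t -> nth (Ordinal n0) (rev x) i = X i w) <-> word t w = x.
Proof.
have sx : size (rev x) = t by rewrite size_rev size_tuple.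
have sw : size (rev (word t w)) = t by rewrite size_rev size_tuple.
have nw i : (i < t)%N -> nth (Ordinal n0) (rev (word t w)) i = X i w.
  by move=> it; rewrite wordE (nth_map 0%N) ?size_iota // nth_iota.
split => [h|<- i]; last by rewrite mem_iota add0n => /nw.
apply/val_inj/(can_inj revK)/(@eq_from_nth _ (Ordinal n0)); first by rewrite sx sw.
by move=> i; rewrite sw => it; rewrite nw // h // mem_iota.
Qed.

Lemma prob_word_eq t (x : t.-tuple 'I_n) :
  P [set w | word t w = x] = ((n%:R^-1 : K) ^+ t)%:E.
Proof.
have -> : [set w | word t w = x] = [set w | forall i, i \in iota 0 t ->
    [set y | nth (Ordinal n0) (rev x) i = y] (X i w)].
  by apply/seteqP; split => w /= /word_eqP.
rewrite (@draw_independent _ _ _ _ _ _ hX (iota 0 t)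
  (fun i => [set y | nth (Ordinal n0) (rev x) i = y]) (iota_uniq 0 t)).
under eq_bigr => i _.
  rewrite (_ : [set w | _ ] = [set w | X i w = nth (Ordinal n0) (rev x) i]).
    rewrite (draw_uniform hX); over.
  by apply/seteqP; split => w /=.
by rewrite -[in RHS](size_iota 0 t); elim: (iota 0 t) => [|i r IH];
  rewrite ?big_nil // big_cons IH -EFinM -exprS.
Qed.

Lemma word_measurable t (x : t.-tuple 'I_n) : measurable [set w | word t w = x].
Proof.
elim: t x => [|t IH] x.
  rewrite (_ : [set _ | _] = setT) //; apply/seteqP; split => // w _ /=.
  by apply: val_inj; case: x => -[].
rewrite (_ : [set _ | _] = [set w | X t w = thead x] `&`
    [set w | word t w = [tuple of behead x]]).
  by apply: measurableI => //; exact: (draw_measurable hX).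
case/tupleP: x => k x; apply/seteqP; split => w /=.
  by move=> /(congr1 val) /= [<- e]; split=> //; apply: val_inj.
by move=> [e1 /(congr1 val) e2]; apply: val_inj => /=; rewrite e1 theadE e2.
Qed.

Lemma prob_word t (Q : pred (t.-tuple 'I_n)) :
  measurable [set w | Q (word t w)] /\
  P [set w | Q (word t w)] = (\sum_(x | Q x) (n%:R^-1 : K) ^+ t)%:E.
Proof.
have -> : [set w | Q (word t w)] = [set w | word t w \in enum Q].
  by apply/seteqP; split => w /=; rewrite mem_enum.
have [m1 m2] := prob_mem (@word_measurable t) (enum_uniq Q); split=> //.
rewrite m2 big_enum /= -sumEFin; apply: eq_bigr => x _; exact: prob_word_eq.
Qed.

End Draws.

(** * Occupancy probabilities and their generating functions *)

Section Counting.
Context {K : realType}.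
Context (n : nat).

Definition ndist (x : seq 'I_n) : nat := size (undup x).

Lemma ndist_cons k x : ndist (k :: x) = (ndist x + (k \notin x))%N.
Proof. by rewrite /ndist /=; case: ifP => _; rewrite /= ?addn0 ?addn1. Qed.

Lemma sum_tupleS t (F : t.+1.-tuple 'I_n -> K) :
  \sum_x F x = \sum_(x : t.-tuple 'I_n) \sum_k F [tuple of k :: x].
Proof.
rewrite pair_big /= (reindex (fun p : t.-tuple 'I_n * 'I_n => [tuple of p.2 :: p.1])) //=.
exists (fun x : t.+1.-tuple 'I_n => ([tuple of behead x], thead x)) => [[x k] _|x _] /=.
  by rewrite theadE; congr pair; apply: val_inj.
by rewrite [RHS]tuple_eta.
Qed.

Lemma sum_draw (x : seq 'I_n) (a b : K) :
  \sum_k (if k \notin x then a else b) = (n%:R - (ndist x)%:R) * a + (ndist x)%:R * b.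
Proof.
have e : #|[pred k in x]| = ndist x.
  by rewrite /ndist -(card_uniqP (undup_uniq x)); apply: eq_card => k; rewrite !inE mem_undup.
rewrite (bigID (fun k => k \notin x)) /=; congr (_ + _).
  rewrite (eq_bigr (fun=> a)) => [|k -> //].
  rewrite sumr_const -[LHS]mulr_natl; congr (_ * _).
  apply/eqP; rewrite eq_sym subr_eq -natrD -e -{1}(card_ord n) addnC.
  by rewrite -(cardC [pred k in x]).
rewrite (eq_bigr (fun=> b)) => [|k /negbTE -> //].
rewrite sumr_const -[LHS]mulr_natl -e; congr (_%:R * _); apply: eq_card => k.
by rewrite unfold_in negbK inE.
Qed.

(* The probability that [t] draws give [i] distinct coupons. *)
Definition occ t i : K := \sum_(x : t.-tuple 'I_n | ndist x == i) n%:R^-1 ^+ t.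

Lemma occ0 i : occ 0 i = (i == 0%N)%:R.
Proof.
rewrite /occ (big_mkcond (fun x => _ == i)) (big_pred1 [tuple]) => [|x].
  by rewrite /ndist /= expr0 eq_sym; case: eqP.
by apply/esym/eqP; apply: val_inj; case: x => -[].
Qed.

Lemma sum_new_coupon t i (a : K) :
  \sum_(x : t.+1.-tuple 'I_n | (ndist x == i.+1) && (ndist (behead x) == i)) a =
  (n%:R - i%:R) * \sum_(x : t.-tuple 'I_n | ndist x == i) a.
Proof.
rewrite big_mkcond sum_tupleS mulr_sumr [RHS]big_mkcond; apply: eq_bigr => x _ /=.
rewrite (eq_bigr (fun k => if k \notin x then if ndist x == i then a else 0 else 0)).
  by rewrite sum_draw mulr0 addr0; case: eqP => [->|]; rewrite ?mulr0.
move=> k _; rewrite ndist_cons; case: (k \in x); rewrite /= ?addn0 ?addn1.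
  by case: (eqVneq (ndist x) i) => [->|_]; rewrite ?andbF // (ltn_eqF (ltnSn i)).
by rewrite eqSS andbb.
Qed.

Lemma sum_old_coupon t i (a : K) :
  \sum_(x : t.+1.-tuple 'I_n | (ndist x == i) && (ndist (behead x) == i)) a =
  i%:R * \sum_(x : t.-tuple 'I_n | ndist x == i) a.
Proof.
rewrite big_mkcond sum_tupleS mulr_sumr [RHS]big_mkcond; apply: eq_bigr => x _ /=.
rewrite (eq_bigr (fun k => if k \notin x then 0 else if ndist x == i then a else 0)).
  by rewrite sum_draw mulr0 add0r; case: eqP => [->|]; rewrite ?mulr0.
move=> k _; rewrite ndist_cons; case: (k \in x); rewrite /= ?addn0 ?addn1 ?andbb //.
by case: (eqVneq (ndist x) i) => [->|_]; rewrite ?andbF // -addn1 -[X in _ == X]addn0 eqn_add2l.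
Qed.

Lemma ndist_behead t (x : t.+1.-tuple 'I_n) :
  (ndist x == ndist (behead x)) || (ndist x == (ndist (behead x)).+1).
Proof.
by case/tupleP: x => k x /=; rewrite ndist_cons; case: (_ \notin _); rewrite ?addn0 ?addn1 eqxx ?orbT.
Qed.

Lemma occSE t i : occ t.+1 i =
  i%:R / n%:R * occ t i + (if i is i'.+1 then (n%:R - i'%:R) / n%:R * occ t i' else 0).
Proof.
have e (j : nat) (b : K) : b * n%:R^-1 * occ t j =
    b * \sum_(x : t.-tuple 'I_n | ndist x == j) n%:R^-1 ^+ t.+1.
  by rewrite /occ -mulrA exprS -mulr_sumr.
rewrite /occ (bigID (fun x : t.+1.-tuple 'I_n => ndist (behead x) == i)) /= sum_old_coupon -e.
congr (_ + _); case: i => [|i].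
  rewrite big1 // => x /andP[/eqP h1 h2].
  by have := ndist_behead x; rewrite h1 eq_sym (negbTE h2).
rewrite e -sum_new_coupon; apply: eq_bigl => x.
have := ndist_behead x; move: (ndist x) (ndist (behead x)) => b a; clear; lia.
Qed.

Lemma occ_gf0 : Fps (occ^~ 0%N) = 1.
Proof.
apply: fpsP => -[|t] /=; first by rewrite occ0.
by rewrite occSE mul0r mul0r add0r.
Qed.

Lemma occ_gfS i : (1 - fps_cst (i.+1%:R / n%:R) * fps_X) * Fps (occ^~ i.+1) =
  fps_cst ((n%:R - i%:R) / n%:R) * fps_X * Fps (occ^~ i).
Proof.
apply: fpsP => j; rewrite mulrBl mul1r -!mulrA fcoefB !fcoef_cstM !fcoef_XM.
case: j => [|j] /=; first by rewrite occ0 !mulr0 subrr.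
by rewrite occSE addrC addKr.
Qed.

(** For b = l / (n - l), 1 - b w is n / (n - l) times 1 - (l / n) z. The denominators of the
    occupancy recursion thus become geometric laws. *)
Lemma cst_geo l : (l < n)%N ->
  fps_cst ((n%:R - l%:R) / n%:R : K) =
  (1 - fps_cst (l%:R / n%:R) * fps_X) * geo (l%:R / (n%:R - l%:R)).
Proof.
move=> ln; have nl : 0 < n%:R - l%:R :> K by rewrite subr_gt0 ltr_nat.
have n0 : n%:R != 0 :> K by rewrite pnatr_eq0; case: n ln.
have b0 : 0 <= l%:R / (n%:R - l%:R) :> K by rewrite divr_ge0 // ltW.
have e2 : fps_cst ((n%:R - l%:R) / n%:R : K) * fps_cst (l%:R / (n%:R - l%:R)) = fps_cst (l%:R / n%:R).
  by rewrite -rmorphM; congr fps_cst; field; rewrite n0 gt_eqF.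
have e1 : fps_cst ((n%:R - l%:R) / n%:R : K) + fps_cst (l%:R / n%:R) = 1.
  by rewrite -rmorphD -(rmorph1 fps_cst); congr fps_cst; field.
rewrite -{1}e1 -e2 -[LHS]mulr1 -(geoK b0) /fps_w mulrA; congr (_ * _); ring.
Qed.

(** The factor (n - i) / n times z is the draw of a new coupon after i distinct ones, so the left
    side is the law of the time of the (i + 1)-th new coupon, and the right side that of a sum of
    independent geometric times. *)
Lemma occ_gf i : (i < n)%N ->
  fps_cst ((n%:R - i%:R) / n%:R) * fps_X * Fps (occ^~ i) =
  fps_X ^+ i.+1 * \prod_(0 <= l < i.+1) geo (l%:R / (n%:R - l%:R)).
Proof.
elim: i => [|i IH] lt.
  rewrite occ_gf0 big_nat1 mul0r geo0 !mulr1 expr1 subr0 divff ?rmorph1 ?mul1r //.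
  by rewrite pnatr_eq0 -lt0n.
rewrite big_nat_recr //= mulrA exprS -(mulrA fps_X) -IH ?(ltnW lt) // -(occ_gfS i) (cst_geo lt).
ring.
Qed.

Lemma occ_odds m : (m < n)%N ->
  fps_cst (m.+1%:R / n%:R) * fps_X * Fps (occ^~ (n - m).-1) =
  fps_X ^+ (n - m) * geo_prod (odds_range m n) (odds n) 1.
Proof.
move=> mn; have N0 : (0 < n - m)%N by rewrite subn_gt0.
have lt : ((n - m).-1 < n)%N by lia.
have -> : m.+1%:R = n%:R - (n - m).-1%:R :> K.
  by rewrite -natrB; [congr (_%:R); lia|lia].
rewrite (occ_gf lt) (prednK N0).
congr (_ * _); rewrite /geo_prod /odds_range big_nat_rev /= -[m.+1 in RHS]add0n big_addn subSS.
apply: eq_big_nat => l /andP[_ ln]; congr geo; rewrite mul1r /odds.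
rewrite -natrB; last by lia.
by congr (_%:R / _%:R); lia.
Qed.

End Counting.

(** * From occupancy to the waiting time *)

Section WaitingTime.
Context {K : realType} {d : measure_display} {T : measurableType d}.
Context (n m : nat) (P : probability T K) (X : nat -> T -> 'I_n).
Hypotheses (mn : (m < n)%N) (hX : iid_uniform_draws P X).
Local Open Scope classical_set_scope.
Let n0 : (0 < n)%N := leq_ltn_trans (leq0n m) mn.
Let W := waiting_time X m.

Lemma num_distinctE w t : num_distinct X w t = ndist (word X t w).
Proof.
rewrite /ndist -(card_uniqP (undup_uniq _)) /num_distinct; apply: eq_card => k.
rewrite mem_undup -mem_rev wordE; apply/imsetP/mapP; case=> i.
  by move=> _ ->; exists (i : nat); rewrite // mem_iota add0n ltn_ord.
by rewrite mem_iota add0n => it ->; exists (Ordinal it).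
Qed.

Lemma ndist_wordS w t :
  (ndist (word X t.+1 w) == ndist (word X t w)) || (ndist (word X t.+1 w) == (ndist (word X t w)).+1).
Proof. exact: (ndist_behead (word X t.+1 w)). Qed.

Lemma ndist_word_le w s t : (s <= t)%N -> (ndist (word X s w) <= ndist (word X t w))%N.
Proof.
move=> /subnKC <-; elim: (t - s)%N => [|r IH]; first by rewrite addn0.
by rewrite addnS; case/orP: (ndist_wordS w (s + r)) => /eqP -> //; exact: leqW.
Qed.

Lemma ndist_word_max w t : (ndist (word X t w) <= t)%N.
Proof. by apply: leq_trans (size_undup _) _; rewrite size_tuple. Qed.

(** The number of distinct coupons never decreases and grows by at most one per draw, so the first
    visit to n - m is the step from n - m - 1. *)
Lemma waiting_timeS w t : W w = t.+1 <->
  (ndist (word X t.+1 w) == n - m)%N && (ndist (word X t w) == (n - m).-1)%N.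
Proof.
have N0 : (0 < n - m)%N by rewrite subn_gt0.
have step := ndist_wordS w t.
rewrite /W /waiting_time; case: pselect => [h|h]; last first.
  by split => // /andP[/eqP e _]; case: h; exists t.+1; rewrite num_distinctE e.
case: ex_minnP => s; rewrite num_distinctE => hs hmin; split => [e|/andP[h1 /eqP h2]].
  rewrite e in hs hmin; rewrite hs /=.
  case/orP: step => /eqP e2; last by rewrite -(eqP hs) e2.
  have := hmin t; rewrite num_distinctE -e2 hs => /(_ isT); by rewrite ltnn.
apply/eqP; rewrite eqn_leq hmin ?num_distinctE //= ltnNge; apply/negP => st.
by have := ndist_word_le w st; rewrite (eqP hs) h2 leqNgt ltn_predL N0.
Qed.

Lemma waiting_time0 w t : W w = 0%N -> (ndist (word X t w) < n - m)%N.
Proof.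
have N0 : (0 < n - m)%N by rewrite subn_gt0.
rewrite /W /waiting_time; case: pselect => [h|h].
  case: ex_minnP => s; rewrite num_distinctE => hs _ e; move: hs N0.
  by rewrite e => /eqP <-; rewrite ltnNge ndist_word_max.
move=> _; elim: t => [|t IH]; first by apply: leq_ltn_trans N0; exact: ndist_word_max.
rewrite ltn_neqAle; apply/andP; split.
  by apply/negP => e; case: h; exists t.+1; rewrite num_distinctE.
by case/orP: (ndist_wordS w t) => /eqP -> //; exact: ltnW.
Qed.

Lemma prob_waitingS t : measurable [set w | W w = t.+1] /\
  P [set w | W w = t.+1] = (m.+1%:R / n%:R * @occ K n t (n - m).-1)%:E.
Proof.
have N0 : (0 < n - m)%N by rewrite subn_gt0.
pose Q (x : t.+1.-tuple 'I_n) := (ndist x == (n - m).-1.+1) && (ndist (behead x) == (n - m).-1).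
have -> : [set w | W w = t.+1] = [set w | Q (word X t.+1 w)].
  by apply/seteqP; split => w /=; rewrite /Q prednK // => /waiting_timeS.
have [m1 ->] := prob_word n0 hX Q; split => //; congr _%:E.
rewrite sum_new_coupon /occ -natrB; last by lia.
rewrite exprS -mulr_sumr mulrA; congr (_%:R / _ * _); lia.
Qed.

Lemma waiting_measurable (B : set nat) : measurable [set w | B (W w)].
Proof.
have mS t : measurable [set w | W w = t.+1] by case: (prob_waitingS t).
have -> : [set w | B (W w)] = \bigcup_(s in B) [set w | W w = s].
  by apply/seteqP; split => [w h|w [s Bs /= e]]; [exists (W w)|rewrite e].
apply: bigcup_measurable => -[|t] _ //.
have -> : [set w | W w = 0%N] = ~` \bigcup_t [set w | W w = t.+1].
  apply/seteqP; split => w /=; first by move=> e [t _ /=]; rewrite e.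
  by case e : (W w) => [//|t] h; case: h; exists t.
by apply: measurableC; apply: bigcup_measurable.
Qed.

Lemma sum_occ_le i J : (i < n)%N -> \sum_(t < J) @occ K n t i <= n%:R.
Proof.
move=> ln; set x : fps K := fps_X ^+ i.+1 * \prod_(0 <= l < i.+1) geo (l%:R / (n%:R - l%:R)).
have sx : fnorm J.+1 x <= 1.
  apply: subprobM; first exact/subprobX/subprob_fps_X.
  rewrite big_seq_cond; apply: subprob_prod => l.
  rewrite mem_index_iota andbT => /andP[_ li]; apply: subprob_geo.
  by rewrite divr_ge0 // subr_ge0 ler_nat; apply: ltnW; apply: leq_ltn_trans ln.
have nR : 0 < n%:R :> K by rewrite ltr0n.
have := sx; rewrite /x -(occ_gf ln) /fnorm big_ord_recl -mulrA fcoef_cstM fcoef_XM mulr0 normr0 add0r.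
have occ_ge0 t : 0 <= @occ K n t i by apply: sumr_ge0 => y _; rewrite exprn_ge0 // invr_ge0.
under eq_bigr => t _.
  rewrite lift0 fcoef_cstM fcoef_XM /= ger0_norm; last first.
    by rewrite mulr_ge0 // divr_ge0 // subr_ge0 ler_nat ltnW.
  over.
rewrite -mulr_sumr mulrAC ler_pdivrMr // mul1r; apply: le_trans.
rewrite ler_peMl ?sumr_ge0 // -natrB ?(ltnW ln) // ler1n subn_gt0 //.
Qed.

(** Apart from the default value, W is positive, so W = 0 means that at every time fewer than n - m
    coupons have been seen. The expected time spent at each level is at most n by [sum_occ_le],
    hence p J <= (n - m) n for every J. *)
Lemma prob_waiting0 : P [set w | W w = 0%N] = 0%E.
Proof.
have m0 : measurable [set w | W w = 0%N] by exact: (waiting_measurable [set 0%N]).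
have fP : P [set w | W w = 0%N] \is a fin_num by exact: fin_num_measure.
rewrite -(fineK fP); congr _%:E; set p := fine _.
have p0 : 0 <= p by rewrite fine_ge0.
have pt t : p <= \sum_(i < n - m) @occ K n t i.
  have [m1 e] := prob_word n0 hX (fun x : t.-tuple 'I_n => (ndist x < n - m)%N).
  have : (P [set w | W w = 0%N] <= P [set w | (ndist (word X t w) < n - m)%N])%E.
    by apply: le_measure; rewrite ?inE // => w; exact: waiting_time0.
  rewrite e -(fineK fP) lee_fin => /le_trans; apply.
  rewrite /occ (big_mkcond (fun x : t.-tuple 'I_n => ndist x < _)%N) /=.
  under [leRHS]eq_bigr => i _ do rewrite big_mkcond.
  rewrite exchange_big; apply: ler_sum => x _ /=.
  case: ifP => [h|_]; first by rewrite (bigD1 (Ordinal h)) //= eqxx lerDl;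
    apply: sumr_ge0 => i _; case: ifP => //; rewrite exprn_ge0 // invr_ge0.
  by apply: sumr_ge0 => i _; case: ifP => //; rewrite exprn_ge0 // invr_ge0.
apply/eqP; rewrite eq_le p0 andbT leNgt; apply/negP => pp.
have bd J : p * J%:R <= (n - m)%:R * n%:R.
  apply: (@le_trans _ _ (\sum_(t < J) \sum_(i < n - m) @occ K n t i)).
    rewrite -[J in leLHS]card_ord mulr_natr -sumr_const; exact: ler_sum.
  rewrite exchange_big /= -[X in X%:R * _]card_ord mulr_natl -sumr_const.
  by apply: ler_sum => i _; apply: sum_occ_le; apply: leq_trans (ltn_ord i) (leq_subr _ _).
have := bd (Num.bound ((n - m)%:R * n%:R / p)); rewrite mulrC -ler_pdivlMr // leNgt.
by rewrite archi_boundP // divr_ge0.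
Qed.

Lemma prob_waiting s : fine (P [set w | W w = s]) =
  fcoef (fps_X ^+ (n - m) * geo_prod (odds_range m n) (odds n) 1 : fps K) s.
Proof.
rewrite -(occ_odds mn) -mulrA fcoef_cstM fcoef_XM.
case: s => [|t]; first by rewrite prob_waiting0 mulr0.
by case: (prob_waitingS t) => _ ->.
Qed.

Lemma mu_law_signed : @cshift K n m >= 0 -> signed_law (mu_law m P X).
Proof.
move=> c0; pose Y s : int := s%:Z - (n%:Z - m%:Z) + @cshift K n m.
have YE A : mu_law m P X A = P [set w | (Y @^-1` A) (W w)] by [].
split => [F _ triv _|A|A neg].
- rewrite YE preimage_bigcup.
  have := @measure_semi_sigma_additive _ _ _ P (fun i => [set w | (Y @^-1` F i) (W w)]).
  apply => [i||]; [exact: waiting_measurable| |exact: (waiting_measurable (\bigcup_n (Y @^-1` F n)))].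
  by move=> i j _ _ [w [/= h1 h2]]; apply: triv => //; exists (Y (W w)).
- by rewrite YE fin_num_measure //; exact: waiting_measurable.
rewrite YE; apply/eqP; rewrite -measure_le0 -prob_waiting0; apply: le_measure.
- by rewrite inE; exact: waiting_measurable.
- by rewrite inE; exact: (waiting_measurable [set 0%N]).
(* A positive waiting time is at least n - m; as the shift is nonnegative, negative values can only
   come from the null event W = 0. *)
move=> w /neg /=; case e : (W w) => [//|t].
have /andP[/eqP h _] := (waiting_timeS w t).1 e.
by have := ndist_word_max w t.+1; rewrite h /Y; move: c0; clear; lia.
Qed.

Lemma mu_law_point c j : @cshift K n m = c%:Z ->
  fine (mu_law m P X [set j%:Z]) = fcoef (interp (odds_range m n) (odds n) c 1 : fps K) j.
Proof.
move=> hc; rewrite interp1 fcoef_XnM /mu_law /pushforward hc.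
case: (leqP c (j + (n - m))) => cj; last first.
  rewrite (_ : _ @^-1` _ = set0) ?measure0; first by rewrite leqNgt (leq_ltn_trans _ cj) ?leq_addr.
  by apply/seteqP; split => // w /= ; move: cj mn; clear; lia.
rewrite (_ : _ @^-1` _ = [set w | W w = j + (n - m) - c]%N).
  rewrite prob_waiting fcoef_XnM (_ : (n - m <= _)%N = (c <= j)%N); last by lia.
  by case: ifP => // cj'; congr fcoef; lia.
by apply/seteqP; split => w /=; rewrite -/W; move: cj mn; clear; lia.
Qed.

End WaitingTime.

(** * Total variation bounds for the coupon law *)

Section Main.
Context {K : realType}.

Lemma dTV_coupon_le n m R c d (T : measurableType d) (P : probability T K)
    (X : nat -> T -> 'I_n) (nu : {charge set int -> \bar K}) (B : K) :
  (m < n)%N -> iid_uniform_draws P X -> (3 <= R)%N -> poisson_charlier n m R nu ->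
  Num.floor (acoef n m 2 : K) = c%:Z -> (~~ (1 < acoef n m 2 :> K) -> c = 0%N) ->
  (forall N, fnorm N (interp (odds_range m n) (odds n) c 1 -
    expw (pois_mean (odds_range m n) (odds n)) * peval_w
      (expp (if 1 < acoef n m 2 :> K then R else (3 * R - 2)%N)
        (logp (psum (odds_range m n) (odds n)) c R))) <= B) ->
  (dTV (mu_law m P X) nu <= B%:E)%E.
Proof.
move=> mn hX R3 hnu hc hc0 hB.
have E : psum (odds_range m n) (odds n) = acoef n m :> (nat -> K).
  by apply/funext => j; rewrite acoef_psum.
rewrite E in hB.
apply: dTV_le; [|exact: charge_law hnu.1|move=> N].
  by apply: (mu_law_signed mn hX); rewrite /cshift hc.
apply: le_trans (hB N); apply: ler_sum => j _; rewrite fcoefB.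
by rewrite (mu_law_point mn hX _ hc) (poisson_charlier_coef _ R3 (fun=> hc) hc0 hnu) sigma_sq_pois.
Qed.

Lemma acoef_floor n m (a := acoef n m 2 : K) (c := `|Num.floor a|%N) :
  Num.floor a = c%:Z /\ 0 <= a - c%:R <= 1.
Proof.
have a0 : 0 <= a by rewrite /a acoef_psum; apply: psum_ge0 => j; exact: odds_ge0.
have e : Num.floor a = c%:Z by rewrite /c gez0_abs // floor_ge0.
split=> //; have -> : c%:R = (Num.floor a)%:~R :> K by rewrite e.
have /andP[] := floor_itv a; rewrite intrD => h1 h2.
by rewrite subr_ge0 h1 lerBlDr addrC ltW.
Qed.

End Main.

Theorem corollary7p0p1 (K : realType) (R : nat) (hR3 : (3 <= R)%N) :
  exists (mR nR : nat) (CR : K), 0 < CR /\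
  forall n m : nat, (1 <= m <= n - 1)%N ->
  forall (d : measure_display) (T : measurableType d) (P : probability T K)
    (X : nat -> T -> 'I_n), iid_uniform_draws P X ->
  forall nu : {charge set int -> \bar K}, poisson_charlier n m R nu ->
  (1 < acoef n m 2 :> K -> (mR <= m)%N -> (nR <= n)%N ->
     (m%:R <= n%:R / 2 - 1 :> K ->
        (dTV (mu_law m P X) nu <=
         (CR * (sigma_n n m * ln (sigma_n n m)) *
          (1 / Num.sqrt m%:R) ^+ R)%:E)%E) /\
     (n%:R / 2 <= m%:R :> K ->
        (dTV (mu_law m P X) nu <=
         (CR * (Num.sqrt n%:R ^+ (R - 3) / (n%:R - m%:R) ^+ (R - 2)))%:E)%E))
  /\
  (acoef n m 2 < 1 :> K -> (nR <= n)%N ->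
     (dTV (mu_law m P X) nu <=
      (CR * ((n%:R - m%:R) / Num.sqrt n%:R ^+ R.+1))%:E)%E).
Proof.
have [n1 [C1 C1_gt0 small]] := @regime_small K R hR3.
have [n2 [C2 C2_gt0 half]] := @regime_half K R hR3.
have [m3 [C3 C3_gt0 tail]] := @regime_tail K R hR3.
(* [m3] serves m <= n/2 - 1, [n2] serves m >= n/2, and [n1] the case a_{n,2} < 1. *)
exists m3, (maxn n1 n2), (C1 + C2 + C3); split; first by rewrite !addr_gt0.
move=> n m hmn d T P X hX nu hnu.
have m0n : (0 < m < n)%N by lia.
have /andP[m0 mn] := m0n.
have [hc cI] := @acoef_floor K n m; set c := `|_|%N in hc cI.
have nm : n%:R - m%:R = (n - m)%:R :> K by rewrite natrB // ltnW.
rewrite [acoef n m 2]acoef_psum in cI.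
have pa1 : 1 < acoef n m 2 :> K -> 1 < psum (odds_range m n) (odds n) 2 :> K by rewrite acoef_psum.
split=> [a1 mR|a1]; rewrite geq_max => /andP[nR1 nR2].
  have main B := dTV_coupon_le (B := B) mn hX hR3 hnu hc.
  rewrite a1 in main.
  split=> h; rewrite ?nm.
    have mn2 : (2 * m <= n)%N by rewrite -(ler_nat K) natrM; lra.
    apply: main => // N; apply: le_trans (tail n m c m0 mn2 mR cI N) _.
    (* sigma_n >= 1 makes its logarithm nonnegative, so that [C3] may be enlarged to the sum of the
       constants. *)
    have pm1 : 1 <= pois_mean (odds_range m n) (odds n) :> K.
      rewrite /pois_mean -!acoef_psum; apply: le_trans (ltW a1) _.
      by rewrite lerDr acoef_psum; apply: psum_ge0 => j; exact: odds_ge0.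
    rewrite /sigma_n sigma_sq_pois ler_wpM2r ?exprn_ge0 ?divr_ge0 // ler_wpM2r //.
      by rewrite mulr_ge0 ?sqrtr_ge0 // ln_ge0 // -sqrtr1 ler_wsqrtr.
    by lra.
  have mn2 : (n <= 2 * m)%N by rewrite -(ler_nat K) natrM; lra.
  apply: main => // N; apply: le_trans (half n m c m0n mn2 cI (ltW (pa1 a1)) nR2 N) _.
  by rewrite ler_wpM2r ?divr_ge0 ?exprn_ge0 //; lra.
have c0 : c = 0%N.
  apply/eqP; rewrite -leqn0 -ltnS -(ltr_nat K); apply: le_lt_trans a1.
  by rewrite acoef_psum -subr_ge0; case/andP: cI.
rewrite nm; apply: (dTV_coupon_le mn hX hR3 hnu hc) => // N.
rewrite ltNge (ltW a1) c0; apply: le_trans (small n m m0n _ nR1 N) _; first by rewrite -acoef_psum.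
by rewrite ler_wpM2r ?divr_ge0 ?exprn_ge0 //; lra.
Qed.
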